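(* Let $K\in\mathcal{A}$ and let $M,N\in\mathcal{D}_{\mathcal{A}}$. Suppose, in addition, that the dissipative operators $M-K^*N^{-1}K$ and $N-KM^{-1}K^*$ are boundedly invertible. Then $$\xi(M,\,M-K^*N^{-1}K)=\xi(N,\,N-KM^{-1}K^* ).$$
   Context: $\mathcal{A}$ is a von Neumann algebra of finite type acting on a Hilbert space $\mathcal{H}$, and $\tau$ is a normal tracial state on $\mathcal{A}$. An operator $M\in\mathcal{A}$ is dissipative if $\mathrm{Im}\,M=\frac{1}{2\mathrm{i}}(M-M^* )\ge 0$. $\mathcal{D}_{\mathcal{A}}$ denotes the set of boundedly invertible dissipative operators in $\mathcal{A}$. For dissipative $M\in\mathcal{A}$, let $L$ be its minimal self-adjoint dilation: a (possibly unbounded) self-adjoint operator in a Hilbert space $\mathcal{K}\supset\mathcal{H}$ with $(M-zI)^{-1}=P_{\mathcal{H}}(L-zI)^{-1}|_{\mathcal{H}}$ for $\mathrm{Im}\,z<0$, where $P_{\mathcal{H}}$ is the orthogonal projection of $\mathcal{K}$ onto $\mathcal{H}$, and such that $\mathcal{K}$ is the closed linear span of the vectors $(L-zI)^{-1}h$, $h\in\mathcal{H}$, $z\in\mathbb{C}\setminus\mathbb{R}$. With $E_L$ the spectral measure of $L$, the $\Xi$-operator of $M$ is $$\Xi(M)=P_{\mathcal{H}}\left[E_L((-\infty,0))+\tfrac12E_L(\{0\})\right]\Big|_{\mathcal{H}},$$ which is an element of $\mathcal{A}$. When $M$ is boundedly invertible, $\Xi(M)=\frac1\pi\mathrm{Im}\log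 M$, where $\log$ is the principal branch with the cut along the negative imaginary semi-axis, defined by the Riesz functional calculus. The $\xi$-index of a pair $(M,N)$ of dissipative operators in $\mathcal{A}$ is $\xi(M,N)=\tau[\Xi(N)]-\tau[\Xi(M)]$. *)

(* Defs.v *)
From mathcomp Require Import all_boot all_order all_algebra complex.
From mathcomp Require Import all_classical all_reals all_analysis.

Set Implicit Arguments.
Unset Strict Implicit.
Unset Printing Implicit Defensive.

Import Order.TTheory GRing.Theory Num.Theory.
Import numFieldNormedType.Exports.

Local Open Scope classical_set_scope.
Local Open Scope ring_scope.
Local Open Scope complex_scope.

(* The inner product is linear in its first argument and conjugate-linear in
   its second. *)
Record hilbertType (R : realType) := HilbertType {
  hilbert_sort :> completeNormedModType R[i];
  hdot : {dot hilbert_sort for (@Num.conj R[i])};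
  hdot_norm : forall x : hilbert_sort, hdot x x = `|x| ^+ 2 }.

Arguments hdot {R h}.

Section BoundedOperators.
Context {R : realType}.
Implicit Types H K : hilbertType R.

(* Operators are plain functions with the pointwise module structure, the
   product being composition. *)
Definition bounded_op H K (T : H -> K) : Prop := linear T /\ continuous T.

Definition is_adjoint H K (T : H -> K) (S : K -> H) : Prop :=
  forall x y, hdot (T x) y = hdot x (S y).

Definition adj H (T : H -> H) : H -> H :=
  xget 0 [set S | bounded_op S /\ is_adjoint T S].

Definition is_inverse H (T S : H -> H) : Prop :=
  [/\ bounded_op S, T \o S = id & S \o T = id].

Definition boundedly_invertible H (T : H -> H) : Prop :=
  exists S, is_inverse T S.

Definition inv_op H (T : H -> H) : H -> H := xget 0 [set S | is_inverse T S].

(* [0 <= z] in R[i] means that z is real and nonnegative. *)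
Definition pos_op H (T : H -> H) : Prop := forall x, 0 <= hdot (T x) x.

Definition le_op H (S T : H -> H) : Prop := pos_op (T - S).

Definition im_op H (T : H -> H) : H -> H := (2 * 'i)^-1 *: (T - adj T).

Definition dissipative H (T : H -> H) : Prop := pos_op (im_op T).

Definition orthogonal_projection H (T : H -> H) : Prop :=
  [/\ bounded_op T, T \o T = T & is_adjoint T T].

End BoundedOperators.

Section VonNeumannAlgebras.
Context {R : realType} {H : hilbertType R}.
Implicit Types (A F : set (H -> H)) (tau : (H -> H) -> R[i]).

Definition commutant A : set (H -> H) :=
  [set T | bounded_op T /\ forall S, A S -> T \o S = S \o T].

Definition von_neumann_algebra A : Prop :=
  [/\ forall T, A T -> bounded_op T,
      forall T, A T -> exists2 S, A S & is_adjoint T S &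
      commutant (commutant A) = A].

(* The identity is a finite projection. *)
Definition finite_type A : Prop :=
  forall V, A V -> adj V \o V = id -> V \o adj V = id.

(* tau is only constrained, and only used, on A. *)
Definition state_on A tau : Prop :=
  [/\ forall c S T, A S -> A T -> tau (c *: S + T) = c * tau S + tau T,
      forall T, A T -> pos_op T -> 0 <= tau T &
      tau id = 1].

Definition tracial_on A tau : Prop :=
  forall S T, A S -> A T -> tau (S \o T) = tau (T \o S).

Definition op_directed F : Prop :=
  F !=set0 /\
  forall S T, F S -> F T -> exists U, [/\ F U, le_op S U & le_op T U].

Definition op_supremum A F T : Prop :=
  [/\ A T, forall S, F S -> le_op S T &
      forall U, A U -> (forall S, F S -> le_op S U) -> le_op T U].

(* The upward directed sets are the ranges of the increasing nets. *)
Definition normal_on A tau : Prop :=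
  forall F T, F `<=` A -> (forall S, F S -> is_adjoint S S) ->
    op_directed F -> op_supremum A F T -> supremums (tau @` F) (tau T).

Definition normal_tracial_state A tau : Prop :=
  [/\ state_on A tau, tracial_on A tau & normal_on A tau].

Definition invertible_dissipative A : set (H -> H) :=
  [set M | [/\ A M, dissipative M & boundedly_invertible M]].

End VonNeumannAlgebras.

Section SelfAdjointOperators.
Context {R : realType}.
Implicit Type K : hilbertType R.

Definition is_subspace K (V : set K) : Prop :=
  V 0 /\ forall c x y, V x -> V y -> V (c *: x + y).

Definition closed_span K (V : set K) : set K :=
  closure (smallest (@is_subspace K) V).

(* The values of uop outside udom are irrelevant. *)
Record unbounded_operator K := UnboundedOperator {
  udom : set K;
  uop :> K -> K;
  udom_subspace : is_subspace udom;
  uop_linear : forall c x y, udom x -> udom y ->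
    uop (c *: x + y) = c *: uop x + uop y }.

(* The right-hand side of the second conjunct says that (y, z) is in the graph
   of L, the left-hand side that it is in the graph of the adjoint of L. *)
Definition self_adjoint K (L : unbounded_operator K) : Prop :=
  dense (udom L) /\
  forall y z, (forall x, udom L x -> hdot (L x) y = hdot x z) <->
              (udom L y /\ L y = z).

Definition resolvent K (L : unbounded_operator K) (z : R[i]) (h : K) : K :=
  xget 0 [set x | udom L x /\ L x - z *: x = h].

(* A projection-valued measure on the Borel sets of the line. Countable
   additivity is that of the scalar measures B |-> <E(B)x, x>. *)
Record projection_measure K := ProjectionMeasure {
  pvm :> set (measurableTypeR R) -> K -> K;
  pvm_scalar : K -> {measure set (measurableTypeR R) -> \bar R};
  pvm_projection : forall B, measurable B -> orthogonal_projection (pvm B);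
  pvm_setT : pvm setT = id;
  pvm_setI : forall B C, measurable B -> measurable C ->
    pvm (B `&` C) = pvm B \o pvm C;
  pvm_scalarE : forall x B, measurable B ->
    pvm_scalar x B = (complex.Re (hdot (pvm B x) x))%:E }.

(* L = \int l dE(l), with its maximal domain. The quadratic form of L
   determines <L x, y> by polarization. *)
Definition spectral_measure_of K (L : unbounded_operator K)
    (E : projection_measure K) : Prop :=
  udom L =
    [set x | (\int[pvm_scalar E x]_(l in setT) (l ^+ 2)%:E < +oo)%E] /\
  forall x, udom L x ->
    hdot (L x) x = (Rintegral (pvm_scalar E x) setT id)%:C.

End SelfAdjointOperators.

Section XiIndex.
Context {R : realType} {H : hilbertType R}.

(* The inclusion of H in dil_space is the isometry dil_emb; its adjoint
   dil_proj is the orthogonal projection onto H, as a map with values in H. *)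
Record minimal_dilation (M : H -> H) := MinimalDilation {
  dil_space : hilbertType R;
  dil_emb : H -> dil_space;
  dil_proj : dil_space -> H;
  dil_op : unbounded_operator dil_space;
  dil_spectral : projection_measure dil_space;
  dil_emb_linear : linear dil_emb;
  dil_emb_isometry : forall x y, hdot (dil_emb x) (dil_emb y) = hdot x y;
  dil_proj_adjoint : is_adjoint dil_emb dil_proj;
  dil_op_self_adjoint : self_adjoint dil_op;
  dil_op_spectral : spectral_measure_of dil_op dil_spectral;
  dil_resolvent : forall z : R[i], complex.Im z < 0 -> forall h,
    inv_op (M - z *: id) h = dil_proj (resolvent dil_op z (dil_emb h));
  dil_minimal :
    closed_span [set k | exists (z : R[i]) (h : H),
      complex.Im z != 0 /\ k = resolvent dil_op z (dil_emb h)] = setT }.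

Arguments dil_emb {M}.
Arguments dil_proj {M}.
Arguments dil_op {M}.
Arguments dil_spectral {M}.

Definition Xi (M : H -> H) (D : minimal_dilation M) : H -> H :=
  dil_proj D \o (dil_spectral D `]-oo, 0[%classic
                 + 2^-1 *: dil_spectral D [set 0]) \o dil_emb D.

Definition xi_index (tau : (H -> H) -> R[i]) (M N : H -> H)
    (DM : minimal_dilation M) (DN : minimal_dilation N) : R[i] :=
  tau (Xi DN) - tau (Xi DM).

End XiIndex.

(* Main.v *)
From HB Require Import structures.
Require Import Defs.
From mathcomp Require Import all_boot all_order all_algebra complex.
From mathcomp Require Import all_classical all_reals all_analysis.
From mathcomp Require Import measurable_realfun ring lra.

Set Implicit Arguments.
Unset Strict Implicit.
Unset Printing Implicit Defensive.

Import Order.TTheory GRing.Theory Num.Theory.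
Import numFieldNormedType.Exports.

Local Open Scope classical_set_scope.
Local Open Scope ring_scope.
Local Open Scope complex_scope.

(** For an invertible dissipative operator M, pi Xi (M) is the imaginary part
of log M, so pi tau (Xi (M)) is the argument of a determinant of M. The block
matrix with rows M, K^* and K, N has the two Schur factorizations, hence
  det M det (N - K M^-1 K^* ) = det N det (M - K^* N^-1 K),
and the theorem is the equality of the arguments. It holds without any integer
multiple of 2 pi because the four operators can be deformed to simple ones
while staying dissipative and invertible.

The logarithm enters only through its integral along a straight segment: for
a functional omega, segment_log omega F is the integral of
omega (F_w^-1 (F - i)) over the segment F_w from i to F. Two facts about it
carry the proof.

The first one, dissipative_log_schur, is the determinant identity. If omega is
tracial, the first order variation of segment_log at F is omega (F^-1 dF)
(segment_log_increment). Moving M to i with K and N fixed, these variations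
cancel in the combination of the theorem (log_defect_segment), and so do those
obtained by moving N to i; for M = N = i the identity is clear
(log_defect_base). Along the way all operators are dissipative and uniformly
bounded below, which makes their segments from i invertible with uniform
bounds (dissipative_segment, schur_segment_exists).

The second one, tau_Xi, identifies tau (Xi (M)) with 1/2 plus segment_log
divided by pi, for omega the imaginary part of tau. It is first proved for the
functional T |-> Im <T y, y> (segment_log_vec). There the integrand is a
resolvent form of the dilation L, that is an integral of a rational function of
the spectral parameter l against the scalar spectral measure of y
(resolvent_form, proved from the definition of the spectral measure by cutting
the line into short intervals), and integrating in w turns it into an angle,
minus pi / 2 times the sign of l (segment_integral). Riemann sums of the operators
F_w^-1 (F - i) then show that Xi (M) is a limit in norm of elements of the
algebra and carry the formula over to tau.

Derivatives are avoided nearly everywhere: a function whose increments over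
[u, v] are bounded by (v - u) times the increment of another function is
constant (increment_bound). *)

(** * Increments of real functions *)

Lemma ler_add_invnat (R : realType) (x y c : R) :
  (forall n : nat, x <= y + c / n.+1%:R) -> x <= y.
Proof.
move=> xy; have [c0|c0] := leP c 0.
  by apply: (le_trans (xy 0%N)); rewrite divr1 gerDl.
apply/ler_addgt0Pr => e e0.
have [n cn] : exists n : nat, c / e < n.+1%:R.
  exists (Num.Def.archi_bound (c / e)); have := archi_boundP (divr_ge0 (ltW c0) (ltW e0)).
  by move=> h; apply: (lt_trans h); rewrite ltr_nat.
apply: (le_trans (xy n)); rewrite lerD2l ler_pdivrMr//.
by rewrite ltr_pdivrMr// in cn; rewrite mulrC ltW.
Qed.

(** A mean value inequality that asks for no derivative. Cut [a, b] into n
equal pieces: the D-terms add up to D (b - a), and the m-terms telescope to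
(m b - m a) (b - a) / n, which vanishes as n grows. With m x = C x it applies
to errors that are quadratic in v - u; with m the distribution function of a
finite measure it applies to functions of the spectral parameter. *)
Lemma increment_bound (R : realType) (h m : R -> R) (a b D : R) : a <= b ->
  (forall u v, a <= u -> u <= v -> v <= b ->
     `|h v - h u| <= (D + (m v - m u)) * (v - u)) ->
  `|h b - h a| <= D * (b - a).
Proof.
move=> ab H.
apply: (@ler_add_invnat R _ _ ((m b - m a) * (b - a))) => n.
set N := n.+1%:R : R; have N0 : 0 < N by rewrite ltr0n.
pose t k := a + k%:R * ((b - a) / N).
have st : 0 <= (b - a) / N by rewrite divr_ge0 ?subr_ge0 // ltW.
have t0 : t 0%N = a by rewrite /t mul0r addr0.
have tN : t n.+1 = b by rewrite /t mulrC divfK ?gt_eqF// addrC subrK.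
have tS k : t k.+1 = t k + (b - a) / N by rewrite /t -natr1 mulrDl mul1r addrA.
have tle k : (k <= n.+1)%N -> t k <= b.
  by move=> kn; rewrite -tN /t lerD2l ler_wpM2r// ler_nat.
have tge k : a <= t k by rewrite /t lerDl mulr_ge0.
have E k : (k <= n.+1)%N ->
    `|h (t k) - h a| <= (k%:R * D + (m (t k) - m a)) * ((b - a) / N).
  elim: k => [|k IH] kn; first by rewrite t0 !subrr normr0 mul0r add0r mul0r.
  have -> : h (t k.+1) - h a = (h (t k.+1) - h (t k)) + (h (t k) - h a) by ring.
  apply: le_trans (ler_normD _ _) _.
  have := H (t k) (t k.+1) (tge k) _ (tle _ kn).
  rewrite tS lerDl => /(_ st) h1.
  have h2 := IH (ltnW kn).
  apply: (le_trans (lerD h1 h2)); rewrite -natr1.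
  rewrite le_eqVlt; apply/orP; left; apply/eqP.
  ring.
have := E _ (leqnn _); rewrite tN => /le_trans; apply.
by rewrite -/N le_eqVlt; apply/orP; left; apply/eqP; field; rewrite gt_eqF.
Qed.

Definition mean01 (R : realType) (f : R -> R) : R :=
  \int[lebesgue_measure]_(t in `[0, 1]) f t.

(** Integrals over [0, 1] are only used through such a primitive: comparing two
of them with increment_bound replaces differentiation under the integral, and
summing the estimate over a subdivision gives Riemann sums with an error 1/n. *)
Lemma lipschitz_primitive (R : realType) (f : R -> R) (C : R) :
  (forall u v : R, 0 <= u -> u <= v -> v <= 1 -> `|f v - f u| <= C * (v - u)) ->
  exists F : R -> R, F 1 - F 0 = mean01 f /\
    forall u v : R, 0 <= u -> u <= v -> v <= 1 ->
      `|F v - F u - (v - u) * f u| <= C * (v - u) ^+ 2.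
Proof.
move=> fC.
have C0 : 0 <= C.
  by have := fC 0 1 (lexx _) ler01 (lexx _); rewrite subr0 mulr1; apply: le_trans.
have f_lip (u v : R) : 0 <= u <= 1 -> 0 <= v <= 1 -> `|f v - f u| <= C * `|v - u|.
  move=> /andP[u0 u1] /andP[v0 v1]; have [uv|vu] := leP u v.
    rewrite (ger0_norm (_ : 0 <= v - u)) ?subr_ge0//; exact: fC.
  rewrite -normrN opprB -(normrN (v - u)) opprB (ger0_norm (_ : 0 <= u - v));
    last by rewrite subr_ge0 ltW.
  by apply: fC => //; exact: ltW.
have fc : {within `[0, 1], continuous f}.
  apply/(@subspace_continuousP _ _ _ f) => x /=.
  rewrite in_itv/= => x01; apply/cvgrPdist_le => e e0.
  near=> y; have y01 : 0 <= y <= 1.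
    by have : `[0, 1]%classic y by near: y; exact: withinT.
  apply: (le_trans (f_lip _ _ y01 x01)).
  have h : `|x - y| <= e / (C + 1).
    near: y; apply: (@cvgr_dist_le _ _ _ (within _ (nbhs x)) _ id x); first exact: cvg_within.
    by rewrite divr_gt0 // ltr_wpDl.
  apply: (le_trans (ler_wpM2l C0 h)).
  by rewrite mulrA ler_pdivrMr ?ltr_wpDl// mulrC ler_wpM2l ?lerDl// ltW.
have fi : lebesgue_measure.-integrable `[0, 1] (EFin \o f).
  exact: (continuous_compact_integrable (@segment_compact _ _ _)).
exists (fun x => \int[lebesgue_measure]_(t in `[0, x]) f t); split.
  by rewrite set_itv1 Rintegral_set1 subr0.
move=> u v u0 uv v1.
have sub : `]u, v]%classic `<=` `[0, 1]%classic.
  move=> x /=; rewrite !in_itv/= => /andP[ux xv].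
  by rewrite (le_trans u0 (ltW ux)) (le_trans xv v1).
have fiuv : lebesgue_measure.-integrable `]u, v] (EFin \o f).
  by apply: integrableS fi => //; exact: measurable_itv.
rewrite (@Rintegral_itvB _ f (BLeft 0) (BRight v)); last 3 first.
- apply: integrableS fi => //; move=> x /=; rewrite !in_itv/= => /andP[-> xv] /=.
  exact: le_trans v1.
- by rewrite bnd_simp.
- by rewrite bnd_simp.
have muv : fine (lebesgue_measure `]u, v]) = v - u.
  rewrite lebesgue_measure_itv/= lte_fin; case: ltP => //= vu.
  by rewrite (le_anti (introT andP (conj uv vu))) subrr.
have fin : (lebesgue_measure `]u, v] < +oo :> \bar R)%E.
  by rewrite lebesgue_measure_itv/=; case: ifP => //; rewrite ltry.
have icst r : lebesgue_measure.-integrable `]u, v] (EFin \o (fun=> r : R)).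
  apply: (@integrableS _ (measurableTypeR R) _ _ `[0, 1] `]u, v]) => //.
  apply: continuous_compact_integrable; first exact: segment_compact.
  by apply: continuous_subspaceT => x; exact: cvg_cst.
have -> : (v - u) * f u = \int[lebesgue_measure]_(t in `]u, v]) f u.
  by rewrite Rintegral_cst// muv mulrC.
rewrite -RintegralB//.
have iB : lebesgue_measure.-integrable `]u, v] (EFin \o (fun t => f t - f u)).
  exact: (@integrableB _ (measurableTypeR R) _ _ _ _ (EFin \o f) (EFin \o (fun=> f u))).
apply: (le_trans (le_normr_Rintegral _ iB)) => //.
apply: (@le_trans _ _ (\int[lebesgue_measure]_(t in `]u, v]) (C * (v - u)))).
  apply: le_Rintegral => //.
    exact: (integrable_norm iB).
  move=> x /=; rewrite in_itv/= => /andP[ux xv].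
  apply: le_trans (fC _ _ u0 (ltW ux) (le_trans xv v1)) _.
  by rewrite ler_wpM2l// lerD2r.
by rewrite Rintegral_cst// muv expr2 mulrA.
Unshelve. all: by end_near. Qed.

(** * The logarithm along segments, in an algebra with a bounded functional *)

(** An operator norm, known only through its upper bounds: bnd b x stands for
the inequality saying that the norm of x is at most b. The constants of the
estimates below are then found by unification. *)
Record norm_bound (R : realType) (B : unitAlgType R) (bnd : R -> B -> Prop) :
    Prop := NormBound {
  bnd_ge0 : forall b x, bnd b x -> 0 <= b;
  bnd_ex : forall x, exists b, bnd b x;
  bndW : forall a b x, a <= b -> bnd a x -> bnd b x;
  bndD : forall a b x y, bnd a x -> bnd b y -> bnd (a + b) (x + y);
  bndZ : forall r b x, bnd b x -> bnd (`|r| * b) (r *: x);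
  bndM : forall a b x y, bnd a x -> bnd b y -> bnd (a * b) (x * y) }.

Definition bounded_functional (R : realType) (B : unitAlgType R)
    (bnd : R -> B -> Prop) (c : R) (omega : B -> R) : Prop :=
  [/\ 0 <= c, forall a x y, omega (a *: x + y) = a * omega x + omega y &
      forall b x, bnd b x -> `|omega x| <= c * b].

Section SegmentLogarithm.
Variables (R : realType) (B : unitAlgType R) (bnd : R -> B -> Prop).
Hypothesis bndP : norm_bound bnd.
Variable J : B.

Definition segment (F : B) (w : R) : B := J + w *: (F - J).

Definition invertible_segment (p : R) (F : B) : Prop :=
  forall w, 0 <= w <= 1 ->
    segment F w \is a GRing.unit /\ bnd p (segment F w)^-1.

(** The integral of omega (F_w^-1 dF_w) along the segment F_w from J to F.
When J is the imaginary unit and omega is the imaginary part of a trace or of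
a vector functional, this is omega (log F - log J) for the branch of the
logarithm that is continuous on the dissipative operators. *)
Definition segment_log (omega : B -> R) (F : B) : R :=
  mean01 (fun w => omega ((segment F w)^-1 * (F - J))).

(** The Riemann sum of the same integral before omega is applied: one element
of the algebra that approximates segment_log for all functionals at once. *)
Definition segment_sum (F : B) (n : nat) : B :=
  n.+1%:R^-1 *: \sum_(k < n.+1)
    ((segment F (k%:R / n.+1%:R))^-1 * (F - J)).

Lemma segment1 F : segment F 1 = F.
Proof. by rewrite /segment scale1r addrC subrK. Qed.

Lemma resolvent_identity (x y : B) : x \is a GRing.unit -> y \is a GRing.unit ->
  y^-1 - x^-1 = - (y^-1 * (y - x) * x^-1).
Proof.
by move=> ux uy; rewrite mulrBr mulVr// mulrBl mul1r -mulrA divrr// mulr1 opprB.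
Qed.

Lemma resolvent_identity' (x y : B) : x \is a GRing.unit -> y \is a GRing.unit ->
  y^-1 - x^-1 = - (x^-1 * (y - x) * y^-1).
Proof.
by move=> ux uy; rewrite mulrBr mulVr// mulrBl mul1r -mulrA divrr// mulr1 opprB.
Qed.

Section Functional.
Variables (c : R) (omega : B -> R).
Hypothesis om : bounded_functional bnd c omega.

Lemma functionalP a x y : omega (a *: x + y) = a * omega x + omega y.
Proof. by case: om. Qed.

Lemma functionalD x y : omega (x + y) = omega x + omega y.
Proof. by rewrite -[x]scale1r functionalP mul1r scale1r. Qed.

Lemma functional0 : omega 0 = 0.
Proof. by apply: (addrI (omega 0)); rewrite -functionalD !addr0. Qed.

Lemma functionalZ a x : omega (a *: x) = a * omega x.
Proof. by rewrite -[_ *: _]addr0 functionalP functional0 addr0. Qed.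

Lemma functionalN x : omega (- x) = - omega x.
Proof. by rewrite -scaleN1r functionalZ mulN1r. Qed.

Lemma functionalB x y : omega (x - y) = omega x - omega y.
Proof. by rewrite functionalD functionalN. Qed.

Lemma functional_sum n (f : 'I_n -> B) : omega (\sum_i f i) = \sum_i omega (f i).
Proof. by apply: (big_morph omega functionalD functional0). Qed.

Lemma functional_le b x : bnd b x -> `|omega x| <= c * b.
Proof. by case: om => _ _; apply. Qed.

Lemma segmentB F u v : segment F v - segment F u = (v - u) *: (F - J).
Proof. by rewrite /segment opprD addrACA subrr add0r -scalerBl. Qed.

Section Primitive.
Variables (p b : R) (F : B).
Hypotheses (segF : invertible_segment p F) (Fb : bnd b (F - J)).

Lemma segment_invB u v : 0 <= u <= 1 -> 0 <= v <= 1 ->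
  (segment F v)^-1 - (segment F u)^-1 =
  - (v - u) *: ((segment F v)^-1 * (F - J) * (segment F u)^-1).
Proof.
move=> u01 v01; rewrite resolvent_identity; [|exact: (segF _).1..].
by rewrite segmentB -scalerAr -scalerAl scaleNr.
Qed.

Lemma segment_log_primitive : exists Phi : R -> R,
  Phi 1 - Phi 0 = segment_log omega F /\
  forall u v : R, 0 <= u -> u <= v -> v <= 1 ->
    `|Phi v - Phi u - (v - u) * omega ((segment F u)^-1 * (F - J))| <=
    c * ((p * b) ^+ 2) * (v - u) ^+ 2.
Proof.
apply: lipschitz_primitive => u v u0 uv v1.
have u01 : 0 <= u <= 1 by rewrite u0 (le_trans uv).
have v01 : 0 <= v <= 1 by rewrite v1 (le_trans u0).
rewrite -functionalB -mulrBl segment_invB// -scalerAl functionalZ normrM normrN.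
rewrite (ger0_norm (_ : 0 <= v - u)) ?subr_ge0// mulrC ler_wpM2r ?subr_ge0//.
apply: functional_le.
have -> : (p * b) ^+ 2 = p * b * p * b by ring.
by repeat (first [exact: (segF _).2 | exact: Fb | apply: (bndM bndP)]).
Qed.

Lemma segment_sum_approx n :
  `|segment_log omega F - omega (segment_sum F n)| <=
  c * (p * b) ^+ 2 / n.+1%:R.
Proof.
have [Phi [<- Phi_prim]] := segment_log_primitive.
set N := n.+1%:R : R; have N0 : 0 < N by rewrite ltr0n.
pose t k : R := k%:R / N.
have tS k : t k.+1 - t k = N^-1 by rewrite /t -mulrBl -natrB// subSn// subnn mul1r.
have -> : Phi 1 - Phi 0 = \sum_(k < n.+1) (Phi (t k.+1) - Phi (t k)).
  rewrite -(big_mkord xpredT (fun k => Phi (t k.+1) - Phi (t k))).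
  by rewrite telescope_sumr// /t mul0r divff// gt_eqF.
rewrite functionalZ functional_sum mulr_sumr -sumrB.
apply: (le_trans (ler_norm_sum _ _ _)).
have -> : c * (p * b) ^+ 2 / N = \sum_(k < n.+1) (c * (p * b) ^+ 2 / N ^+ 2).
  by rewrite sumr_const card_ord -[RHS]mulr_natr -/N; field; rewrite gt_eqF.
apply: ler_sum => k _.
have := Phi_prim (t k) (t k.+1).
rewrite tS exprVn; apply.
- by rewrite divr_ge0// ltW.
- by rewrite -subr_ge0 tS invr_ge0 ltW.
- by rewrite ler_pdivrMr// mul1r ler_nat.
Qed.

End Primitive.

Section Trace.
Hypothesis omegaC : forall x y, omega (x * y) = omega (y * x).

(** First order variation of the logarithm. Write D for F1 - F0 and P for the
inverse of the segment of F0 at w. To first order in D the integrand changes by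
omega (P D) - w omega (P (F0 - J) P D), after one use of the trace property;
this is the derivative in w of w omega (P D), so it integrates to
omega (F0^-1 D), and what is left is quadratic in D. *)
Lemma segment_log_increment p b d (F0 F1 : B) :
  invertible_segment p F0 -> invertible_segment p F1 ->
  bnd b (F0 - J) -> bnd d (F1 - F0) ->
  `|segment_log omega F1 - segment_log omega F0 -
    omega (F0^-1 * (F1 - F0))| <= c * (p ^+ 2 + p ^+ 3 * b) * d ^+ 2.
Proof.
move=> s0 s1 Fb Fd.
have [Phi0 [E0 H0]] := segment_log_primitive s0 Fb.
have Fb1 : bnd (d + b) (F1 - J).
  by rewrite -[F1](subrK F0) -addrA; apply: (bndD bndP).
have [Phi1 [E1 H1]] := segment_log_primitive s1 Fb1.
set D := F1 - F0; set G := F0 - J.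
pose P w := (segment F0 w)^-1; pose Q w := (segment F1 w)^-1.
pose h w := w * omega (P w * D).
pose C := c * ((p * (d + b)) ^+ 2) + c * ((p * b) ^+ 2) +
   c * (p * b * p * d + p * b * p * b * p * d).
have c0 : 0 <= c by case: om.
have bP w : 0 <= w <= 1 -> bnd p (P w) by move=> /s0[].
have bQ w : 0 <= w <= 1 -> bnd p (Q w) by move=> /s1[].
(* The integrands agree up to the derivative of h and a term quadratic in D. *)
have Hpsi w : 0 <= w <= 1 ->
    `|omega (Q w * (F1 - J)) - omega (P w * G) -
      (omega (P w * D) - w * omega (P w * G * P w * D))| <=
    c * (p ^+ 2 + p ^+ 3 * b) * d ^+ 2.
  move=> w01; have /andP[w0 w1] := w01.
  have segD : segment F1 w - segment F0 w = w *: D.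
    by rewrite /segment opprD addrACA subrr add0r -scalerBr opprB addrA subrK.
  have QP : Q w - P w = - w *: (Q w * D * P w).
    rewrite /Q /P resolvent_identity; [|exact: (s0 _ _).1|exact: (s1 _ _).1].
    by rewrite segD -scalerAr -scalerAl scaleNr.
  have QP' : Q w - P w = - w *: (P w * D * Q w).
    rewrite /Q /P resolvent_identity'; [|exact: (s0 _ _).1|exact: (s1 _ _).1].
    by rewrite segD -scalerAr -scalerAl scaleNr.
  have -> : omega (Q w * (F1 - J)) - omega (P w * G) -
      (omega (P w * D) - w * omega (P w * G * P w * D)) =
      w ^+ 2 * omega (P w * D * Q w * D * P w * G) - w * omega (Q w * D * P w * D).
    have -> : F1 - J = D + G by rewrite /D /G addrA subrK.
    have e1 : omega (Q w * D) = omega (P w * D) - w * omega (Q w * D * P w * D).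
      by rewrite -[Q w in LHS](subrK (P w)) QP mulrDl functionalD -scalerAl functionalZ mulNr addrC.
    have e2 : omega (Q w * G) = omega (P w * G) - w * omega (P w * D * Q w * G).
      by rewrite -[Q w in LHS](subrK (P w)) QP' mulrDl functionalD -scalerAl functionalZ mulNr addrC.
    have e3 : omega (P w * D * Q w * G) = omega (P w * D * P w * G)
        - w * omega (P w * D * Q w * D * P w * G).
      rewrite -[in LHS]mulrA -[Q w in LHS](subrK (P w)) QP mulrDl mulrDr functionalD.
      by rewrite -scalerAl -scalerAr functionalZ mulNr addrC !mulrA.
    have e4 : omega (P w * G * P w * D) = omega (P w * D * P w * G).
      by rewrite -mulrA omegaC !mulrA.
    by rewrite mulrDr functionalD e1 e2 e3 e4; ring.
  apply: (le_trans (ler_normB _ _)).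
  rewrite (normrM w (omega _)) (normrM (w ^+ 2)) normrX (ger0_norm w0).
  have -> : c * (p ^+ 2 + p ^+ 3 * b) * d ^+ 2 =
    c * (p * d * p * d * p * b) + c * (p * d * p * d) by ring.
  have le1 (x y : R) : 0 <= x <= 1 -> 0 <= y -> x * y <= y.
    by move=> /andP[_ x1] y0; rewrite ler_piMl.
  apply: lerD.
    apply: le_trans (le1 _ _ _ (normr_ge0 _)) _.
      by rewrite sqr_ge0 exprn_ile1.
    apply: functional_le.
    by repeat (first [exact: bP | exact: bQ | exact: Fb | exact: Fd | apply: (bndM bndP)]).
  apply: le_trans (le1 _ _ w01 (normr_ge0 _)) _.
  apply: functional_le.
  by repeat (first [exact: bP | exact: bQ | exact: Fb | exact: Fd | apply: (bndM bndP)]).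
(* The function h has that derivative, with a quadratic error. *)
have Hh (u v : R) : 0 <= u <= 1 -> 0 <= v <= 1 ->
    `|h v - h u - (v - u) * (omega (P u * D) - u * omega (P u * G * P u * D))|
    <= c * (p * b * p * d + p * b * p * b * p * d) * (v - u) ^+ 2.
  move=> u01 v01.
  have PB := segment_invB s0 u01 v01; rewrite -/(P v) -/(P u) -/G in PB.
  have -> : h v - h u - (v - u) * (omega (P u * D) - u * omega (P u * G * P u * D))
     = - ((omega (P v * G * P u * D) - u * omega (P v * G * P u * G * P u * D)) * (v - u) ^+ 2).
    have e1 : omega (P v * D) = omega (P u * D) - (v - u) * omega (P v * G * P u * D).
      by rewrite -[P v in LHS](subrK (P u)) PB mulrDl functionalD -scalerAl functionalZ mulNr addrC.
    have e2 : omega (P u * G * P u * D) = omega (P v * G * P u * D)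
        + (v - u) * omega (P v * G * P u * G * P u * D).
      have Pu : P u = P v + (v - u) *: (P v * G * P u).
        by rewrite -[_ *: _]opprK -scaleNr -PB opprB addrC subrK.
      by rewrite {1}Pu !mulrDl functionalD -!scalerAl functionalZ -mulrDl.
    rewrite /h e1 e2; ring.
  rewrite normrN normrM (ger0_norm (sqr_ge0 _)) ler_wpM2r ?sqr_ge0//.
  apply: (le_trans (ler_normB _ _)); rewrite (mulrDr c); apply: lerD.
    apply: functional_le.
    by repeat (first [exact: bP | exact: bQ | exact: Fb | exact: Fd | apply: (bndM bndP)]).
  have /andP[u0 u1] := u01.
  rewrite normrM (ger0_norm u0).
  apply: le_trans (_ : _ <= `|omega (P v * G * P u * G * P u * D)|) _.
    by rewrite ler_piMl.
  apply: functional_le.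
  by repeat (first [exact: bP | exact: bQ | exact: Fb | exact: Fd | apply: (bndM bndP)]).
pose Psi x := Phi1 x - Phi0 x - h x.
have -> : segment_log omega F1 - segment_log omega F0 - omega (F0^-1 * D) = Psi 1 - Psi 0.
  by rewrite /Psi -E0 -E1 /h /P segment1; ring.
rewrite -[leRHS]mulr1 -[X in _ <= _ * X](subr0 1).
apply: (@increment_bound R Psi (fun x => C * x)) => // u v u0 uv v1.
have u01 : 0 <= u <= 1 by rewrite u0 (le_trans uv).
have v01 : 0 <= v <= 1 by rewrite v1 (le_trans u0).
have uv0 : 0 <= v - u by rewrite subr_ge0.
set A0 := c * _ * _.
have -> : (A0 + (C * v - C * u)) * (v - u) = A0 * (v - u) + C * (v - u) ^+ 2 by ring.
pose X1 := Phi1 v - Phi1 u - (v - u) * omega (Q u * (F1 - J)).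
pose X0 := Phi0 v - Phi0 u - (v - u) * omega (P u * G).
pose X2 := h v - h u - (v - u) * (omega (P u * D) - u * omega (P u * G * P u * D)).
pose X3 := (omega (Q u * (F1 - J)) - omega (P u * G) -
      (omega (P u * D) - u * omega (P u * G * P u * D))).
have -> : Psi v - Psi u = X3 * (v - u) + (X1 - X0 - X2).
  by rewrite /Psi /X0 /X1 /X2 /X3; ring.
apply: (le_trans (ler_normD _ _)); apply: lerD.
  by rewrite normrM (ger0_norm uv0) ler_wpM2r// Hpsi.
apply: (le_trans (ler_normB _ _)); rewrite /C 2!mulrDl.
by apply: lerD; [apply: (le_trans (ler_normB _ _)); apply: lerD; [exact: H1|exact: H0]|exact: Hh].
Qed.
End Trace.
End Functional.
End SegmentLogarithm.

(** * Schur complements have the same logarithmic defect *)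

Section SchurComplements.
Variables (R : realType) (B : unitAlgType R) (bnd : R -> B -> Prop).
Hypothesis bndP : norm_bound bnd.
Variables (J : B) (c : R) (omega : B -> R).
Hypothesis om : bounded_functional bnd c omega.
Hypothesis omegaC : forall x y, omega (x * y) = omega (y * x).
Hypothesis unitJ : J \is a GRing.unit.
Hypothesis comJ : forall x, GRing.comm J x.

Local Notation log := (segment_log J omega).

Definition schur (K' N K M : B) : B := M - K' * N^-1 * K.

Definition schur_segment (p : R) (K K' M N : B) : Prop :=
  forall t, 0 <= t <= 1 ->
    [/\ invertible_segment bnd J p (segment J M t),
        invertible_segment bnd J p (schur K' N K (segment J M t)) &
        invertible_segment bnd J p (schur K (segment J M t) K' N)].

Definition log_defect (K K' M N : B) : R :=
  log (schur K' N K M) - log M - (log (schur K M K' N) - log N).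

Lemma invertible_segment_unit p F : invertible_segment bnd J p F ->
  F \is a GRing.unit /\ bnd p F^-1.
Proof. by move=> /(_ 1); rewrite segment1; apply; rewrite ler01 lexx. Qed.

(** Both sides are the upper left corner of the inverse of the block matrix
[[M, K'], [K, N]], minus M^-1, read off its two block factorizations. *)
Lemma schur_inv (K K' M N : B) : M \is a GRing.unit -> N \is a GRing.unit ->
  schur K' N K M \is a GRing.unit -> schur K M K' N \is a GRing.unit ->
  (schur K' N K M)^-1 - M^-1 =
  M^-1 * K' * (schur K M K' N)^-1 * K * M^-1.
Proof.
move=> uM uN uS uT; set S := schur K' N K M; set T := schur K M K' N.
set X := K' * T^-1 * K * M^-1.
have SM : S * M^-1 = 1 - K' * N^-1 * K * M^-1 by rewrite /S /schur mulrBl divrr.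
have KMK : K * M^-1 * K' = N - T by rewrite /T /schur opprB addrC subrK.
have E : S * (M^-1 * X) = 1 - S * M^-1.
  rewrite mulrA SM mulrBl mul1r {2}/X !mulrA.
  have -> : K' * N^-1 * K * M^-1 * K' = K' - K' * N^-1 * T.
    by rewrite -[X in _ = X - _](divrK uN) -mulrBr -KMK !mulrA.
  by rewrite !mulrBl -(mulrA _ T) divrr// mulr1 -/X !opprB addrC subrK addrC subrK.
apply: (mulrI uS); rewrite mulrBr divrr// -E /X !mulrA //.
Qed.

Lemma schur_invB (K K' N M0 M1 : B) :
  M0 \is a GRing.unit -> M1 \is a GRing.unit ->
  schur K M1 K' N - schur K M0 K' N = K * M0^-1 * (M1 - M0) * M1^-1 * K'.
Proof.
move=> u0 u1; rewrite /schur opprB addrC addrA subrK.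
have M01 : M0^-1 * (M1 - M0) * M1^-1 = M0^-1 - M1^-1.
  by rewrite -[RHS]opprB resolvent_identity'// opprK.
have -> : K * M0^-1 * (M1 - M0) * M1^-1 * K' = K * (M0^-1 * (M1 - M0) * M1^-1) * K'.
  by rewrite !mulrA.
by rewrite M01 mulrBr mulrBl.
Qed.

(** Move M to J along a segment, with N, K and K' fixed. The Schur complement
of N moves by the same increment as M, that of M by K M^-1 dM M^-1 K', so by
schur_inv and the trace property the first order changes of the three
logarithms cancel. The defect therefore varies quadratically in the parameter
and is constant. *)
Lemma log_defect_segment p (K K' M N : B) : N \is a GRing.unit ->
  schur_segment p K K' M N -> log_defect K K' M N = log_defect K K' J N.
Proof.
move=> uN HS.
pose Mt t := segment J M t.
pose S t := schur K' N K (Mt t); pose T t := schur K (Mt t) K' N.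
have [g Hg] := bnd_ex bndP (M - J).
have [k Hk] := bnd_ex bndP K; have [k' Hk'] := bnd_ex bndP K'.
have [n Hn] := bnd_ex bndP (N - J); have [n' Hn'] := bnd_ex bndP (N^-1).
pose h t := log (S t) - log (Mt t) - log (T t).
have bZ a b x : 0 <= a <= 1 -> bnd b x -> bnd b (a *: x).
  move=> /andP[a0 a1] bx; apply: (bndW bndP _ (bndZ bndP a bx)).
  by rewrite ger0_norm// ler_piMl// (bnd_ge0 bndP bx).
have bN b x : bnd b x -> bnd b (- x).
  by move=> bx; have := bndZ bndP (-1) bx; rewrite normrN1 mul1r scaleN1r.
have MtJ t : Mt t - J = t *: (M - J) by rewrite /Mt /segment addrC addKr.
have bM t : 0 <= t <= 1 -> bnd g (Mt t - J) by move=> t01; rewrite MtJ; exact: bZ.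
have bS t : 0 <= t <= 1 -> bnd (g + k' * n' * k) (S t - J).
  move=> t01; rewrite /S /schur addrAC; apply: (bndD bndP); first exact: bM.
  by apply: bN; repeat (first [exact: Hk | exact: Hk' | exact: Hn' | apply: (bndM bndP)]).
have bT t : 0 <= t <= 1 -> bnd (n + k * p * k') (T t - J).
  move=> t01; rewrite /T /schur addrAC; apply: (bndD bndP) => //.
  have [/invertible_segment_unit[_ Hp] _ _] := HS t t01.
  by apply: bN; repeat (first [exact: Hk | exact: Hk' | exact: Hp | apply: (bndM bndP)]).
pose C1 b := c * (p ^+ 2 + p ^+ 3 * b).
pose C := C1 (g + k' * n' * k) * g ^+ 2 + C1 g * g ^+ 2
   + C1 (n + k * p * k') * (k * p * g * p * k') ^+ 2
   + c * (p * k * p * g * p * g * p * k').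
suff : `|h 1 - h 0| <= 0.
  rewrite normr_le0 subr_eq0 => /eqP.
  have s0 : segment J M 0 = J by rewrite /segment scale0r addr0.
  by rewrite /h /S /T /Mt segment1 s0 /log_defect => E; lra.
rewrite -[leRHS](mul0r (1 - 0)).
apply: (@increment_bound R h (fun x => C * x)) => // u v u0 uv v1.
have u01 : 0 <= u <= 1 by rewrite u0 (le_trans uv).
have v01 : 0 <= v <= 1 by rewrite v1 (le_trans u0).
have uv0 : 0 <= v - u by rewrite subr_ge0.
set e := v - u.
have [sMu sSu sTu] := HS u u01; have [sMv sSv sTv] := HS v v01.
have [uMu pMu] := invertible_segment_unit sMu.
have [uMv pMv] := invertible_segment_unit sMv.
have [uSu pSu] := invertible_segment_unit sSu.
have [uTu pTu] := invertible_segment_unit sTu.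
have MB : Mt v - Mt u = e *: (M - J) by exact: segmentB.
have SB : S v - S u = e *: (M - J).
  by rewrite -MB /S /schur opprB addrA subrK.
have TB : T v - T u = e *: (K * (Mt u)^-1 * (M - J) * (Mt v)^-1 * K').
  by rewrite /T schur_invB// -/(Mt v) -/(Mt u) MB -scalerAr -!scalerAl.
have be b x : bnd b x -> bnd (e * b) (e *: x).
  by move=> /(bndZ bndP e); rewrite ger0_norm.
have bKT : bnd (k * p * g * p * k') (K * (Mt u)^-1 * (M - J) * (Mt v)^-1 * K').
  by repeat (first [exact: Hk | exact: Hk' | exact: pMu | exact: pMv | exact: Hg |
    apply: (bndM bndP)]).
have lS : `|log (S v) - log (S u) - omega ((S u)^-1 * (e *: (M - J)))| <=
    C1 (g + k' * n' * k) * (e * g) ^+ 2.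
  rewrite -SB; apply: (segment_log_increment bndP om omegaC sSu sSv (bS u u01)).
  by rewrite -/(S v) -/(S u) SB; exact: be.
have lM : `|log (Mt v) - log (Mt u) - omega ((Mt u)^-1 * (e *: (M - J)))| <=
    C1 g * (e * g) ^+ 2.
  rewrite -MB; apply: (segment_log_increment bndP om omegaC sMu sMv (bM u u01)).
  by rewrite -/(Mt v) -/(Mt u) MB; exact: be.
have lT : `|log (T v) - log (T u) -
      omega ((T u)^-1 * (e *: (K * (Mt u)^-1 * (M - J) * (Mt v)^-1 * K')))|
    <= C1 (n + k * p * k') * (e * (k * p * g * p * k')) ^+ 2.
  rewrite -TB; apply: (segment_log_increment bndP om omegaC sTu sTv (bT u u01)).
  by rewrite -/(T v) -/(T u) TB; exact: be.
(* The first order terms cancel up to the second difference of the inverse of Mt. *)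
have main : omega ((S u)^-1 * (e *: (M - J))) - omega ((Mt u)^-1 * (e *: (M - J)))
   - omega ((T u)^-1 * (e *: (K * (Mt u)^-1 * (M - J) * (Mt v)^-1 * K'))) =
   e ^+ 2 * omega ((T u)^-1 * K * (Mt u)^-1 * (M - J) * (Mt u)^-1 * (M - J) * (Mt v)^-1 * K').
  rewrite -!scalerAr !(functionalZ om) -!mulrBr.
  set Y := omega (_ * K') in |- *; rewrite [RHS](_ : _ = e * (e * Y)); last by rewrite mulrA -expr2.
  rewrite {}/Y.
  congr (e * _).
  rewrite -(functionalB om) -mulrBl schur_inv// -/(T u).
  have -> : omega ((Mt u)^-1 * K' * (T u)^-1 * K * (Mt u)^-1 * (M - J)) =
     omega ((T u)^-1 * K * (Mt u)^-1 * (M - J) * (Mt u)^-1 * K').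
    by rewrite -!(mulrA ((Mt u)^-1 * K')) omegaC !mulrA.
  rewrite -(functionalB om) !mulrA -mulrBl -mulrBr -(functionalZ om).
  have -> : (Mt u)^-1 - (Mt v)^-1 = e *: ((Mt u)^-1 * (M - J) * (Mt v)^-1).
    by rewrite -opprB resolvent_identity'// opprK MB -scalerAr -scalerAl.
  by rewrite -scalerAr -scalerAl !mulrA.
have mainb : `|e ^+ 2 *
    omega ((T u)^-1 * K * (Mt u)^-1 * (M - J) * (Mt u)^-1 * (M - J) * (Mt v)^-1 * K')|
   <= e ^+ 2 * (c * (p * k * p * g * p * g * p * k')).
  rewrite normrM (ger0_norm (sqr_ge0 _)) ler_wpM2l ?sqr_ge0//; apply: (functional_le om).
  by repeat (first [exact: Hk | exact: Hk' | exact: pMu | exact: pMv | exact: pTu |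
    exact: Hg | apply: (bndM bndP)]).
set a1 := omega _ in lS; set a2 := omega _ in lM; set a3 := omega _ in lT.
have -> : h v - h u = (log (S v) - log (S u) - a1) - (log (Mt v) - log (Mt u) - a2)
   - (log (T v) - log (T u) - a3) + (a1 - a2 - a3).
  by rewrite /h; ring.
rewrite /a1 /a2 /a3 main.
have -> : (0 + (C * v - C * u)) * e =
    C1 (g + k' * n' * k) * (e * g) ^+ 2 + C1 g * (e * g) ^+ 2
   + C1 (n + k * p * k') * (e * (k * p * g * p * k')) ^+ 2
   + e ^+ 2 * (c * (p * k * p * g * p * g * p * k')) by rewrite /C /e; ring.
apply: (le_trans (ler_normD _ _)); apply: lerD => //.
apply: (le_trans (ler_normB _ _)); apply: lerD => //.
by apply: (le_trans (ler_normB _ _)); apply: lerD.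
Qed.

Lemma log_defect_swap (K K' M N : B) :
  log_defect K K' M N = - log_defect K' K N M.
Proof. by rewrite /log_defect; ring. Qed.

(** The two integrands agree pointwise, because K intertwines the inverses of
J - w K' J^-1 K and J - w K J^-1 K' and the functional is a trace. *)
Lemma log_defect_base (K K' : B) :
  (forall w, 0 <= w <= 1 -> segment J (schur K' J K J) w \is a GRing.unit) ->
  (forall w, 0 <= w <= 1 -> segment J (schur K J K' J) w \is a GRing.unit) ->
  log_defect K K' J J = 0.
Proof.
move=> u1 u2; rewrite /log_defect opprB addrA subrK.
apply/eqP; rewrite subr_eq0; apply/eqP; apply: eq_Rintegral => w.
rewrite inE/= in_itv/= => w01.
have {}u1 := u1 _ w01; have {}u2 := u2 _ w01.
set X := segment J (schur K' J K J) w in u1 *.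
set Y := segment J (schur K J K' J) w in u2 *.
have sJ (A C : B) : schur A J C J - J = - (A * J^-1 * C) by rewrite /schur addrAC subrr add0r.
have cJV x : x * J^-1 = J^-1 * x by apply: commrV; exact: commr_sym.
have KXY : K * X = Y * K.
  rewrite /X /Y /segment !sJ !scalerN mulrBr mulrBl -(comJ K) -scalerAr -scalerAl.
  by rewrite !mulrA -(mulrA K K') cJV !mulrA.
have KX : K * X^-1 = Y^-1 * K.
  by apply: (mulrI u2); rewrite [LHS]mulrA -KXY mulrK// mulVKr.
rewrite !sJ !mulrN !(functionalN om); congr (- _).
have -> : X^-1 * (K' * J^-1 * K) = X^-1 * K' * (J^-1 * K) by rewrite !mulrA.
have -> : Y^-1 * (K * J^-1 * K') = Y^-1 * K * K' * J^-1 by rewrite -!mulrA cJV.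
by rewrite omegaC [RHS]omegaC !mulrA -!(mulrA J^-1) KX !mulrA.
Qed.

(** By log_defect_segment M can be moved to J; exchanging the roles of M and N
changes the sign of the defect, so N can be moved to J as well. *)
Theorem log_schur p (K K' M N : B) :
  M \is a GRing.unit -> N \is a GRing.unit ->
  schur_segment p K K' M N -> schur_segment p K' K N J ->
  log (schur K' N K M) - log M = log (schur K M K' N) - log N.
Proof.
move=> uM uN MN NJ.
apply/eqP; rewrite -subr_eq0 -/(log_defect K K' M N); apply/eqP.
rewrite (log_defect_segment uN MN) log_defect_swap (log_defect_segment unitJ NJ).
have s0 : segment J N 0 = J by rewrite /segment scale0r addr0.
have [] := NJ 0 _; first by rewrite lexx ler01.
rewrite s0 => _ s1 s2.
by rewrite log_defect_base ?oppr0// => w w01; [have [] := s1 _ w01|have [] := s2 _ w01].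
Qed.
End SchurComplements.

(** * Hilbert spaces: real-valued norm and inner product *)

Section ComplexParts.
Variable R : realType.
Implicit Types z w : R[i].
Local Notation Re := (@complex.Re R).
Local Notation Im := (@complex.Im R).

Lemma cReD z w : Re (z + w) = Re z + Re w. Proof. by case: z; case: w. Qed.
Lemma cImD z w : Im (z + w) = Im z + Im w. Proof. by case: z; case: w. Qed.
Lemma cReN z : Re (- z) = - Re z. Proof. by case: z. Qed.
Lemma cImN z : Im (- z) = - Im z. Proof. by case: z. Qed.
Lemma cReM z w : Re (z * w) = Re z * Re w - Im z * Im w.
Proof. by case: z; case: w. Qed.
Lemma cImM z w : Im (z * w) = Re z * Im w + Im z * Re w.
Proof. by case: z => a b; case: w => c d. Qed.
Lemma cReJ z : Re (Num.conj z) = Re z. Proof. by case: z. Qed.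
Lemma cImJ z : Im (Num.conj z) = - Im z. Proof. by case: z. Qed.
Lemma complex_eq z w : Re z = Re w -> Im z = Im w -> z = w.
Proof. by case: z => a b; case: w => c d /= -> ->. Qed.
Lemma complex_ge0 z : (0 <= z) = (Im z == 0) && (0 <= Re z).
Proof. by rewrite lecE /= . Qed.
End ComplexParts.

Section Hilbert.
Variables (R : realType) (H : hilbertType R).
Implicit Types (x y z : H) (r : R) (a : R[i]).

Definition vnorm x : R := complex.Re `|x|.
Definition hre x y : R := complex.Re (hdot x y).

Lemma vnormE x : `|x| = (vnorm x)%:C.
Proof.
apply: complex_eq => //=.
by have := normr_ge0 x; rewrite complex_ge0 => /andP[/eqP].
Qed.

Lemma vnorm_ge0 x : 0 <= vnorm x.
Proof. by have := normr_ge0 x; rewrite complex_ge0 => /andP[]. Qed.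

Lemma vnormD x y : vnorm (x + y) <= vnorm x + vnorm y.
Proof. by have := ler_normD x y; rewrite !vnormE -rmorphD lecR. Qed.

Lemma vnormN x : vnorm (- x) = vnorm x.
Proof. by rewrite /vnorm normrN. Qed.

Lemma vnormB x y : vnorm (x - y) <= vnorm x + vnorm y.
Proof. by rewrite -[vnorm y]vnormN; exact: vnormD. Qed.

Lemma vnorm0 : vnorm 0 = 0. Proof. by rewrite /vnorm normr0. Qed.

Lemma vnorm_eq0 x : vnorm x = 0 -> x = 0.
Proof. by move=> x0; apply/normr0_eq0; rewrite vnormE x0. Qed.

Lemma vnormZ r x : vnorm (r%:C *: x) = `|r| * vnorm x.
Proof.
by rewrite {1}/vnorm normrZ vnormE normc_def [LHS]cReM/= expr0n addr0 sqrtr_sqr mul0r subr0.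
Qed.

Lemma vnormi x : vnorm ('i *: x) = vnorm x.
Proof.
rewrite {1}/vnorm normrZ vnormE normc_def [LHS]cReM/= expr0n expr1n add0r sqrtr1.
by rewrite mul1r mul0r subr0.
Qed.

Lemma hreDl x y z : hre (x + y) z = hre x z + hre y z.
Proof. by rewrite /hre linearDl cReD. Qed.
Lemma hreDr x y z : hre x (y + z) = hre x y + hre x z.
Proof. by rewrite /hre linearDr cReD. Qed.
Lemma hreNl x y : hre (- x) y = - hre x y.
Proof. by rewrite /hre linearNl cReN. Qed.
Lemma hreNr x y : hre x (- y) = - hre x y.
Proof. by rewrite /hre linearNr cReN. Qed.
Lemma hreBl x y z : hre (x - y) z = hre x z - hre y z.
Proof. by rewrite hreDl hreNl. Qed.
Lemma hreBr x y z : hre x (y - z) = hre x y - hre x z.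
Proof. by rewrite hreDr hreNr. Qed.
Lemma hreZl r x y : hre (r%:C *: x) y = r * hre x y.
Proof. by rewrite /hre linearZl_LR cReM /= mul0r subr0. Qed.
Lemma hreZr r x y : hre x (r%:C *: y) = r * hre x y.
Proof. by rewrite /hre linearZr_LR cReM cReJ cImJ /= oppr0 mul0r subr0. Qed.
Lemma hre0l y : hre 0 y = 0. Proof. by rewrite /hre linear0l. Qed.
Lemma hre0r x : hre x 0 = 0. Proof. by rewrite /hre linear0r. Qed.

Lemma hdotJ x y : hdot x y = Num.conj (hdot y x).
Proof. by rewrite hermC mul1r. Qed.
Lemma hreC x y : hre x y = hre y x.
Proof. by rewrite /hre hdotJ cReJ. Qed.

Lemma hdot_nn x : hdot x x = (vnorm x ^+ 2)%:C.
Proof. by rewrite hdot_norm vnormE rmorphXn. Qed.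

Lemma hre_nn x : hre x x = vnorm x ^+ 2.
Proof. by rewrite /hre hdot_nn. Qed.

Lemma hre_ir x y : hre x ('i *: y) = complex.Im (hdot x y).
Proof. by rewrite /hre linearZr_LR cReM cReJ cImJ /=; ring. Qed.
Lemma hre_il x y : hre ('i *: x) y = - complex.Im (hdot x y).
Proof. by rewrite /hre linearZl_LR cReM /=; ring. Qed.

Lemma vnorm_sqD x y : vnorm (x + y) ^+ 2 = vnorm x ^+ 2 + 2 * hre x y + vnorm y ^+ 2.
Proof. by rewrite -!hre_nn !(hreDl, hreDr) (hreC y x); ring. Qed.

Lemma vnorm_sqB x y : vnorm (x - y) ^+ 2 = vnorm x ^+ 2 - 2 * hre x y + vnorm y ^+ 2.
Proof. by rewrite vnorm_sqD hreNr vnormN; ring. Qed.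

Lemma hre_le x y : hre x y <= vnorm x * vnorm y.
Proof.
have [x0|x0] := eqVneq (vnorm x) 0.
  by rewrite (vnorm_eq0 x0) hre0l vnorm0 mul0r.
have [y0|y0] := eqVneq (vnorm y) 0.
  by rewrite (vnorm_eq0 y0) hre0r vnorm0 mulr0.
have X : 0 < vnorm x by rewrite lt_def x0 vnorm_ge0.
have Y : 0 < vnorm y by rewrite lt_def y0 vnorm_ge0.
have := sqr_ge0 (vnorm ((vnorm y)%:C *: x - (vnorm x)%:C *: y)).
rewrite vnorm_sqB !vnormZ hreZl hreZr !ger0_norm ?vnorm_ge0//.
have -> : (vnorm y * vnorm x) ^+ 2 - 2 * (vnorm y * (vnorm x * hre x y)) +
  (vnorm x * vnorm y) ^+ 2 =
   (2 * (vnorm x * vnorm y)) * (vnorm x * vnorm y - hre x y) by ring.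
by rewrite pmulr_rge0 ?subr_ge0// !mulr_gt0.
Qed.

Lemma hre_norm_le x y : `|hre x y| <= vnorm x * vnorm y.
Proof.
by rewrite ler_norml hre_le andbT -vnormN lerNl -hreNl hre_le.
Qed.

Lemma him_norm_le x y : `|complex.Im (hdot x y)| <= vnorm x * vnorm y.
Proof. by rewrite -hre_ir -(vnormi y) hre_norm_le. Qed.

Lemma hdot_eq x y : (forall z, hdot x z = hdot y z) -> x = y.
Proof.
move=> E; apply/eqP; rewrite -subr_eq0; apply/eqP/vnorm_eq0/eqP.
by rewrite -sqrf_eq0 -hre_nn /hre linearBl /= E subrr.
Qed.

Lemma hre_eq x y : (forall z, hre x z = hre y z) -> x = y.
Proof.
move=> E; apply: hdot_eq => z; apply: complex_eq; first exact: E.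
by rewrite -!hre_ir E.
Qed.

(** Take z in the dense set closer to x than the norm of x: then the square of
the norm of x is the real part of <x, x - z>, which is too small. *)
Lemma hre_dense_eq0 (D : set H) x : dense D ->
  (forall z, D z -> hre x z = 0) -> x = 0.
Proof.
move=> dD E; apply/vnorm_eq0/eqP/contraT => x0.
have xp : 0 < vnorm x by rewrite lt_def x0 vnorm_ge0.
have bx : nbhs x (ball x (vnorm x)%:C) by apply: nbhsx_ballx; rewrite ltcR.
have [|z [/interior_subset bz Dz]] := dD (ball x (vnorm x)%:C)^° _ (@open_interior _ _).
  by exists x.
move: bz; rewrite -ball_normE /ball_/= vnormE ltcR => xz.
have : vnorm x ^+ 2 < vnorm x ^+ 2; last by rewrite ltxx.
rewrite -{1}hre_nn -[hre x x]subr0 -(E z Dz) -hreBr.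
by apply: (le_lt_trans (hre_le _ _)); rewrite expr2 ltr_pM2l.
Qed.

Definition norm_le (b : R) (T : H -> H) : Prop :=
  0 <= b /\ forall x, vnorm (T x) <= b * vnorm x.

End Hilbert.

(** * Bounded operators, adjoints and inverses *)

Section BoundedOps.
Variables (R : realType) (H : hilbertType R).
Implicit Types (T S : H -> H) (x y : H).

Lemma linD T x y : linear T -> T (x + y) = T x + T y.
Proof. by move=> /(_ 1 x y); rewrite !scale1r. Qed.
Lemma lin0 T : linear T -> T 0 = 0.
Proof. by move=> lT; apply: (addrI (T 0)); rewrite -linD// !addr0. Qed.
Lemma linZ T a x : linear T -> T (a *: x) = a *: T x.
Proof. by move=> lT; have := lT a x 0; rewrite (lin0 lT) !addr0. Qed.
Lemma linN T x : linear T -> T (- x) = - T x.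
Proof. by move=> lT; rewrite -scaleN1r linZ// scaleN1r. Qed.
Lemma linB T x y : linear T -> T (x - y) = T x - T y.
Proof. by move=> lT; rewrite linD// linN. Qed.

Lemma bounded_opP T : bounded_op T <-> linear T /\ exists b, norm_le b T.
Proof.
split=> [[linT cT]|[linT [b [b0 Tb]]]].
  split=> //; pose f : {linear H -> H} := HB.pack T (GRing.isLinear.Build _ _ _ _ T linT).
  have /linear_bounded_continuous/linear_boundedP : continuous f by exact: cT.
  move=> /pinfty_ex_gt0[r r0 fr].
  have rE : r = (complex.Re r)%:C.
    by apply: complex_eq => //=; move: r0; rewrite ltcE => /andP[/eqP].
  exists (complex.Re r); split; first by move: r0; rewrite ltcE => /andP[_ /ltW].
  by move=> x; have := fr x; rewrite !vnormE rE -rmorphM lecR.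
split=> //; pose f : {linear H -> H} := HB.pack T (GRing.isLinear.Build _ _ _ _ T linT).
apply: (@bounded_linear_continuous _ _ _ f); apply/linear_boundedP.
near=> r => x; apply: (@le_trans _ _ (b%:C * `|x|)).
  by rewrite !vnormE -rmorphM lecR; exact: Tb.
rewrite ler_wpM2r//; near: r; apply: nbhs_pinfty_ge; apply/complex_realP; by exists b.
Unshelve. all: by end_near. Qed.

Lemma norm_leW (a b : R) T : a <= b -> norm_le a T -> norm_le b T.
Proof.
move=> ab [a0 Ta]; split; first exact: le_trans ab.
by move=> x; apply: (le_trans (Ta x)); rewrite ler_wpM2r// vnorm_ge0.
Qed.

Lemma norm_leD a b S T : norm_le a S -> norm_le b T -> norm_le (a + b) (S + T).
Proof.
move=> [a0 Sa] [b0 Tb]; split; first exact: addr_ge0.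
by move=> x; rewrite mulrDl; apply: (le_trans (vnormD _ _)); exact: lerD.
Qed.

Lemma norm_leZ r b T : norm_le b T -> norm_le (`|r| * b) (r%:C *: T).
Proof.
move=> [b0 Tb]; split; first exact: mulr_ge0.
by move=> x; rewrite vnormZ -mulrA ler_wpM2l.
Qed.

Lemma norm_leM a b S T : norm_le a S -> norm_le b T -> norm_le (a * b) (S \o T).
Proof.
move=> [a0 Sa] [b0 Tb]; split; first exact: mulr_ge0.
by move=> x /=; apply: (le_trans (Sa _)); rewrite -mulrA ler_wpM2l.
Qed.

Lemma bounded_op_id : bounded_op (id : H -> H).
Proof. by apply/bounded_opP; split=> //; exists 1; split=> // x; rewrite mul1r. Qed.

Lemma linear_comb a S T : linear S -> linear T -> linear (a *: S + T).
Proof.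
move=> lS lT c x y.
rewrite -[LHS]/(a *: S (c *: x + y) + T (c *: x + y)) lS lT.
rewrite -[RHS]/(c *: (a *: S x + T x) + (a *: S y + T y)).
by rewrite !scalerDr !scalerA (mulrC a) addrACA.
Qed.

Lemma linear_comp S T : linear S -> linear T -> linear (S \o T).
Proof. by move=> lS lT c x y; rewrite /= lT lS. Qed.

Lemma bounded_op_comb a S T : bounded_op S -> bounded_op T -> bounded_op (a *: S + T).
Proof.
move=> /bounded_opP[lS [b Sb]] /bounded_opP[lT [d Td]].
apply/bounded_opP; split; first exact: linear_comb.
exists (complex.Re `|a| * b + d); apply: norm_leD => //; split.
  apply: mulr_ge0; last by case: Sb.
  by have := normr_ge0 a; rewrite complex_ge0 => /andP[].
move=> x; case: Sb => b0 Sb.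
have na : `|a| = (complex.Re `|a|)%:C.
  by apply: complex_eq => //=; have := normr_ge0 a; rewrite complex_ge0 => /andP[/eqP].
rewrite [X in X <= _]/vnorm normrZ na vnormE -rmorphM /= -mulrA ler_wpM2l//.
by have := normr_ge0 a; rewrite complex_ge0 => /andP[].
Qed.

Lemma bounded_op_comp S T : bounded_op S -> bounded_op T -> bounded_op (S \o T).
Proof.
move=> /bounded_opP[lS [b Sb]] /bounded_opP[lT [d Td]].
apply/bounded_opP; split; first exact: linear_comp.
by exists (b * d); exact: norm_leM.
Qed.

Lemma bounded_op_linear T : bounded_op T -> linear T.
Proof. by case. Qed.

Lemma is_adjoint_sym S T : is_adjoint S T -> is_adjoint T S.
Proof. by move=> ST x y; rewrite hdotJ -ST -hdotJ. Qed.

Lemma is_adjoint_uniq T S S' : is_adjoint T S -> is_adjoint T S' -> S = S'.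
Proof.
move=> TS TS'; apply/funext => y; apply: hdot_eq => z.
by rewrite hdotJ -TS TS' -hdotJ.
Qed.

Lemma adjE T S : bounded_op S -> is_adjoint T S -> adj T = S.
Proof.
move=> bS TS; apply: (is_adjoint_uniq (T := T)) => //.
have : [set S | bounded_op S /\ is_adjoint T S] (adj T).
  by apply: (xgetPex _ (ex_intro _ S _)).
by case.
Qed.

Lemma is_inverse_uniq T S S' : is_inverse T S -> is_inverse T S' -> S = S'.
Proof.
move=> [_ _ ST] [_ TS' _]; apply/funext => x.
by rewrite -[in LHS](congr1 (@^~ x) TS') /= -[LHS]/((S \o T) (S' x)) ST.
Qed.

Lemma inv_opE T S : is_inverse T S -> inv_op T = S.
Proof.
move=> TS; apply: (is_inverse_uniq (T := T)) => //.
exact: (xgetPex _ (ex_intro _ S TS)).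
Qed.

Lemma lower_bound_inverse m T : linear T -> 0 < m ->
  (forall x, m * vnorm x <= vnorm (T x)) -> (forall y, exists x, T x = y) ->
  exists2 S, is_inverse T S & norm_le m^-1 S.
Proof.
move=> lT m0 Tm sT.
have [S TS] := choice sT.
have inj x y : T x = T y -> x = y.
  move=> E; apply/eqP; rewrite -subr_eq0; apply/eqP/vnorm_eq0/eqP.
  rewrite eq_le vnorm_ge0 andbT -(ler_pM2l m0) mulr0.
  by apply: (le_trans (Tm _)); rewrite linB// E subrr vnorm0.
have bS : norm_le m^-1 S.
  split; first by rewrite invr_ge0 ltW.
  by move=> x; rewrite ler_pdivlMl// -{2}(TS x).
exists S => //; split.
- apply/bounded_opP; split; last by exists m^-1.
  by move=> a x y; apply: inj; rewrite lT !TS.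
- exact/funext.
- by apply/funext => x; apply: inj; rewrite TS.
Qed.

End BoundedOps.

(** * A von Neumann algebra as a unital algebra *)

Section VonNeumannClosure.
Variables (R : realType) (H : hilbertType R) (A : set (H -> H)).
Hypothesis A_vN : von_neumann_algebra A.

Lemma vN_bounded T : A T -> bounded_op T.
Proof. by case: A_vN => + _ _; apply. Qed.

Lemma vN_linear T : A T -> linear T.
Proof. by move=> /vN_bounded[]. Qed.

Lemma vN_norm_le T : A T -> exists b, norm_le b T.
Proof. by move=> /vN_bounded /bounded_opP[]. Qed.

Lemma vN_bicommutant T : bounded_op T ->
  (forall S, commutant A S -> T \o S = S \o T) -> A T.
Proof. by case: A_vN => _ _ {2}<- bT TS; split. Qed.

Lemma vN_commute T S : A T -> commutant A S -> S \o T = T \o S.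
Proof. by move=> AT [_]; apply. Qed.

Lemma vN_comb a S T : A S -> A T -> A (a *: S + T).
Proof.
move=> AS AT; apply: vN_bicommutant; first exact/bounded_op_comb/vN_bounded/AT/vN_bounded.
move=> U cU; have lU : linear U by case: cU => /bounded_op_linear.
have US := vN_commute AS cU; have UT := vN_commute AT cU.
apply/funext => x /=.
rewrite -[LHS]/(a *: S (U x) + T (U x)) -[RHS]/(U (a *: S x + T x)) lU.
by rewrite -[U (S x)]/((U \o S) x) US -[U (T x)]/((U \o T) x) UT.
Qed.

Lemma vN_comp S T : A S -> A T -> A (S \o T).
Proof.
move=> AS AT; apply: vN_bicommutant; first exact: bounded_op_comp (vN_bounded AS) (vN_bounded AT).
move=> U cU; have US := vN_commute AS cU; have UT := vN_commute AT cU.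
by rewrite -compA -UT compA -US.
Qed.

Lemma vN_id : A id.
Proof. by apply: vN_bicommutant => [|U]; first exact: bounded_op_id. Qed.

Lemma vN0 : A 0.
Proof.
rewrite (_ : 0 = -1 *: id + id); first exact: vN_comb vN_id vN_id.
by rewrite scaleN1r addNr.
Qed.

Lemma vN_inverse T S : A T -> is_inverse T S -> A S.
Proof.
move=> AT [bS TS ST]; apply: vN_bicommutant => // U cU.
have UT := vN_commute AT cU.
rewrite -[LHS]/(S \o U \o id) -TS.
have -> : S \o U \o (T \o S) = S \o (U \o T) \o S by [].
by rewrite UT compA ST.
Qed.

Lemma vN_adj T : A T -> A (adj T) /\ is_adjoint T (adj T).
Proof.
move=> AT; have [S AS TS] : exists2 S, A S & is_adjoint T S by case: A_vN => _ + _; apply.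
by rewrite (adjE (vN_bounded AS) TS).
Qed.

(** Commuting with every element of the commutant passes to limits in norm. *)
Lemma vN_limit T : bounded_op T ->
  (forall e : R, 0 < e -> exists2 S, A S & norm_le e (T - S)) -> A T.
Proof.
move=> bT TA; apply: vN_bicommutant => // U [bU cU].
have lU := bounded_op_linear bU; have [_ [u [u0 Uu]]] := (bounded_opP _).1 bU.
have lT := bounded_op_linear bT.
apply/funext => x /=; apply/eqP; rewrite -subr_eq0; apply/eqP/vnorm_eq0/eqP.
rewrite eq_le vnorm_ge0 andbT.
apply: (@ler_add_invnat R _ _ (vnorm (U x) + u * vnorm x)) => n; rewrite add0r.
have [|S AS [_ TS]] := TA n.+1%:R^-1; first by rewrite invr_gt0 ltr0n.
have -> : T (U x) - U (T x) = (T - S) (U x) - U ((T - S) x).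
  rewrite -[(T - S) (U x)]/(T (U x) - S (U x)) -[(T - S) x]/(T x - S x) linB//.
  by rewrite -[S (U x)]/((S \o U) x) -cU//= opprB addrA subrK.
apply: (le_trans (vnormB _ _)); rewrite mulrDl; apply: lerD.
  by rewrite mulrC; exact: TS.
by apply: (le_trans (Uu _)); rewrite -mulrA ler_wpM2l// mulrC; exact: TS.
Qed.
End VonNeumannClosure.

(** The algebra A as a type, so that a functional on A becomes total and the
algebraic part above applies. Scalars are real, which suffices for segments;
the imaginary unit is the central element vn_i below. That the identity is not
zero is what makes A a nontrivial ring. *)
Record vnop (R : realType) (H : hilbertType R) (A : set (H -> H))
    (A_vN : von_neumann_algebra A) (id_neq0 : (id : H -> H) != 0) :=
  VNOp { vnval :> H -> H; vnP : A vnval }.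

Section VonNeumannRing.
Variables (R : realType) (H : hilbertType R) (A : set (H -> H)).
Variables (A_vN : von_neumann_algebra A) (id_neq0 : (id : H -> H) != 0).
Local Notation V := (vnop A_vN id_neq0).
Implicit Types S T U : V.

HB.instance Definition _ := gen_eqMixin V.
HB.instance Definition _ := gen_choiceMixin V.

Lemma vn_eq S T : S =1 T -> S = T.
Proof.
case: S => S AS; case: T => T AT /= /funext ST; case: _ / ST in AT *.
by congr VNOp; exact: Prop_irrelevance.
Qed.

Lemma vn_linear T : linear T. Proof. exact: (vN_linear A_vN (vnP T)). Qed.

Definition vn_zero : V := VNOp A_vN id_neq0 (vN0 A_vN).
Definition vn_one : V := VNOp A_vN id_neq0 (vN_id A_vN).
Lemma vn_opp_subproof T : A (- (T : H -> H)).
Proof.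
by rewrite -[- _]addr0 -scaleN1r; apply: (vN_comb A_vN); [exact: vnP|exact: vN0].
Qed.
Definition vn_opp T : V := VNOp A_vN id_neq0 (vn_opp_subproof T).
Lemma vn_add_subproof S T : A ((S : H -> H) + T).
Proof. by rewrite -[X in X + _]scale1r; apply: (vN_comb A_vN); exact: vnP. Qed.
Definition vn_add S T : V := VNOp A_vN id_neq0 (vn_add_subproof S T).
Definition vn_mul S T : V := VNOp A_vN id_neq0 (vN_comp A_vN (vnP S) (vnP T)).
Lemma vn_scale_subproof (a : R) T : A (a%:C *: (T : H -> H)).
Proof. by rewrite -[_ *: _]addr0; apply: (vN_comb A_vN); [exact: vnP|exact: vN0]. Qed.
Definition vn_scale (a : R) T : V := VNOp A_vN id_neq0 (vn_scale_subproof a T).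

Lemma vn_addA : associative vn_add.
Proof. by move=> S T U; apply: vn_eq => x; exact: addrA. Qed.
Lemma vn_addC : commutative vn_add.
Proof. by move=> S T; apply: vn_eq => x; exact: addrC. Qed.
Lemma vn_add0 : left_id vn_zero vn_add.
Proof. by move=> S; apply: vn_eq => x; exact: add0r. Qed.
Lemma vn_addN : left_inverse vn_zero vn_opp vn_add.
Proof. by move=> S; apply: vn_eq => x; exact: addNr. Qed.

HB.instance Definition _ := GRing.isZmodule.Build V vn_addA vn_addC vn_add0 vn_addN.

Lemma vn_mulA : associative vn_mul.
Proof. by move=> S T U; exact: vn_eq. Qed.
Lemma vn_mul1 : left_id vn_one vn_mul.
Proof. by move=> S; exact: vn_eq. Qed.
Lemma vn_mulr1 : right_id vn_one vn_mul.
Proof. by move=> S; exact: vn_eq. Qed.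
Lemma vn_mulDl : left_distributive vn_mul +%R.
Proof. by move=> S T U; exact: vn_eq. Qed.
Lemma vn_mulDr : right_distributive vn_mul +%R.
Proof. by move=> S T U; apply: vn_eq => x; exact: (linD _ _ (vn_linear S)). Qed.
Lemma vn_oner_neq0 : vn_one != 0.
Proof. by apply: contra_neq id_neq0 => /(congr1 (@vnval _ _ _ _ _)). Qed.

HB.instance Definition _ :=
  GRing.Zmodule_isNzRing.Build V vn_mulA vn_mul1 vn_mulr1 vn_mulDl vn_mulDr vn_oner_neq0.

Lemma vn_scaleA a b T : vn_scale a (vn_scale b T) = vn_scale (a * b) T.
Proof. by apply: vn_eq => x; rewrite /= rmorphM; exact: scalerA. Qed.
Lemma vn_scale1 : left_id 1 vn_scale.
Proof. by move=> T; apply: vn_eq => x; exact: scale1r. Qed.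
Lemma vn_scaleDr : right_distributive vn_scale +%R.
Proof. by move=> a S T; apply: vn_eq => x; exact: scalerDr. Qed.
Lemma vn_scaleDl T : {morph vn_scale^~ T : a b / a + b}.
Proof. by move=> a b; apply: vn_eq => x; rewrite /= rmorphD; exact: scalerDl. Qed.

HB.instance Definition _ :=
  GRing.Zmodule_isLmodule.Build R V vn_scaleA vn_scale1 vn_scaleDr vn_scaleDl.

Lemma vn_scaleAl (a : R) (S T : V) : a *: (S * T) = (a *: S) * T.
Proof. exact: vn_eq. Qed.
HB.instance Definition _ := GRing.Lmodule_isLalgebra.Build R V vn_scaleAl.

Lemma vn_scaleAr (a : R) (S T : V) : a *: (S * T) = S * (a *: T).
Proof. by apply: vn_eq => x; rewrite /= -[RHS]/(S (a%:C *: T x)) (linZ _ _ (vn_linear S)). Qed.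
HB.instance Definition _ := GRing.Lalgebra_isAlgebra.Build R V vn_scaleAr.

Definition vn_unit : {pred V} := fun T => `[< exists S, S * T = 1 /\ T * S = 1 >].
Definition vn_inv (T : V) : V := xget T [set S | S * T = 1 /\ T * S = 1].
Lemma vn_invP T : T \in vn_unit -> vn_inv T * T = 1 /\ T * vn_inv T = 1.
Proof. by move=> /asboolP[S ST]; 
  apply: (xgetPex T (P := [set S | S * T = 1 /\ T * S = 1])); exists S. Qed.
Lemma vn_mulV : {in vn_unit, left_inverse 1 vn_inv *%R}.
Proof. by move=> T /vn_invP[]. Qed.
Lemma vn_mulrV : {in vn_unit, right_inverse 1 vn_inv *%R}.
Proof. by move=> T /vn_invP[]. Qed.
Lemma vn_unitP S T : T * S = 1 /\ S * T = 1 -> S \in vn_unit.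
Proof. by move=> ST; apply/asboolP; exists T. Qed.
Lemma vn_inv_out : {in [predC vn_unit], vn_inv =1 id}.
Proof.
move=> T; rewrite !inE => /asboolP nT; rewrite /vn_inv; case: xgetP => // S _ ST.
by case: nT; exists S.
Qed.
HB.instance Definition _ :=
  GRing.NzRing_hasMulInverse.Build V vn_mulV vn_mulrV vn_unitP vn_inv_out.

End VonNeumannRing.

(** * Invertibility by perturbation *)

Section HilbertSeries.
Variables (R : realType) (H : hilbertType R).

Lemma vnorm_sum (I : Type) (s : seq I) (P : pred I) (u : I -> H) :
  vnorm (\sum_(i <- s | P i) u i) <= \sum_(i <- s | P i) vnorm (u i).
Proof.
elim/big_rec2: _ => [|i a b _ ab]; first by rewrite vnorm0.
by apply: (le_trans (vnormD _ _)); rewrite lerD2l.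
Qed.

Lemma vnorm_cvg_series (u : nat -> H) (v : nat -> R) :
  (forall k, vnorm (u k) <= v k) -> cvgn (series v) -> cvgn (series u).
Proof.
move=> uv /cauchy_cvgP/cauchy_seriesP cv.
apply/cauchy_cvgP/cauchy_seriesP => e e0.
have eE : e = (complex.Re e)%:C.
  by apply: complex_eq => //=; move: e0; rewrite ltcE => /andP[/eqP].
have e0' : 0 < complex.Re e by move: e0; rewrite ltcE => /andP[].
have := cv _ e0'; apply: filterS => n h.
rewrite vnormE eE ltcR; apply: le_lt_trans h.
apply: (le_trans (vnorm_sum _ _ _)); apply: le_trans (ler_norm _).
by apply: ler_sum.
Qed.

(** The increments of the iterates decay geometrically. *)
Lemma hilbert_contraction_fixpoint (f : H -> H) (r : R) : 0 <= r < 1 ->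
  (forall x y, vnorm (f x - f y) <= r * vnorm (x - y)) -> exists x, f x = x.
Proof.
move=> /andP[r0 r1] fr.
pose x n := iter n f 0; pose u n := x n.+1 - x n.
pose v n := geometric (vnorm (u 0%N)) r n.
have uv k : vnorm (u k) <= v k.
  elim: k => [|k IH]; first by rewrite /v /geometric /= expr0 mulr1.
  rewrite /v /geometric /= exprS mulrCA; apply: le_trans (ler_wpM2l r0 IH).
  exact: fr.
have /(vnorm_cvg_series uv) cu : cvgn (series v).
  by apply: is_cvg_geometric_series; rewrite ger0_norm.
have xE : series u = x.
  apply/funext => n; rewrite /series /= (telescope_sumr _ (leq0n n)).
  by rewrite [x 0%N]/= subr0.
rewrite xE in cu; exists (limn x); apply/eqP; rewrite -subr_eq0.
apply/eqP/vnorm_eq0/eqP; rewrite eq_le vnorm_ge0 andbT.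
apply/ler_addgt0Pr => e e0; rewrite add0r.
have e2 : 0 < (e / 2)%:C :> R[i] by rewrite ltcR divr_gt0.
have [N _ xN] := (@cvgrPdist_le _ _ _ _ _ _ _).1 cu _ e2.
have d n : (N <= n)%N -> vnorm (limn x - x n) <= e / 2.
  by move=> Nn; have := xN n Nn; rewrite /= vnormE lecR.
have -> : f (limn x) - limn x = (f (limn x) - f (x N)) - (limn x - x N.+1).
  by rewrite [x N.+1]/= opprB addrA subrK.
rewrite [e]splitr; apply: (le_trans (vnormB _ _)); apply: lerD; last exact: d.
apply: (le_trans (fr _ _)); apply: le_trans (d N (leqnn _)).
by rewrite ler_piMl ?vnorm_ge0// ltW.
Qed.

End HilbertSeries.

Section Dissipative.
Variables (R : realType) (H : hilbertType R) (A : set (H -> H)).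
Variables (A_vN : von_neumann_algebra A) (id_neq0 : (id : H -> H) != 0).
Local Notation V := (vnop A_vN id_neq0).
Implicit Types S T F : V.

Definition vnbnd (b : R) (T : V) : Prop := norm_le b T.

Lemma vnbndP : norm_bound vnbnd.
Proof.
split.
- by move=> b T [].
- by move=> T; exact: (vN_norm_le A_vN (vnP T)).
- by move=> a b T; exact: norm_leW.
- by move=> a b S T; exact: norm_leD.
- by move=> r b T; exact: norm_leZ.
- by move=> a b S T; exact: norm_leM.
Qed.

Lemma vn_i_subproof : A ('i *: (id : H -> H)).
Proof.
by rewrite -[_ *: _]addr0; apply: (vN_comb A_vN); [exact: vN_id|exact: vN0].
Qed.
Definition vn_i : V := VNOp A_vN id_neq0 vn_i_subproof.

Lemma vn_iE x : vn_i x = 'i *: x. Proof. by []. Qed.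
Lemma vn_addE S T x : (S + T) x = S x + T x. Proof. by []. Qed.
Lemma vn_oppE T x : (- T) x = - T x. Proof. by []. Qed.
Lemma vn_subE S T x : (S - T) x = S x - T x. Proof. by []. Qed.
Lemma vn_mulE S T x : (S * T) x = S (T x). Proof. by []. Qed.
Lemma vn_scaleE (a : R) T x : (a *: T) x = a%:C *: T x. Proof. by []. Qed.
Lemma vn_1E x : (1 : V) x = x. Proof. by []. Qed.

Lemma vn_iC T : GRing.comm vn_i T.
Proof. by apply: vn_eq => x; rewrite !vn_mulE !vn_iE (linZ _ _ (vn_linear T)). Qed.

Lemma vn_ii : vn_i * vn_i = -1.
Proof.
apply: vn_eq => x; rewrite vn_mulE !vn_iE scalerA -expr2 sqr_i.
by rewrite scaleN1r.
Qed.

Lemma vn_unit_inverse T : T \is a GRing.unit ->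
  is_inverse T (GRing.inv T).
Proof.
move=> uT; split; first exact: (vN_bounded A_vN (vnP _)).
  exact: (congr1 (@vnval _ _ _ _ _) (divrr uT)).
exact: (congr1 (@vnval _ _ _ _ _) (mulVr uT)).
Qed.

Lemma vn_inverse_unit T (S : H -> H) : is_inverse T S ->
  T \is a GRing.unit /\ GRing.inv T = S :> (H -> H).
Proof.
move=> TS; have AS := vN_inverse A_vN (vnP T) TS.
have uT : T \is a GRing.unit.
  apply/unitrP; exists (VNOp A_vN id_neq0 AS); case: TS => _ TS ST.
  by split; apply: vn_eq => x; [exact: (congr1 (@^~ x) ST)|exact: (congr1 (@^~ x) TS)].
by split=> //; exact: is_inverse_uniq (vn_unit_inverse uT) TS.
Qed.

Definition lower_bound (m : R) (T : V) : Prop :=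
  forall x, m * vnorm x <= vnorm (T x).

Lemma lower_boundW m m' T : m <= m' -> lower_bound m' T -> lower_bound m T.
Proof. by move=> mm Tm x; apply: le_trans (Tm x); rewrite ler_wpM2r// vnorm_ge0. Qed.

Lemma lower_bound_unit m T : 0 < m -> lower_bound m T ->
  (forall y, exists x, T x = y) -> T \is a GRing.unit /\ vnbnd m^-1 T^-1.
Proof.
move=> m0 Tm sT; have [S TS bS] := lower_bound_inverse (vn_linear T) m0 Tm sT.
by have [uT TE] := vn_inverse_unit TS; split=> //; rewrite /vnbnd TE.
Qed.

Lemma unit_lower_bound T : T \is a GRing.unit -> exists2 m, 0 < m & lower_bound m T.
Proof.
move=> uT; have [b [b0 Tb]] := bnd_ex vnbndP T^-1.
exists (b + 1)^-1; first by rewrite invr_gt0 ltr_wpDl.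
move=> x; rewrite ler_pdivrMl ?ltr_wpDl//.
have {1}-> : x = (T^-1 * T) x by rewrite mulVr.
apply: (le_trans (Tb _)); rewrite ler_wpM2r ?vnorm_ge0// lerDl//.
Qed.

(** T x = y means that x is a fixed point of x |-> S^-1 (y - (T - S) x), which
contracts distances by the factor d / m. *)
Lemma perturbation_surjective m d S T : 0 < m -> S \is a GRing.unit -> vnbnd m^-1 S^-1 ->
  vnbnd d (T - S) -> d < m -> forall y, exists x, T x = y.
Proof.
move=> m0 uS [_ Sm] [d0 TS] dm y.
have linS' := vn_linear (S^-1); have linD := vn_linear (T - S).
have [|x1 x2|x xE] := @hilbert_contraction_fixpoint R H (fun x => S^-1 (y - (T - S) x)) (m^-1 * d).
- by apply/andP; split; [rewrite mulr_ge0// invr_ge0 ltW|rewrite ltr_pdivrMl// mulr1].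
- have E (a b c : H) : a - b - (a - c) = c - b by rewrite opprB addrC addrA subrK.
  rewrite -linB// E -linB//.
  apply: (le_trans (Sm _)); rewrite -mulrA ler_wpM2l//; first by rewrite invr_ge0 ltW.
  apply: (le_trans (TS _)).
  by rewrite -vnormN opprB.
exists x; have xS : S x = y - (T - S) x by rewrite -{1}xE -vn_mulE divrr.
have E : y = S x + (T - S) x by rewrite xS subrK.
by rewrite [RHS]E vn_subE addrC subrK.
Qed.

End Dissipative.

(** * Dissipative operators and the segments from i *)

Section DissipativeSegments.
Variables (R : realType) (H : hilbertType R) (A : set (H -> H)).
Variables (A_vN : von_neumann_algebra A) (id_neq0 : (id : H -> H) != 0).
Local Notation V := (vnop A_vN id_neq0).
Local Notation J := (vn_i A_vN id_neq0).
Implicit Types S T F : V.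

Definition him (x y : H) : R := complex.Im (hdot x y).

Lemma himDl x y z : him (x + y) z = him x z + him y z.
Proof. by rewrite /him linearDl cImD. Qed.
Lemma himNl x y : him (- x) y = - him x y.
Proof. by rewrite /him linearNl cImN. Qed.
Lemma himZl (r : R) x y : him (r%:C *: x) y = r * him x y.
Proof. by rewrite /him linearZl_LR cImM /= mul0r addr0. Qed.
Lemma himC x y : him x y = - him y x.
Proof. by rewrite /him hdotJ cImJ. Qed.
Lemma him_il x y : him ('i *: x) y = hre x y.
Proof. by rewrite /him linearZl_LR cImM /= mul0r mul1r add0r. Qed.

Definition im_ge (c : R) (T : V) : Prop :=
  forall x, c * vnorm x ^+ 2 <= him (T x) x.

Lemma im_geW c c' T : c <= c' -> im_ge c' T -> im_ge c T.
Proof. by move=> cc Tc x; apply: le_trans (Tc x); rewrite ler_wpM2r// sqr_ge0. Qed.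

Lemma im_ge_lower_bound c T : im_ge c T -> lower_bound c T.
Proof.
move=> Tc x; have [x0|x0] := eqVneq (vnorm x) 0; first by rewrite x0 mulr0 vnorm_ge0.
have X : 0 < vnorm x by rewrite lt_def x0 vnorm_ge0.
rewrite -(ler_pM2r X) -mulrA -expr2; apply: (le_trans (Tc x)).
by apply: le_trans (ler_norm _) (him_norm_le _ _).
Qed.

Lemma dissipative_im_ge T : dissipative T -> im_ge 0 T.
Proof.
move=> dT x; rewrite mul0r.
have [_ aT] := vN_adj A_vN (vnP T).
have := dT x; rewrite complex_ge0 => /andP[_].
rewrite (_ : hdot _ _ = (him (T x) x)%:C)//.
rewrite -[im_op T x]/((2 * 'i)^-1 *: (T x - adj T x)) linearZl_LR /=.
rewrite linearBl /= (hdotJ (adj T x)) -aT.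
have -> : hdot (T x) x - Num.conj (hdot (T x) x) = (2 * 'i) * (him (T x) x)%:C.
  by rewrite /him; case: (hdot (T x) x) => a b; apply: complex_eq => /=; ring.
rewrite mulKf// mulf_neq0// ?pnatr_eq0// eq_complex /= eqxx oner_eq0 andbF //.
Qed.

Lemma vn_segmentE F w x : segment J F w x = w%:C *: F x + (1 - w)%:C *: ('i *: x).
Proof.
rewrite /segment vn_addE vn_scaleE vn_subE vn_iE scalerBr rmorphB scalerBl.
by rewrite /= rmorph1 scale1r addrCA.
Qed.

Lemma vn_segment0 F : segment J F 0 = J.
Proof. by rewrite /segment scale0r addr0. Qed.

Lemma segment_im_ge F w : im_ge 0 F -> 0 <= w <= 1 ->
  im_ge (1 - w) (segment J F w).
Proof.
move=> F0 /andP[w0 w1] x; rewrite vn_segmentE himDl !himZl him_il hre_nn.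
by rewrite lerDr mulr_ge0//; have := F0 x; rewrite mul0r.
Qed.

(** The segment from i to F is bounded below by 1 - w, its imaginary part, and
by w m - (1 - w). The larger of the two is smallest where they coincide, at
1 - w = m / (m + 2). *)
Lemma segment_lower_bound m F : 0 < m -> im_ge 0 F -> lower_bound m F ->
  forall w, 0 <= w <= 1 -> lower_bound (m / (m + 2)) (segment J F w).
Proof.
move=> m0 F0 Fm w w01; have /andP[w0 w1] := w01.
have m2 : 0 < m + 2 by rewrite ltr_wpDl// ltW.
have [h|h] := leP (m / (m + 2)) (1 - w).
  by apply: lower_boundW h _; apply: im_ge_lower_bound; exact: segment_im_ge.
move=> x; apply: (@le_trans _ _ (w * (m * vnorm x) - (1 - w) * vnorm x)).
  rewrite mulrA -mulrBl ler_wpM2r ?vnorm_ge0//.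
  have -> : m / (m + 2) = m - (m + 1) * (m / (m + 2)) by field; rewrite gt_eqF.
  have : (m + 1) * (1 - w) <= (m + 1) * (m / (m + 2)).
    by rewrite ler_wpM2l ?ltW// addr_gt0.
  by set Q := (m + 1) * (m / (m + 2)); lra.
have wF : w * (m * vnorm x) <= vnorm (w%:C *: F x).
  by rewrite vnormZ ger0_norm// ler_wpM2l.
have wi : vnorm ((1 - w)%:C *: ('i *: x)) = (1 - w) * vnorm x.
  by rewrite vnormZ ger0_norm ?subr_ge0// vnormi.
rewrite vn_segmentE -wi lerBlDr; apply: (le_trans wF).
set a := _ *: F x; set b := _ *: ('i *: x).
by rewrite -{1}(addrK b a); exact: vnormB.
Qed.

Lemma vn_i_unit : J \is a GRing.unit.
Proof.
apply/unitrP; exists (- J).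
by rewrite mulNr mulrN vn_ii opprK.
Qed.

(** The lower bound is uniform along the segment, so invertibility propagates
from i to F in finitely many small steps. *)
Lemma dissipative_segment m F : 0 < m -> im_ge 0 F -> lower_bound m F ->
  invertible_segment (@vnbnd _ _ _ _ _) J (m / (m + 2))^-1 F.
Proof.
move=> m0 F0 Fm w w01; have /andP[w0 w1] := w01.
have m2 : 0 < m + 2 by rewrite ltr_wpDl// ltW.
set q := m / (m + 2); have q0 : 0 < q by rewrite divr_gt0.
have [d Fd] := bnd_ex (vnbndP A_vN id_neq0) (F - J).
have d0 := bnd_ge0 (vnbndP A_vN id_neq0) Fd.
have [n nd] : exists n : nat, d / n.+1%:R < q.
  exists (Num.Def.archi_bound (d / q)); rewrite ltr_pdivrMr ?ltr0n//.
  rewrite -ltr_pdivrMl// mulrC.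
  apply: lt_trans (archi_boundP _) _; first by rewrite divr_ge0// ltW.
  by rewrite ltr_nat.
set N := n.+1%:R : R; have N0 : 0 < N by rewrite ltr0n.
pose t k := w * (k%:R / N).
have tN : t n.+1 = w by rewrite /t divff ?gt_eqF// mulr1.
rewrite -tN.
have t01 k : (k <= n.+1)%N -> 0 <= t k <= 1.
  move=> kn; have k01 : 0 <= k%:R / N <= 1.
    by rewrite divr_ge0 ?(ltW N0)//= ler_pdivrMr// mul1r ler_nat.
  case/andP: k01 => k0 k1; rewrite mulr_ge0//=.
  by rewrite -[leRHS]mulr1 ler_pM.
suff : forall k, (k <= n.+1)%N -> segment J F (t k) \is a GRing.unit /\
    vnbnd q^-1 (segment J F (t k))^-1 by apply.
elim=> [|k IH] kn.
  rewrite /t mul0r mulr0; apply: lower_bound_unit => //.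
    by apply: segment_lower_bound => //; rewrite lexx ler01.
  move=> y; exists (J^-1 y); rewrite vn_segment0 -vn_mulE divrr//.
  exact: vn_i_unit.
have [uk bk] := IH (ltnW kn).
apply: lower_bound_unit => //; first exact: segment_lower_bound (t01 _ kn).
apply: (perturbation_surjective q0 uk bk _ nd).
rewrite segmentB.
have -> : t k.+1 - t k = w / N by rewrite /t -natr1; ring.
apply: (bndW (vnbndP A_vN id_neq0)) (bndZ (vnbndP A_vN id_neq0) _ Fd).
rewrite ger0_norm; last by rewrite divr_ge0// ltW.
rewrite mulrC -/N mulrA ler_wpM2r ?invr_ge0 ?(ltW N0)//.
by rewrite ler_piMr.
Qed.

End DissipativeSegments.

(** * Schur complements of dissipative operators *)

(** The candidate inverse is the lower right corner of the inverse of the block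
matrix [[M, K'], [K, N]]. *)
Lemma schur_unit (R : realType) (B : unitAlgType R) (K K' M N : B) :
  M \is a GRing.unit -> N \is a GRing.unit ->
  schur K' N K M \is a GRing.unit ->
  schur K M K' N \is a GRing.unit /\
  (schur K M K' N)^-1 = N^-1 + N^-1 * K * (schur K' N K M)^-1 * K' * N^-1.
Proof.
move=> uM uN uS; set S := schur K' N K M; set T := schur K M K' N.
set X := N^-1 + _.
have KNK : K' * N^-1 * K = M - S by rewrite /S /schur opprB addrC subrK.
have KMK : K * M^-1 * K' = N - T by rewrite /T /schur opprB addrC subrK.
pose Y := K * S^-1 * K' * N^-1; pose Z := N^-1 * K * S^-1 * K'.
have TX : T * X = 1.
  have XE : X = N^-1 + N^-1 * Y by rewrite /X /Y !mulrA.
  have NX : N * X = 1 + Y by rewrite XE mulrDr mulrA divrr// mul1r.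
  have KX : K * M^-1 * K' * X = Y.
    rewrite XE mulrDr mulrA /Y.
    have -> : K * M^-1 * K' * N^-1 * (K * S^-1 * K' * N^-1) =
       K * M^-1 * (K' * N^-1 * K) * S^-1 * K' * N^-1 by rewrite !mulrA.
    rewrite KNK (mulrBr (K * M^-1)) (mulrVK uM) !mulrBl.
    by rewrite (mulrK uS) addrC subrK.
  by rewrite /T /schur mulrBl NX KX addrK.
have XT : X * T = 1.
  have XE : X = N^-1 + Z * N^-1 by rewrite /X /Z.
  have XN : X * N = 1 + Z by rewrite XE mulrDl mulVr// mulrVK.
  have KX : X * (K * M^-1 * K') = Z.
    rewrite XE mulrDl /Z.
    have -> : N^-1 * K * S^-1 * K' * N^-1 * (K * M^-1 * K') =
       N^-1 * K * S^-1 * (K' * N^-1 * K) * M^-1 * K' by rewrite !mulrA.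
    rewrite KNK (mulrBr (N^-1 * K * S^-1)) (mulrVK uS) !mulrBl.
    by rewrite (mulrK uM) !mulrA addrC subrK.
  by rewrite /T /schur mulrBr XN KX addrK.
have uT : T \is a GRing.unit by apply/unitrP; exists X.
by split=> //; apply: (mulrI uT); rewrite divrr.
Qed.

Section DissipativeSchur.
Variables (R : realType) (H : hilbertType R) (A : set (H -> H)).
Variables (A_vN : von_neumann_algebra A) (id_neq0 : (id : H -> H) != 0).
Local Notation V := (vnop A_vN id_neq0).
Local Notation J := (vn_i A_vN id_neq0).
Local Notation bnd := (@vnbnd _ _ _ A_vN id_neq0).
Local Notation bndP := (vnbndP A_vN id_neq0).
Implicit Types S T F K M N : V.

Lemma invertible_segmentW p p' F : p <= p' ->
  invertible_segment bnd J p F -> invertible_segment bnd J p' F.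
Proof. by move=> pp Fp w w01; have [? h] := Fp w w01; split=> //; exact: (bndW bndP) h. Qed.

Lemma inverse_lower_bound b T : 0 < b -> T \is a GRing.unit -> bnd b T^-1 ->
  lower_bound b^-1 T.
Proof.
move=> b0 uT [_ Tb] x; rewrite ler_pdivrMl//.
have {1}-> : x = T^-1 (T x) by rewrite -vn_mulE mulVr.
exact: Tb.
Qed.

Lemma im_geD c c' S T : im_ge c S -> im_ge c' T -> im_ge (c + c') (S + T).
Proof. by move=> Sc Tc x; rewrite vn_addE himDl mulrDl lerD. Qed.

(** With u = F^-1 D x the form of - C F^-1 D at x is minus the conjugate of the
form of F at u, so inversion and the sign both reverse the half-plane. *)
Lemma im_ge_conj (C D : V) F : F \is a GRing.unit -> im_ge 0 F -> is_adjoint C D ->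
  im_ge 0 (- (C * F^-1 * D)).
Proof.
move=> uF F0 CD x; rewrite mul0r vn_oppE himNl !vn_mulE /him CD -/(him _ _).
rewrite himC opprK; set u := F^-1 (D x).
have -> : D x = F u by rewrite /u -vn_mulE divrr.
by have := F0 u; rewrite mul0r.
Qed.

Lemma im_ge_schur c (C D : V) F M : F \is a GRing.unit -> im_ge 0 F -> is_adjoint C D ->
  im_ge c M -> im_ge c (schur C F D M).
Proof. by move=> uF F0 CD Mc; rewrite -[c]addr0; apply: im_geD => //; exact: im_ge_conj. Qed.

(** Only the uniformity in t needs care. For t < 1 the imaginary parts give
bounds that degenerate as t tends to 1; near t = 1 the operators are close to
invertible ones. The Schur complement of M is controlled by the formula of
schur_unit for its inverse. *)
Lemma schur_segment_exists (K K' M N : V) : is_adjoint K K' ->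
  M \is a GRing.unit -> im_ge 0 M -> N \is a GRing.unit -> im_ge 0 N ->
  schur K' N K M \is a GRing.unit -> exists p, schur_segment bnd J p K K' M N.
Proof.
move=> KK uM M0 uN N0 uS.
have K'K := is_adjoint_sym KK.
have [m m0 Mm] := unit_lower_bound uM.
have [s s0 Ss] := unit_lower_bound uS.
have [g Gg] := bnd_ex bndP (M - J); have g0 := bnd_ge0 bndP Gg.
have [k Hk] := bnd_ex bndP K; have [k' Hk'] := bnd_ex bndP K'.
have [n Hn] := bnd_ex bndP N^-1.
have k0 := bnd_ge0 bndP Hk; have k'0 := bnd_ge0 bndP Hk'; have n0 := bnd_ge0 bndP Hn.
pose q (a : R) := a / (a + 2).
have q0 a : 0 < a -> 0 < q a by move=> a0; rewrite divr_gt0// addr_gt0.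
pose s' := s / (1 + g); have s'0 : 0 < s' by rewrite divr_gt0// ltr_pwDl.
pose b := n + n * k * s'^-1 * k' * n + 1.
have b0 : 0 < b by rewrite ltr_wpDl// addr_ge0// !mulr_ge0// invr_ge0 ltW.
pose p := (q (q m))^-1 + (q s')^-1 + (q b^-1)^-1.
have pq a : 0 < a -> 0 <= (q a)^-1 by move=> a0; rewrite invr_ge0 ltW// q0.
have pm : (q (q m))^-1 <= p by rewrite /p -addrA lerDl addr_ge0// pq// invr_gt0.
have ps : (q s')^-1 <= p by rewrite /p addrAC lerDr addr_ge0// pq ?q0// invr_gt0.
have pb : (q b^-1)^-1 <= p by rewrite /p lerDr addr_ge0// pq// q0.
exists p => t t01; have /andP[t0 t1] := t01.
set Mt := segment J M t.
have Mt_lb : lower_bound (q m) Mt by exact: segment_lower_bound.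
have Mt_im : im_ge (1 - t) Mt by exact: segment_im_ge.
have Mt_im0 : im_ge 0 Mt by apply: im_geW Mt_im; rewrite subr_ge0.
have [uMt _] : Mt \is a GRing.unit /\ bnd (q m)^-1 Mt^-1 by exact: dissipative_segment.
have sM := dissipative_segment (q0 _ m0) Mt_im0 Mt_lb.
set St := schur K' N K Mt.
have St_im : im_ge (1 - t) St by exact: im_ge_schur.
(* Away from t = 1 the imaginary part bounds St below; near t = 1 the operator
   St is close to its invertible value at 1. The number s' balances the two. *)
have St_lb : lower_bound s' St.
  have [h|h] := leP s' (1 - t); first by apply: lower_boundW h _; exact: im_ge_lower_bound.
  move=> x.
  have SB : schur K' N K M - St = (1 - t) *: (M - J).
    by rewrite /St /schur opprB addrA subrK -(segmentB J M) segment1.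
  have Sx : St x = schur K' N K M x - ((1 - t) *: (M - J)) x.
    by rewrite -vn_subE -SB opprB addrC subrK.
  have [_ Gx] := bndZ bndP (1 - t) Gg.
  have h1 := Ss x; have h2 := Gx x.
  have h3 : vnorm (schur K' N K M x) <= vnorm (St x) + vnorm (((1 - t) *: (M - J)) x).
    by rewrite -{1}[schur K' N K M x](subrK (((1 - t) *: (M - J)) x)) -Sx vnormD.
  rewrite ger0_norm ?subr_ge0// in h2.
  have h4 : (1 - t) * g * vnorm x <= s' * g * vnorm x.
    by rewrite ler_wpM2r ?vnorm_ge0// ler_wpM2r// ltW.
  have -> : s' * vnorm x = s * vnorm x - s' * g * vnorm x.
    by rewrite /s'; field; rewrite gt_eqF// ltr_pwDl.
  lra.
have sS := dissipative_segment s'0 (im_geW (_ : 0 <= 1 - t) St_im) St_lb.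
have {}sS := sS (_ : 0 <= 1 - t); rewrite subr_ge0 in sS; have {}sS := sS t1.
have [uSt bSt] := invertible_segment_unit sS.
have bSt' : bnd s'^-1 St^-1.
  split; first by rewrite invr_ge0 ltW.
  move=> x; rewrite ler_pdivlMl//; apply: (le_trans (St_lb _)).
  by rewrite -vn_mulE divrr.
have [uTt TtE] := schur_unit uMt uN uSt.
set Tt := schur K Mt K' N in uTt TtE *.
have Tt_im : im_ge 0 Tt by exact: im_ge_schur.
have bTt : bnd b Tt^-1.
  rewrite TtE; apply: (bndW bndP (_ : n + n * k * s'^-1 * k' * n <= _)).
    by rewrite lerDl.
  apply: (bndD bndP) => //.
  by repeat (first [exact: Hk | exact: Hk' | exact: Hn | exact: bSt' | apply: (bndM bndP)]).
have binv0 : 0 < b^-1 by rewrite invr_gt0.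
have sT := dissipative_segment binv0 Tt_im (inverse_lower_bound b0 uTt bTt).
by split; [exact: invertible_segmentW sM|exact: invertible_segmentW sS|
  exact: invertible_segmentW sT].
Qed.

(** Both deformations of log_schur stay among invertible dissipative operators.
The second one, which moves N, starts with M already at i; the Schur complement
that has to be invertible there is the one at the end of the first. *)
Lemma dissipative_log_schur (c : R) (omega : V -> R) (K K' M N : V) :
  bounded_functional bnd c omega -> (forall S T, omega (S * T) = omega (T * S)) ->
  is_adjoint K K' -> M \is a GRing.unit -> im_ge 0 M ->
  N \is a GRing.unit -> im_ge 0 N ->
  schur K' N K M \is a GRing.unit ->
  segment_log J omega (schur K' N K M) - segment_log J omega M =
  segment_log J omega (schur K M K' N) - segment_log J omega N.
Proof.
move=> om omC KK uM M0 uN N0 uS.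
have [p MN] := schur_segment_exists KK uM M0 uN N0 uS.
have uJ := vn_i_unit A_vN id_neq0.
have J0 : im_ge 0 J by move=> x; rewrite mul0r vn_iE him_il hre_nn sqr_ge0.
have [_ _ T0] := MN 0 (introT andP (conj (lexx _) ler01)).
rewrite vn_segment0 in T0; have [uT0 _] := invertible_segment_unit T0.
have [p' NJ] := schur_segment_exists (is_adjoint_sym KK) uN N0 uJ J0 uT0.
have maxl : p <= Num.max p p' by rewrite le_max lexx.
have maxr : p' <= Num.max p p' by rewrite le_max lexx orbT.
apply: (log_schur bndP om omC uJ (@vn_iC _ _ _ A_vN id_neq0) (p := Num.max p p')) => //.
  by move=> t t01; have [? ? ?] := MN t t01; split; apply: invertible_segmentW maxl _.
by move=> t t01; have [? ? ?] := NJ t t01; split; apply: invertible_segmentW maxr _.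
Qed.

End DissipativeSchur.

(** * States on the algebra *)

Section State.
Variables (R : realType) (H : hilbertType R) (A : set (H -> H)).
Variable A_vN : von_neumann_algebra A.
Variable tau : (H -> H) -> R[i].
Hypothesis tauP : state_on A tau.
Implicit Types S T : H -> H.

Lemma tau_comb a S T : A S -> A T -> tau (a *: S + T) = a * tau S + tau T.
Proof. by case: tauP => + _ _ AS AT; apply. Qed.

Lemma tau0 : tau 0 = 0.
Proof.
have := tau_comb 1 (vN0 A_vN) (vN0 A_vN); rewrite scale1r addr0 mul1r.
by move=> h; apply: (addrI (tau 0)); rewrite addr0 -h.
Qed.

Lemma tauZ a S : A S -> tau (a *: S) = a * tau S.
Proof. by move=> AS; rewrite -[_ *: _]addr0 tau_comb ?tau0 ?addr0//; exact: vN0. Qed.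

Lemma tauD S T : A S -> A T -> tau (S + T) = tau S + tau T.
Proof. by move=> AS AT; rewrite -[S]scale1r tau_comb// mul1r scale1r. Qed.

Lemma vN_scale a S : A S -> A (a *: S).
Proof. by move=> AS; rewrite -[_ *: _]addr0; apply: (vN_comb A_vN) => //; exact: vN0. Qed.

Lemma vN_add S T : A S -> A T -> A (S + T).
Proof. by move=> AS AT; rewrite -[S]scale1r; exact: vN_comb. Qed.

(** Both e + T and e - T are positive. *)
Lemma tau_real_form e T : A T -> (forall x, him (T x) x = 0) ->
  (forall x, `|hre (T x) x| <= e * vnorm x ^+ 2) ->
  complex.Im (tau T) = 0 /\ `|complex.Re (tau T)| <= e.
Proof.
move=> AT T0 Te.
have tau_pos : forall S, A S -> pos_op S -> 0 <= tau S by case: tauP.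
have tau1 : tau id = 1 by case: tauP.
have Aid := vN_id A_vN.
have key (s : R) : `|s| = 1 -> 0 <= e%:C + s%:C * tau T.
  move=> s1; have -> : e%:C + s%:C * tau T = tau (s%:C *: T + e%:C *: id).
    by rewrite tau_comb ?tauZ ?tau1 ?mulr1 1?addrC//; exact: vN_scale.
  apply: tau_pos; first by apply: (vN_comb A_vN) => //; exact: vN_scale.
  move=> x; rewrite -[(_ + _ : H -> H) x]/(s%:C *: T x + e%:C *: x).
  rewrite complex_ge0; apply/andP; split.
    rewrite -/(him _ _) himDl !himZl T0 mulr0 add0r.
    by rewrite /him hdot_nn /= mulr0.
  rewrite -/(hre _ _) hreDl !hreZl hre_nn.
  have := Te x; rewrite -[`|hre _ _|]mul1r -s1 -normrM ler_norml => /andP[h _].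
  by rewrite -lerBlDr sub0r.
have := key 1 (normr1 _); have := key (-1) (normrN1 _).
rewrite !complex_ge0 !cImD !cReD !cImM !cReM /= !mul0r !addr0 !add0r !subr0.
rewrite mulN1r !mul1r mulN1r ler_norml => /andP[_ h1] /andP[/eqP-> h2]; split=> //.
by apply/andP; split; lra.
Qed.

Definition im_part T : H -> H := (2^-1)%:C *: ((- 'i) *: (T + (-1) *: adj T)).

Lemma im_partE T x : im_part T x = (2^-1)%:C *: (- ('i *: (T x - adj T x))).
Proof.
rewrite -[LHS]/((2^-1)%:C *: ((- 'i) *: (T x + (-1) *: adj T x))).
by rewrite scaleN1r scaleNr.
Qed.

Lemma vN_im_part T : A T -> A (im_part T).
Proof.
move=> AT; have [AT' _] := vN_adj A_vN AT.
by apply/vN_scale/vN_scale/vN_add => //; exact: vN_scale.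
Qed.

Lemma im_part_hre T x y : A T ->
  hre (im_part T x) y = 2^-1 * (him (T x) y + him (T y) x).
Proof.
move=> AT; have [_ TT'] := vN_adj A_vN AT.
rewrite im_partE hreZl hreNl hre_il opprK -/(him _ _) himDl himNl.
by rewrite (himC (adj T x)) opprK; congr (_ * (_ + _)); rewrite /him TT'.
Qed.

Lemma im_part_sym T x y : A T -> hre (im_part T x) y = hre x (im_part T y).
Proof. by move=> AT; rewrite (hreC x) !im_part_hre// addrC. Qed.

Lemma im_part_form T x : A T -> hre (im_part T x) x = him (T x) x.
Proof. by move=> AT; rewrite im_part_hre//; lra. Qed.

Lemma hre_adj T x : A T -> hre (adj T x) x = hre (T x) x.
Proof. by move=> AT; have [_ TT'] := vN_adj A_vN AT; rewrite hreC /hre -TT'. Qed.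

Lemma im_part_him T x : A T -> him (im_part T x) x = 0.
Proof.
by move=> AT; rewrite im_partE himZl himNl him_il hreBl hre_adj// subrr oppr0 mulr0.
Qed.

(** Split T into real and imaginary parts: the state is real on both, and the
form of the imaginary part is the imaginary part of the form of T. *)
Lemma Im_tau_le e T : A T -> (forall x, `|him (T x) x| <= e * vnorm x ^+ 2) ->
  `|complex.Im (tau T)| <= e.
Proof.
move=> AT Te.
have [AT' TT'] := vN_adj A_vN AT.
have [b [b0 Tb]] := vN_norm_le A_vN AT.
pose X := (2^-1)%:C *: (T + adj T); pose Y := im_part T.
have AX : A X by apply/vN_scale/vN_add.
have AY : A Y by exact: vN_im_part.
have imT' x : him (adj T x) x = - him (T x) x.
  by rewrite himC /him -TT'.
have XE x : X x = (2^-1)%:C *: (T x + adj T x) by [].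
have half (a : R) : 2^-1 * (a + a) = a by lra.
have [|x|X0 _] := @tau_real_form b X AX.
- by move=> x; rewrite XE himZl himDl imT' subrr mulr0.
- rewrite XE hreZl hreDl hre_adj// half.
  by apply: (le_trans (hre_norm_le _ _)); rewrite expr2 mulrA ler_wpM2r ?vnorm_ge0.
have [|x|Y0 Ye] := @tau_real_form e Y AY.
- by move=> x; exact: im_part_him.
- by rewrite im_part_form.
have TXY : T = X + 'i *: Y.
  apply/funext => x; rewrite -[RHS]/(X x + 'i *: Y x) XE /Y im_partE.
  rewrite (scalerA 'i) (mulrC 'i) -scalerA scalerN scalerA -expr2 sqr_i scaleN1r opprK.
  rewrite -scalerDr addrACA subrr addr0 -[T x in RHS]scale1r -scalerDl scalerA.
  rewrite (_ : _ * _ = 1) ?scale1r//; apply: complex_eq => /=; last by ring.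
  by rewrite addr0 mul0r subr0; exact: half.
have -> : tau T = tau X + 'i * tau Y.
  by rewrite {1}TXY (tauD AX (vN_scale _ AY)) (tauZ _ AY).
by rewrite cImD cImM /= X0 mul0r mul1r !add0r.
Qed.

End State.

(** * Spectral projections *)

Section SymmetricForms.
Variables (R : realType) (K : hilbertType R).

(** The numerical radius of a symmetric operator is its norm. Polarize at x and
v, the multiple of S x that has the norm of x, and use the parallelogram law.
The operator may be defined on a subspace D only; it serves for spectral
subspaces of unbounded operators and for bounded operators alike. *)
Lemma symmetric_form_bound (D : set K) (S : K -> K) (d : R) :
  (forall (r : R) x y, D x -> D y -> D (r%:C *: x + y)) ->
  (forall (r : R) x y, D x -> D y -> S (r%:C *: x + y) = r%:C *: S x + S y) ->
  (forall x, D x -> D (S x)) ->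
  (forall x y, D x -> D y -> hre (S x) y = hre x (S y)) ->
  (forall x, D x -> `|hre (S x) x| <= d * vnorm x ^+ 2) ->
  forall x, D x -> vnorm (S x) <= d * vnorm x.
Proof.
move=> DP SP DS Ssym Sd x Dx.
have [Sx|Sx] := eqVneq (vnorm (S x)) 0.
  rewrite Sx; have [x0|x0] := eqVneq (vnorm x) 0; first by rewrite x0 mulr0.
  have X : 0 < vnorm x by rewrite lt_def x0 vnorm_ge0.
  have := Sd x Dx; rewrite (vnorm_eq0 Sx) hre0l normr0 expr2 mulrA.
  by rewrite pmulr_lge0.
have X : 0 < vnorm (S x) by rewrite lt_def Sx vnorm_ge0.
set t := vnorm x / vnorm (S x); set v := t%:C *: S x.
have nv : vnorm v = vnorm x.
  by rewrite /v vnormZ ger0_norm ?divr_ge0 ?vnorm_ge0// /t divfK.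
have Dv : D v.
  have D0 : D 0 by have := DP (-1) x x Dx Dx; rewrite rmorphN1 scaleN1r addNr.
  by rewrite /v -[_ *: _]addr0; apply: DP => //; exact: DS.
have S1 : S (1%:C *: x + v) = S x + S v by rewrite SP// rmorph1 scale1r.
have S2 : S ((-1)%:C *: x + v) = - S x + S v by rewrite SP// rmorphN1 scaleN1r.
have D1 := DP 1 _ _ Dx Dv; have D2 := DP (-1) _ _ Dx Dv.
have h1 := Sd _ D1; have h2 := Sd _ D2.
rewrite S1 in h1; rewrite S2 in h2.
rewrite rmorph1 scale1r vnorm_sqD nv hreDl !hreDr (hreC (S v) x) -(Ssym x v)// in h1.
rewrite rmorphN1 scaleN1r vnorm_sqD nv vnormN hreDl !hreDr !hreNl !hreNr
  (hreC (S v) x) -(Ssym x v)// in h2.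
have Sxv : hre (S x) v = vnorm x * vnorm (S x).
  by rewrite /v hreZr hre_nn /t expr2 mulrA divfK.
rewrite Sxv in h1 h2.
move: h1 h2; rewrite !ler_norml => /andP[_ h1] /andP[h2 _].
rewrite -(ler_pM2r X).
have [x0|x0] := eqVneq (vnorm x) 0.
  have : vnorm (S x) <= 0; last by move/(lt_le_trans X); rewrite ltxx.
  have : vnorm (S 0) = 0.
    have := SP (-1) x x Dx Dx.
    by rewrite rmorphN1 !scaleN1r !addNr => ->; rewrite vnorm0.
  by rewrite -(vnorm_eq0 x0) => ->.
have Xx : 0 < vnorm x by rewrite lt_def x0 vnorm_ge0.
have h : vnorm x * vnorm (S x) <= d * vnorm x ^+ 2 by lra.
have : vnorm (S x) <= d * vnorm x.
  by rewrite -(ler_pM2l Xx); apply: (le_trans h); rewrite expr2; lra.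
by rewrite ler_pM2r.
Qed.

End SymmetricForms.

Section SpectralProjections.
Variables (R : realType) (K : hilbertType R) (E : projection_measure K).
Local Notation Rm := (measurableTypeR R).
Implicit Types (B C : set Rm) (x y z : K).

Lemma pvm_linear B : measurable B -> linear (E B).
Proof. by move=> /(pvm_projection E)[/bounded_op_linear]. Qed.

Lemma pvmK B x : measurable B -> E B (E B x) = E B x.
Proof. by move=> /(pvm_projection E)[_ EE _]; rewrite -[LHS]/((E B \o E B) x) EE. Qed.

Lemma pvm_sym B x y : measurable B -> hdot (E B x) y = hdot x (E B y).
Proof. by move=> /(pvm_projection E)[_ _]; apply. Qed.

Lemma pvm_hre B x y : measurable B -> hre (E B x) y = hre x (E B y).
Proof. by move=> mB; rewrite /hre pvm_sym. Qed.

Lemma pvm_nn B x : measurable B -> hre (E B x) x = vnorm (E B x) ^+ 2.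
Proof. by move=> mB; rewrite -hre_nn -pvm_hre// pvmK. Qed.

Lemma pvm_capE B C x : measurable B -> measurable C ->
  E B (E C x) = E (B `&` C) x.
Proof. by move=> mB mC; rewrite pvm_setI. Qed.

Lemma pvm_le B x : measurable B -> vnorm (E B x) <= vnorm x.
Proof.
move=> mB; have [E0|E0] := eqVneq (vnorm (E B x)) 0; first by rewrite E0 vnorm_ge0.
have X : 0 < vnorm (E B x) by rewrite lt_def E0 vnorm_ge0.
by rewrite -(ler_pM2l X) -expr2 -pvm_nn// hre_le.
Qed.

Lemma pvm_scalar_sq B x : measurable B ->
  pvm_scalar E x B = (vnorm (E B x) ^+ 2)%:E.
Proof. by move=> mB; rewrite pvm_scalarE// -pvm_nn. Qed.

Lemma pvm_scalar_setT x : pvm_scalar E x setT = (vnorm x ^+ 2)%:E.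
Proof. by rewrite pvm_scalar_sq// pvm_setT. Qed.

Lemma pvm_scalar_fin B x : measurable B -> (pvm_scalar E x B < +oo)%E.
Proof. by move=> mB; rewrite pvm_scalar_sq// ltry. Qed.

(** The difference of the two sides is symmetric with vanishing form, by the
additivity of the scalar measures. *)
Lemma pvm_setU B C x : measurable B -> measurable C -> B `&` C = set0 ->
  E (B `|` C) x = E B x + E C x.
Proof.
move=> mB mC BC; have mU := measurableU _ _ mB mC.
have lB := pvm_linear mB; have lC := pvm_linear mC; have lU := pvm_linear mU.
apply/eqP; rewrite -subr_eq0; apply/eqP/vnorm_eq0/eqP; rewrite eq_le vnorm_ge0 andbT.
rewrite -[leRHS](mul0r (vnorm x)).
apply: (@symmetric_form_bound R K setT (fun x => E (B `|` C) x - (E B x + E C x)) 0) => //.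
- move=> r u v _ _; rewrite lB lC lU.
  by rewrite scalerBr scalerDr (addrACA (_ *: E B u)) opprD addrACA.
- by move=> u v _ _; rewrite hreBl hreDl hreBr hreDr !pvm_hre.
- move=> u _; rewrite mul0r hreBl hreDl !pvm_nn//.
  have : (vnorm (E (B `|` C) u) ^+ 2)%:E = (vnorm (E B u) ^+ 2 + vnorm (E C u) ^+ 2)%:E
    := etrans (esym (pvm_scalar_sq u mU)) (etrans (measureU (pvm_scalar E u) mB mC BC)
    (congr2 adde (pvm_scalar_sq u mB) (pvm_scalar_sq u mC))).
  by case=> ->; rewrite subrr normr0.
Qed.

End SpectralProjections.

(** * Local calculus of a self-adjoint operator from its spectral measure *)

Section SpectralCalculus.
Variables (R : realType) (K : hilbertType R).
Variables (L : unbounded_operator K) (E : projection_measure K).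
Hypotheses (sa : self_adjoint L) (sp : spectral_measure_of L E).
Local Notation Rm := (measurableTypeR R).
Local Notation mu := (pvm_scalar E).
Implicit Types (B C : set Rm) (x y z : K).

Lemma udomE x : udom L x <-> (\int[mu x]_(l in setT) (l ^+ 2)%:E < +oo)%E.
Proof. by case: sp => -> _. Qed.

Lemma udom_comb a x y : udom L x -> udom L y -> udom L (a *: x + y).
Proof. by case: (udom_subspace L) => _; apply. Qed.

Lemma udom0 : udom L 0. Proof. by case: (udom_subspace L). Qed.
Lemma udomD x y : udom L x -> udom L y -> udom L (x + y).
Proof. by move=> Dx Dy; rewrite -[x]scale1r; exact: udom_comb. Qed.

Lemma uopD x y : udom L x -> udom L y -> L (x + y) = L x + L y.
Proof. by move=> Dx Dy; rewrite -[x in LHS]scale1r uop_linear// scale1r. Qed.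
Lemma uop0 : L 0 = 0.
Proof. by apply: (addrI (L 0)); rewrite -uopD ?addr0//; exact: udom0. Qed.
Lemma uop_sym x y : udom L x -> udom L y -> hre (L x) y = hre x (L y).
Proof. by move=> Dx Dy; case: sa => _ /(_ y (L y))[_ h]; rewrite /hre h. Qed.

Lemma udom_pvm B x : measurable B -> udom L x -> udom L (E B x).
Proof.
move=> mB /udomE Dx; apply/udomE; apply: le_lt_trans Dx.
apply: ge0_le_measure_integral => //.
- move=> C mC; rewrite !pvm_scalar_sq// pvm_capE// setIC -pvm_capE// lee_fin.
  by rewrite ler_sqr ?nnegrE ?vnorm_ge0// pvm_le.
- by move=> l; rewrite lee_fin sqr_ge0.
- by apply/measurable_EFinP; exact: measurable_funX.
Qed.

Lemma udom_integrable x : udom L x -> (mu x).-integrable setT (fun l => l%:E).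
Proof.
move=> Dx.
have i1 : (mu x).-integrable setT (fun l : Rm => (1 + l ^+ 2)%:E).
  apply/integrableP; split.
    by apply/measurable_EFinP; apply: measurable_funD => //; exact: measurable_funX.
  under eq_integral do rewrite gee0_abs ?lee_fin ?addr_ge0 ?sqr_ge0// EFinD.
  rewrite ge0_integralD//=.
  - rewrite integral_cst// mul1e lte_add_pinfty//; first exact: pvm_scalar_fin.
    exact/udomE.
  - by move=> l _; rewrite lee_fin sqr_ge0.
  - by apply/measurable_EFinP; exact: measurable_funX.
apply: le_integrable i1 => //; first exact/measurable_EFinP.
move=> l _; rewrite !abse_EFin lee_fin.
rewrite (ger0_norm (_ : 0 <= 1 + l ^+ 2)); last by rewrite addr_ge0// sqr_ge0.
have h : 0 <= (`|l| - 1) ^+ 2 := sqr_ge0 _.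
have h2 : `|l| ^+ 2 = l ^+ 2 by rewrite real_normK// num_real.
have h3 := normr_ge0 l; rewrite -h2; nra.
Qed.

Lemma uop_form x : udom L x -> hre (L x) x = fine (\int[mu x]_(l in setT) l%:E).
Proof. by move=> Dx; case: sp => _ /(_ x Dx); rewrite /hre => ->. Qed.

Lemma uop_form_im x : udom L x -> him (L x) x = 0.
Proof. by move=> Dx; case: sp => _ /(_ x Dx); rewrite /him => ->. Qed.

(** The scalar measure of x is the sum of those of its two components. *)
Lemma uop_form_split B x : measurable B -> udom L x ->
  hre (L x) x = hre (L (E B x)) (E B x) + hre (L (E (~` B) x)) (E (~` B) x).
Proof.
move=> mB Dx; have mCB := measurableC mB.
have D1 := udom_pvm mB Dx; have D2 := udom_pvm mCB Dx.
have i1 := udom_integrable D1; have i2 := udom_integrable D2.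
rewrite !uop_form// -fineD; [|exact: integrable_fin_num..].
congr fine; rewrite -(integral_measure_add measurableT i1 i2).
apply: eq_measure_integral => C mC _.
have mCB' := measurableI _ _ mC mB; have mCCB := measurableI _ _ mC mCB.
rewrite [RHS]measure_addE.
rewrite (pvm_scalar_sq E x mC) (pvm_scalar_sq E _ mC) (pvm_scalar_sq E _ mC) !pvm_capE//.
rewrite -EFinD; congr (_%:E).
rewrite -!pvm_nn// -hreDl -pvm_setU//; last first.
  by rewrite setIACA setICr setI0.
by rewrite -setIUr setUv setIT.
Qed.

Lemma pvm_set0 x : E set0 x = 0.
Proof.
have := pvm_setU E x measurable0 measurable0 (setI0 _).
by rewrite setU0 -[X in X = _]addr0 => /addrI.
Qed.

(** The cross terms of the form of L at a + b vanish by uop_form_split, and they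
are twice the real part of <L a, b> because L is symmetric. *)
Lemma uop_cross B x y : measurable B -> udom L x -> udom L y ->
  hre (L (E (~` B) x)) (E B y) = 0.
Proof.
move=> mB Dx Dy; have mCB := measurableC mB.
set a := E (~` B) x; set b := E B y.
have Da : udom L a by exact: udom_pvm.
have Db : udom L b by exact: udom_pvm.
have Eab : E B (a + b) = b.
  by rewrite (linD _ _ (pvm_linear E mB)) /a /b !pvm_capE// setICr setIid pvm_set0 add0r.
have Eab' : E (~` B) (a + b) = a.
  by rewrite (linD _ _ (pvm_linear E mCB)) /a /b !pvm_capE// setICl setIid pvm_set0 addr0.
have := uop_form_split mB (udomD Da Db).
rewrite Eab Eab' uopD// !hreDl !hreDr (uop_sym Db Da) (hreC b (L a)).
lra.
Qed.

Lemma pvm_uop_cross B x : measurable B -> udom L x -> E B (L (E (~` B) x)) = 0.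
Proof.
move=> mB Dx; apply: (@hre_dense_eq0 _ _ (udom L)); first by case: sa.
by move=> z Dz; rewrite pvm_hre// uop_cross.
Qed.

Lemma pvm_uop B x : measurable B -> udom L x -> E B (L x) = L (E B x).
Proof.
move=> mB Dx; have mCB := measurableC mB.
have xE : x = E B x + E (~` B) x.
  by rewrite -pvm_setU// ?setUv ?pvm_setT// setICr.
have D1 := udom_pvm mB Dx; have D2 := udom_pvm mCB Dx.
rewrite {1}xE uopD// (linD _ _ (pvm_linear E mB)) pvm_uop_cross// addr0.
have := pvm_uop_cross mCB Dx; rewrite setCK => h.
have /(congr1 (fun f => f (L (E B x)))) := pvm_setT E.
by rewrite -(setUv B) pvm_setU ?setICr// h addr0.
Qed.

Lemma udom_bounded B x (M : R) : measurable B -> (forall l : R, B l -> `|l| <= M) ->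
  E B x = x -> udom L x.
Proof.
move=> mB BM Ex; have mCB := measurableC mB.
have xC : mu x (~` B) = 0.
  by rewrite pvm_scalar_sq// -Ex pvm_capE// setICl pvm_set0 vnorm0 expr0n.
apply/udomE; rewrite (ge0_negligible_integral mCB) //; last first.
- by move=> l _; rewrite lee_fin sqr_ge0.
- by apply/measurable_EFinP; exact: measurable_funX.
rewrite setDE setCK setTI.
apply: (@le_lt_trans _ _ (\int[mu x]_(l in B) (M ^+ 2)%:E)%E).
  apply: ge0_le_integral => //.
  - by move=> l _; rewrite lee_fin sqr_ge0.
  - by apply/measurable_EFinP; exact: measurable_funX.
  - by move=> l Bl; rewrite lee_fin -(real_normK (num_real l)) lerXn2r ?nnegrE
      ?(le_trans _ (BM l Bl))//; exact: BM.
rewrite integral_cst// pvm_scalar_sq// -EFinM ltry //.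
Qed.

Lemma uop_local_form B z (c d : R) : measurable B -> 0 <= d ->
  (forall l : R, B l -> `|l - c| <= d) -> E B z = z -> udom L z ->
  `|hre (L z) z - c * vnorm z ^+ 2| <= d * vnorm z ^+ 2.
Proof.
move=> mB d0 Bcd Ez Dz; have mCB := measurableC mB.
have zC : mu z (~` B) = 0.
  by rewrite pvm_scalar_sq// -Ez pvm_capE// setICl pvm_set0 vnorm0 expr0n.
have iz := udom_integrable Dz.
have izB : (mu z).-integrable B (EFin \o (fun l : Rm => l : R)).
  exact: (@integrableS _ Rm _ (mu z) setT B _ measurableT mB (@subsetT _ _) iz).
have ic (r : R) : (mu z).-integrable B (EFin \o (fun _ : Rm => r)).
  apply/integrableP; split; first exact/measurable_EFinP.
  by rewrite integral_cst//= pvm_scalar_sq// ltry.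
have mz : fine (mu z B) = vnorm z ^+ 2 by rewrite pvm_scalar_sq//= Ez.
rewrite uop_form// (negligible_integral mCB)// setDE setCK setTI.
rewrite -/(Rintegral (mu z) B (fun l => l)).
rewrite -mz -(Rintegral_cst (mu z) mB c) -(Rintegral_cst (mu z) mB d) -RintegralB//.
apply: (le_trans (le_normr_Rintegral _ _)) => //.
  exact: (@integrableB _ Rm _ _ _ mB (EFin \o _) (EFin \o _) izB (ic c)).
apply: le_Rintegral => //.
by apply: integrable_norm; exact: (@integrableB _ Rm _ _ _ mB (EFin \o _) (EFin \o _) izB (ic c)).
Qed.

(** On the range of E B, where B lies within d of c, the form of L - c is at
most d in absolute value, hence so is its norm. *)
Lemma uop_local B u (c d : R) : measurable B -> 0 <= d ->
  (forall l : R, B l -> `|l - c| <= d) -> E B u = u ->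
  udom L u /\ vnorm (L u - c%:C *: u) <= d * vnorm u.
Proof.
move=> mB d0 Bcd Eu.
have dB z : E B z = z -> udom L z.
  move=> Ez; apply: (@udom_bounded B z (`|c| + d)) => // l /Bcd Bl.
  by rewrite -[l](subrK c) (le_trans (ler_normD _ _))// addrC lerD2l.
split; first exact: dB.
have lB := pvm_linear E mB.
apply: (@symmetric_form_bound R K [set z | E B z = z] (fun z => L z - c%:C *: z) d) => //.
- by move=> r x y Ex Ey; rewrite /= lB Ex Ey.
- move=> r x y /dB Dx /dB Dy; rewrite uop_linear//.
  by rewrite scalerBr scalerDr !scalerA (mulrC c%:C) opprD addrACA.
- move=> x Ex; rewrite /= (linB _ _ lB) (linZ _ _ lB) Ex.
  by rewrite pvm_uop ?Ex//; exact: dB.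
- by move=> x y /dB Dx /dB Dy; rewrite hreBl hreBr uop_sym// hreZl hreZr.
- move=> x Ex; rewrite hreBl hreZl hre_nn; apply: (uop_local_form mB) => //; exact: dB.
Qed.

End SpectralCalculus.

(** * The resolvent as an integral against the scalar measure *)

Section ResolventKernel.
Variables (R : realType) (s : R).
Hypothesis s0 : 0 < s.

Definition res_kernel (l : R) : R := l / (l ^+ 2 + s ^+ 2).

Lemma res_den_gt0 (l : R) : 0 < l ^+ 2 + s ^+ 2.
Proof. by rewrite ltr_wpDl ?sqr_ge0// exprn_gt0. Qed.

Lemma res_kernel_le (l : R) : `|res_kernel l| <= s^-1.
Proof.
rewrite /res_kernel normrM normfV (gtr0_norm (res_den_gt0 l)).
rewrite ler_pdivrMr ?res_den_gt0// ler_pdivlMl//.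
have h2 : `|l| ^+ 2 = l ^+ 2 by rewrite real_normK// num_real.
rewrite -h2; have := sqr_ge0 (`|l| - s); have := sqr_ge0 `|l|; have := sqr_ge0 s; nra.
Qed.

Lemma res_kernel_lip (l c : R) : `|res_kernel l - res_kernel c| <= s ^- 2 * `|l - c|.
Proof.
have Dl := res_den_gt0 l; have Dc := res_den_gt0 c.
have -> : res_kernel l - res_kernel c =
  (s ^+ 2 - l * c) / ((l ^+ 2 + s ^+ 2) * (c ^+ 2 + s ^+ 2)) * (l - c).
  by rewrite /res_kernel; field; rewrite !gt_eqF.
rewrite normrM ler_wpM2r// normrM normfV (gtr0_norm (mulr_gt0 Dl Dc)).
rewrite ler_pdivrMr ?mulr_gt0// ler_pdivlMl ?exprn_gt0//.
rewrite -[X in X * _](gtr0_norm (exprn_gt0 2 s0)) -normrM ler_norml.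
have h1 := sqr_ge0 (l * c); have h2 := sqr_ge0 (s * (l + c)); have h3 := sqr_ge0 (s * l).
have h4 := sqr_ge0 (s * c); have h5 := sqr_ge0 (s * (l - c)).
have h6 := sqr_ge0 (s ^+ 2).
by apply/andP; split; nra.
Qed.

Lemma measurable_res_kernel :
  measurable_fun setT (res_kernel : measurableTypeR R -> measurableTypeR R).
Proof.
apply: continuous_measurable_fun => l; apply: cvgM; first exact: cvg_id.
apply: cvgV; first by rewrite gt_eqF// res_den_gt0.
by apply: cvgD; [exact: exprn_continuous|exact: cvg_cst].
Qed.

End ResolventKernel.

Lemma bounded_fun_integrable (R : realType)
    (mu : {measure set (measurableTypeR R) -> \bar R})
    (B : set (measurableTypeR R)) (f : R -> R) (M : R) :
  measurable B -> (mu B < +oo)%E ->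
  measurable_fun setT (f : measurableTypeR R -> measurableTypeR R) ->
  (forall l, `|f l| <= M) ->
  mu.-integrable B (EFin \o (f : measurableTypeR R -> R)).
Proof.
move=> mB muB mf fM; apply: measurable_bounded_integrable => //.
  exact: measurable_funTS.
by exists M; split; [exact: num_real|move=> a Ma l _ /=; exact: le_trans (ltW Ma)].
Qed.

Section ResolventForm.
Variables (R : realType) (K : hilbertType R).
Variables (L : unbounded_operator K) (E : projection_measure K).
Hypotheses (sa : self_adjoint L) (sp : spectral_measure_of L E).
Local Notation Rm := (measurableTypeR R).
Local Notation mu := (pvm_scalar E).
Variables (s : R) (x y : K).
Hypotheses (s0 : 0 < s) (Dx : udom L x) (yE : L x + s%:C *: ('i *: x) = y).
Implicit Types (B C : set Rm).

Let k : R -> R := res_kernel s.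

Lemma k_integrable B : measurable B -> (mu y).-integrable B (EFin \o (k : Rm -> R)).
Proof.
move=> mB; apply: (@bounded_fun_integrable _ _ _ _ s^-1) => //.
- exact: pvm_scalar_fin.
- exact: measurable_res_kernel.
- exact: res_kernel_le.
Qed.

(** The failure, localized to B, of the formula for the resolvent to be proved. *)
Definition form_defect B : R :=
  hre (E B x) y - \int[mu y]_(l in B) k l.

Lemma pvm_sqU B C z : measurable B -> measurable C -> B `&` C = set0 ->
  vnorm (E (B `|` C) z) ^+ 2 = vnorm (E B z) ^+ 2 + vnorm (E C z) ^+ 2.
Proof.
by move=> mB mC BC; rewrite -!pvm_nn//; [rewrite pvm_setU// hreDl|exact: measurableU].
Qed.

Lemma form_defectU B C : measurable B -> measurable C -> B `&` C = set0 ->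
  form_defect (B `|` C) = form_defect B + form_defect C.
Proof.
move=> mB mC BC; rewrite /form_defect pvm_setU// hreDl Rintegral_setU//.
- by ring.
- by apply: k_integrable; exact: measurableU.
- by rewrite disj_set2E BC.
Qed.

Lemma form_defect_bound B : measurable B ->
  `|form_defect B| <= (vnorm x + s^-1 * vnorm y) * vnorm (E B y).
Proof.
move=> mB; rewrite /form_defect; apply: (le_trans (ler_normB _ _)); rewrite mulrDl; apply: lerD.
  by rewrite pvm_hre// hre_norm_le.
apply: (le_trans (le_normr_Rintegral _ (k_integrable mB))) => //.
apply: (@le_trans _ _ (\int[mu y]_(l in B) s^-1)).
  apply: le_Rintegral => //.
  - exact: (integrable_norm (k_integrable mB)).
  - apply: (@bounded_fun_integrable _ _ _ _ s^-1) => //; first exact: pvm_scalar_fin.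
    by move=> _; rewrite ger0_norm// invr_ge0 ltW.
  - by move=> l _; exact: res_kernel_le.
rewrite Rintegral_cst// pvm_scalar_sq//= -mulrA ler_wpM2l//; first by rewrite invr_ge0 ltW.
by rewrite expr2 ler_wpM2r ?vnorm_ge0// pvm_le.
Qed.

(** On the range of E B the operator L is c up to an error of norm d, so
E B x is E B y / (c + i s) up to that error; the kernel is also constant on B
up to d.
Hence the defect is of order d times the scalar measure of B. *)
Lemma form_defect_local B (c d : R) : measurable B -> 0 <= d ->
  (forall l : R, B l -> `|l - c| <= d) ->
  `|form_defect B| <= d * ((2 + d / s) / s ^+ 2) * vnorm (E B y) ^+ 2.
Proof.
move=> mB d0 Bcd.
set u := E B x; set v := E B y.
have Eu : E B u = u by rewrite /u pvmK.
have [Du ru] := uop_local sa sp mB d0 Bcd Eu.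
set r := L u - c%:C *: u in ru.
have vE : v = L u + s%:C *: ('i *: u).
  rewrite /v -yE (linD _ _ (pvm_linear E mB)) !(linZ _ _ (pvm_linear E mB)).
  by rewrite (pvm_uop sa sp).
have LuE : L u = c%:C *: u + r by rewrite /r addrC subrK.
have hiu : hre u ('i *: u) = 0 by rewrite hre_ir hdot_nn.
have hLiu : hre (L u) ('i *: u) = 0 by rewrite hre_ir -/(him _ _) (uop_form_im sp).
have e1 : hre (E B x) y = c * vnorm u ^+ 2 + hre u r.
  by rewrite -/u -Eu pvm_hre// -/v vE hreDr hreZr hiu mulr0 addr0 LuE hreDr hreZr hre_nn !Eu.
have e2 : vnorm v ^+ 2 = (c ^+ 2 + s ^+ 2) * vnorm u ^+ 2 + 2 * c * hre u r + vnorm r ^+ 2.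
  have -> : vnorm v ^+ 2 = vnorm (L u) ^+ 2 + s ^+ 2 * vnorm u ^+ 2.
    rewrite vE vnorm_sqD hreZr hLiu vnormZ vnormi (ger0_norm (ltW s0)); ring.
  rewrite LuE vnorm_sqD hreZl vnormZ -(real_normK (num_real c)); ring.
have Dc := res_den_gt0 s0 c.
(* Eliminate the norm of u between e1 and e2. *)
have e3 : hre (E B x) y - k c * vnorm v ^+ 2 =
   hre u r * ((s ^+ 2 - c ^+ 2) / (c ^+ 2 + s ^+ 2)) - k c * vnorm r ^+ 2.
  by rewrite e1 e2 /k /res_kernel; field; rewrite gt_eqF.
have U0 := vnorm_ge0 u; have V0 := vnorm_ge0 v; have r0 := vnorm_ge0 r.
have uv : vnorm u ^+ 2 <= vnorm v ^+ 2 / s ^+ 2.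
  rewrite ler_pdivlMr ?exprn_gt0//.
  have -> : vnorm v ^+ 2 = vnorm (L u) ^+ 2 + s ^+ 2 * vnorm u ^+ 2.
    rewrite vE vnorm_sqD hreZr hLiu vnormZ vnormi (ger0_norm (ltW s0)); ring.
  by rewrite mulrC lerDr sqr_ge0.
have b1 : `|hre u r * ((s ^+ 2 - c ^+ 2) / (c ^+ 2 + s ^+ 2))| <= d * vnorm u ^+ 2.
  rewrite normrM.
  have q1 : `|(s ^+ 2 - c ^+ 2) / (c ^+ 2 + s ^+ 2)| <= 1.
    rewrite normrM normfV (gtr0_norm Dc) ler_pdivrMr// mul1r ler_norml.
    by have := sqr_ge0 c; have := sqr_ge0 s; move=> ? ?; apply/andP; split; lra.
  apply: (@le_trans _ _ `|hre u r|); first by rewrite ler_piMr.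
  apply: (le_trans (hre_norm_le _ _)); rewrite expr2 mulrC mulrA.
  by rewrite ler_wpM2r.
have b2 : `|k c * vnorm r ^+ 2| <= d ^+ 2 / s * vnorm u ^+ 2.
  rewrite normrM (ger0_norm (sqr_ge0 _)).
  have -> : d ^+ 2 / s * vnorm u ^+ 2 = s^-1 * (d * vnorm u) ^+ 2 by ring.
  apply: ler_pM; [exact: normr_ge0|exact: sqr_ge0|exact: res_kernel_le|].
  by rewrite lerXn2r ?nnegrE// mulr_ge0.
have ic (a : R) : (mu y).-integrable B (EFin \o (fun _ : Rm => a)).
  by apply: (@bounded_fun_integrable _ _ _ _ `|a|) => //; exact: pvm_scalar_fin.
have b3 : `|\int[mu y]_(l in B) k l - k c * vnorm v ^+ 2| <= d / s ^+ 2 * vnorm v ^+ 2.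
  have mv : fine (mu y B) = vnorm v ^+ 2 by rewrite pvm_scalar_sq.
  rewrite -mv -(Rintegral_cst (mu y) mB (k c)) -(Rintegral_cst (mu y) mB (d / s ^+ 2)).
  rewrite -RintegralB//; last exact: k_integrable.
  have iB := @integrableB _ Rm _ _ _ mB (EFin \o (k : Rm -> R)) (EFin \o _)
    (k_integrable mB) (ic (k c)).
  apply: (le_trans (le_normr_Rintegral _ _)) => //.
  apply: le_Rintegral => //; first exact: integrable_norm.
  move=> l /Bcd Bl; apply: (le_trans (res_kernel_lip s0 _ _)).
  by rewrite mulrC ler_wpM2r ?invr_ge0 ?sqr_ge0.
rewrite /form_defect.
have -> : hre (E B x) y - \int[mu y]_(l in B) k l =
  (hre (E B x) y - k c * vnorm v ^+ 2) - (\int[mu y]_(l in B) k l - k c * vnorm v ^+ 2).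
  by ring.
apply: (le_trans (ler_normB _ _)); apply: (le_trans (lerD (lexx _) b3)).
rewrite e3.
apply: (le_trans (lerD (le_trans (ler_normB _ _) (lerD b1 b2)) (lexx _))).
have h : (d + d ^+ 2 / s) * vnorm u ^+ 2 <= (d + d ^+ 2 / s) * (vnorm v ^+ 2 / s ^+ 2).
  by rewrite ler_wpM2l// addr_ge0// divr_ge0 ?sqr_ge0// ltW.
have -> : d * ((2 + d / s) / s ^+ 2) * vnorm v ^+ 2 =
  (d + d ^+ 2 / s) * (vnorm v ^+ 2 / s ^+ 2) + d / s ^+ 2 * vnorm v ^+ 2.
  by field; rewrite gt_eqF.
by rewrite lerD2r -mulrDl.
Qed.

(** The defect of an interval is its length times its measure, up to a constant,
and the defect is additive: increment_bound applies with the distribution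
function of the scalar measure. *)
Lemma form_defect_interval (T : R) : 0 < T -> form_defect `]- T, T] = 0.
Proof.
move=> T0.
pose C := (2 + T / s) / s ^+ 2.
pose h u := form_defect `]- T, u].
pose m u := C * fine (mu y `]- T, u]%classic).
have C0 : 0 <= C by rewrite divr_ge0 ?sqr_ge0// addr_ge0// divr_ge0// ltW.
have mI (a b : R) : measurable (`]a, b]%classic : set Rm) by exact: measurable_itv.
have TT : - T <= T by rewrite lerNl (le_trans _ (ltW T0))// oppr_le0 ltW.
have h0 : h (- T) = 0.
  by rewrite /h set_itv_ge ?bnd_simp ?ltxx// /form_defect pvm_set0 hre0l Rintegral_set0 subr0.
have split_itv (u v : R) : - T <= u -> u <= v ->
    `]- T, v]%classic = `]- T, u] `|` `]u, v] :> set R.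
  move=> Tu uv; apply/seteqP; split=> l /=; rewrite !in_itv/=.
    by move=> /andP[-> ->]; case: (leP l u) => lu; [left|right].
  move=> [/andP[-> lu]|/andP[ul ->]]; first by rewrite (le_trans lu).
  by rewrite (le_lt_trans Tu).
have disj (u v : R) : `]- T, u] `&` `]u, v] = set0 :> set R.
  by apply/seteqP; split=> // l /= [] ; rewrite !in_itv/= => /andP[_ lu] /andP[ul _];
    have := lt_le_trans ul lu; rewrite ltxx.
have := @increment_bound R h m (- T) T 0 TT; rewrite mul0r h0 subr0 normr_le0 => /(_ _)/eqP; apply.
move=> u v Tu uv vT.
have mB := mI (- T) u; have mC := mI u v.
rewrite /h (split_itv u v Tu uv) form_defectU//.
rewrite addrC addKr.
have -> : m v - m u = C * vnorm (E `]u, v]%classic y) ^+ 2.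
  rewrite /m -mulrBr; congr (_ * _).
  rewrite (split_itv u v Tu uv) pvm_scalar_sq ?pvm_scalar_sq//; last exact: measurableU.
  by rewrite /= pvm_sqU// addrC addKr.
(* The centre and the half-length of the interval from u to v. *)
pose d := (v - u) / 2; pose c := (u + v) / 2.
have d0 : 0 <= d by rewrite divr_ge0// subr_ge0.
have dT : d <= T by rewrite /d; lra.
have loc : `|form_defect `]u, v]| <= d * ((2 + d / s) / s ^+ 2) * vnorm (E `]u, v]%classic y) ^+ 2.
  apply: (form_defect_local (c := c) mC d0) => l; rewrite /= in_itv/= => /andP[ul lv].
  by rewrite ler_norml /d /c; apply/andP; split; lra.
apply: (le_trans loc); set N := vnorm _.
have -> : (0 + C * N ^+ 2) * (v - u) = (v - u) * C * N ^+ 2 by ring.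
rewrite ler_wpM2r ?sqr_ge0//.
apply: ler_pM => //; first by rewrite divr_ge0 ?sqr_ge0// addr_ge0// divr_ge0// ltW.
  by rewrite /d; lra.
rewrite ler_wpM2r ?invr_ge0 ?sqr_ge0// lerD2l ler_wpM2r// invr_ge0 ltW//.
Qed.

Lemma resolvent_form : hre x y = \int[mu y]_l k l.
Proof.
apply/eqP; rewrite -subr_eq0; apply/eqP.
have fT : form_defect setT = hre x y - \int[mu y]_l k l.
  by rewrite /form_defect pvm_setT.
rewrite -fT.
pose I (n : nat) : set Rm := `]- n.+1%:R, n.+1%:R]%classic.
have mI n : measurable (I n) by exact: measurable_itv.
have UI : \bigcup_n I n = setT.
  apply/seteqP; split=> // l _.
  exists (Num.Def.archi_bound `|l|) => //; rewrite /I/= in_itv/=.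
  have := archi_boundP (normr_ge0 l); set N := Num.Def.archi_bound _ => lN.
  have {}lN : `|l| < N.+1%:R by apply: (lt_le_trans lN); rewrite ler_nat.
  by move: lN; rewrite ltr_norml => /andP[-> /ltW].
have homoI : {homo I : n m / (n <= m)%N >-> (n <= m)%O}.
  move=> n m nm; rewrite subsetEset => l; rewrite /I /= !in_itv/= => /andP[h1 h2].
  have nm' : n.+1%:R <= m.+1%:R :> R by rewrite ler_nat.
  by apply/andP; split; [apply: le_lt_trans h1; rewrite lerN2|exact: le_trans nm'].
have cvgI : mu y (I n) @[n --> \oo] --> mu y setT.
  by rewrite -UI; apply: nondecreasing_cvg_mu => //; rewrite UI.
set c := vnorm x + s^-1 * vnorm y.
have c0 : 0 <= c by rewrite addr_ge0 ?vnorm_ge0// mulr_ge0 ?vnorm_ge0// invr_ge0 ltW.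
apply/eqP; rewrite -normr_le0 leNgt; apply/negP => f0.
set f := `|form_defect setT| in f0.
pose e := (f / (c + 1)) ^+ 2.
have c1 : 0 < c + 1 by rewrite ltr_wpDl.
have e0 : 0 < e by rewrite exprn_gt0// divr_gt0.
have [n yn] : exists n, vnorm y ^+ 2 - e < vnorm (E (I n) y) ^+ 2.
  have : (vnorm (E (I n) y) ^+ 2)%:E @[n --> \oo] --> (vnorm y ^+ 2)%:E.
    rewrite -(pvm_scalar_setT E); apply: cvg_trans cvgI; apply: near_eq_cvg.
    by apply: nearW => n; rewrite -pvm_scalar_sq.
  move/fine_cvgP => [_ cv].
  have [|N _ /(_ N (leqnn _))] := @cvgr_gt _ _ _ _ _ _ cv (vnorm y ^+ 2 - e) _.
    by rewrite ltrBlDr ltrDl.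
  by exists N.
have mCI : measurable (~` I n) by exact: measurableC.
have h1 : f <= c * vnorm (E (~` I n) y).
  rewrite /f -(setUv (I n)) form_defectU// ?setICr// form_defect_interval ?ltr0n// add0r.
  exact: form_defect_bound.
have h2 : vnorm (E (~` I n) y) ^+ 2 < e.
  have : vnorm y ^+ 2 = vnorm (E (I n) y) ^+ 2 + vnorm (E (~` I n) y) ^+ 2.
    by rewrite -pvm_sqU// ?setICr// setUv pvm_setT.
  lra.
have h3 : vnorm (E (~` I n) y) < f / (c + 1).
  by rewrite -ltr_sqr ?nnegrE ?vnorm_ge0// divr_ge0// ltW.
have : c * vnorm (E (~` I n) y) < f.
  have h4 : (c + 1) * vnorm (E (~` I n) y) < f by rewrite mulrC -ltr_pdivlMr.
  by have := vnorm_ge0 (E (~` I n) y); lra.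
by move/(le_lt_trans h1); rewrite ltxx.
Qed.

End ResolventForm.

(** * Angles along segments *)

Section ArcTangent.
Variable R : realType.
Implicit Types (l u v w e : R).

Definition seg_den l w : R := w ^+ 2 * l ^+ 2 + (1 - w) ^+ 2.
Definition seg_kernel l w : R := l / seg_den l w.
(** The argument of the point w l + (1 - w) i, measured clockwise from the
imaginary axis; seg_kernel is its derivative in w. *)
Definition seg_angle l w : R := atan (l * (w / (1 - w))).

Lemma seg_den_ge e l w : 0 < e -> e <= w -> w <= 1 - e ->
  e ^+ 2 * (l ^+ 2 + 1) <= seg_den l w.
Proof.
move=> e0 ew we; rewrite /seg_den mulrDr mulr1; apply: lerD.
  by rewrite ler_wpM2r ?sqr_ge0// lerXn2r ?nnegrE; lra.
by rewrite lerXn2r ?nnegrE; lra.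
Qed.

Lemma seg_den_gt0 e l w : 0 < e -> e <= w -> w <= 1 - e -> 0 < seg_den l w.
Proof.
move=> e0 ew we; apply: lt_le_trans (seg_den_ge l e0 ew we).
by rewrite mulr_gt0 ?exprn_gt0// ltr_wpDl// sqr_ge0.
Qed.

Lemma twice_norm_le l : 2 * `|l| <= l ^+ 2 + 1.
Proof.
have h2 : `|l| ^+ 2 = l ^+ 2 by rewrite real_normK// num_real.
by rewrite -h2; have := sqr_ge0 (`|l| - 1); lra.
Qed.

Lemma seg_kernel_le e l w : 0 < e -> e <= w -> w <= 1 - e ->
  `|seg_kernel l w| <= e ^- 2.
Proof.
move=> e0 ew we; have D0 := seg_den_gt0 l e0 ew we.
rewrite /seg_kernel normrM normfV (gtr0_norm D0) ler_pdivrMr// ler_pdivlMl ?exprn_gt0//.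
apply: le_trans (seg_den_ge l e0 ew we); rewrite ler_wpM2l ?sqr_ge0//.
by have := twice_norm_le l; have := normr_ge0 l; lra.
Qed.

Lemma seg_kernel_lip e l u v : 0 < e -> e <= u -> u <= 1 - e ->
  e <= v -> v <= 1 - e ->
  `|seg_kernel l v - seg_kernel l u| <= e ^- 4 * `|v - u|.
Proof.
move=> e0 eu ue ev ve.
have Du := seg_den_gt0 l e0 eu ue; have Dv := seg_den_gt0 l e0 ev ve.
have Gu := seg_den_ge l e0 eu ue; have Gv := seg_den_ge l e0 ev ve.
have -> : seg_kernel l v - seg_kernel l u =
    l * ((2 - u - v) - (u + v) * l ^+ 2) / (seg_den l u * seg_den l v) * (v - u).
  have -> : seg_kernel l v - seg_kernel l u =
      l * (seg_den l u - seg_den l v) / (seg_den l u * seg_den l v).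
    by rewrite /seg_kernel; field; rewrite !gt_eqF.
  by rewrite {1 2}/seg_den; ring.
rewrite normrM ler_wpM2r// normrM normfV (gtr0_norm (mulr_gt0 Du Dv)).
rewrite ler_pdivrMr ?mulr_gt0// ler_pdivlMl ?exprn_gt0//.
set a := l ^+ 2 + 1; have a0 : 0 < a by rewrite ltr_wpDl// sqr_ge0.
apply: (@le_trans _ _ (e ^+ 2 * a * (e ^+ 2 * a))); last first.
  by apply: ler_pM => //; rewrite mulr_ge0 ?sqr_ge0// ltW.
have -> : e ^+ 2 * a * (e ^+ 2 * a) = e ^+ 4 * (a * a) by ring.
rewrite ler_wpM2l ?exprn_ge0 ?(ltW e0)// normrM.
have h1 := twice_norm_le l; rewrite -/a in h1.
have h2 : `|2 - u - v - (u + v) * l ^+ 2| <= 2 * a.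
  by have := sqr_ge0 l; rewrite /a ler_norml; move=> ?; apply/andP; split; nra.
have : `|l| * `|2 - u - v - (u + v) * l ^+ 2| <= `|l| * (2 * a) by rewrite ler_wpM2l.
by move/le_trans; apply; nra.
Qed.

Lemma seg_angle_derive e l w : 0 < e -> e <= w -> w <= 1 - e ->
  is_derive w 1 (seg_angle l) (seg_kernel l w).
Proof.
move=> e0 ew we.
have w1 : 1 - w != 0 by rewrite gt_eqF//; lra.
have D0 := seg_den_gt0 l e0 ew we.
have d1 : is_derive w 1 (fun w : R => l * (w / (1 - w))) (l / (1 - w) ^+ 2).
  have dW : is_derive w (1 : R) (fun w : R => 1 - w) (-1).
    by apply: is_derive_eq; rewrite add0r mul1r.
  have dV := @is_deriveV R (fun w : R => 1 - w) w _ 1 w1 dW.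
  have dM : is_derive w (1 : R) (fun w : R => w / (1 - w))
      (w *: (- (1 - w) ^- 2 *: (-1)) + (1 - w)^-1 *: 1).
    exact: (@is_deriveM R R id (fun y : R => (1 - y)^-1) w 1 _ _ (is_derive_id w 1) dV).
  have := @is_deriveZ R R R (fun w : R => w / (1 - w)) l w 1 _ dM.
  move=> h; apply: (is_derive_eq h).
  by rewrite /GRing.scale /=; field.
have d2 : is_derive (l * (w / (1 - w))) 1 (@atan R) ((1 + (l * (w / (1 - w))) ^+ 2)^-1).
  exact: is_derive1_atan.
have d3 := @is_derive1_comp R atan (fun w : R => l * (w / (1 - w))) w _ _ d2 d1.
apply: (is_derive_eq d3).
have -> : (l * (w / (1 - w))) ^+ 2 = l ^+ 2 * w ^+ 2 / (1 - w) ^+ 2 by field.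
have q0 : 0 < (1 - w) ^+ 2 by rewrite lt_def sqrf_eq0 w1 sqr_ge0.
have -> : 1 + l ^+ 2 * w ^+ 2 / (1 - w) ^+ 2 = seg_den l w / (1 - w) ^+ 2.
  by rewrite /seg_den; field.
by rewrite /seg_kernel; field; rewrite w1 gt_eqF.
Qed.

Lemma seg_angle_expand e l u v : 0 < e -> e <= u -> u <= v -> v <= 1 - e ->
  `|seg_angle l v - seg_angle l u - (v - u) * seg_kernel l u| <= e ^- 4 * (v - u) ^+ 2.
Proof.
move=> e0 eu uv ve.
have [->|neq] := eqVneq u v; first by rewrite !subrr mul0r subrr normr0 expr0n mulr0.
have ltuv : u < v by rewrite lt_def eq_sym neq.
have [||c /andP[uc cv] ->] := @MVT R (seg_angle l) (seg_kernel l) u v ltuv.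
- move=> w; rewrite in_itv/= => /andP[uw wv].
  by apply: (seg_angle_derive l e0); lra.
- apply: derivable_within_continuous => w; rewrite in_itv/= => /andP[uw wv].
  by case: (seg_angle_derive l e0 (le_trans eu uw) (le_trans wv ve)).
move: uc cv; rewrite !bnd_simp => uc cv.
rewrite mulrC -mulrBr normrM (gtr0_norm (_ : 0 < v - u)) ?subr_gt0//.
rewrite expr2 mulrA [leRHS]mulrC ler_wpM2l ?subr_ge0//.
apply: (le_trans (@seg_kernel_lip e l u c e0 _ _ _ _)); [lra..|].
rewrite ler_wpM2l ?invr_ge0 ?exprn_ge0 ?(ltW e0)//.
by rewrite ger0_norm; lra.
Qed.

End ArcTangent.

(** * Integrating the angle against a finite measure *)

Section AngleIntegral.
Variables (R : realType).
Local Notation Rm := (measurableTypeR R).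
Variable mu : {measure set Rm -> \bar R}.
Hypothesis mu_fin : (mu setT < +oo)%E.

Lemma fin_integrable (f : R -> R) (M : R) :
  measurable_fun setT (f : Rm -> Rm) -> (forall l, `|f l| <= M) ->
  mu.-integrable setT (EFin \o (f : Rm -> R)).
Proof.
by move=> mf fM; exact: bounded_fun_integrable fM.
Qed.

Lemma measurable_atan_scale (a : R) :
  measurable_fun setT ((fun l => atan (l * a)) : Rm -> Rm).
Proof.
apply: continuous_measurable_fun => l.
apply: (@continuous_comp _ _ _ (fun l : R => l * a) (@atan R)); last exact: continuous_atan.
by apply: cvgM; [exact: cvg_id|exact: cvg_cst].
Qed.

Lemma atan_le (a : R) : `|atan a| <= pi / 2.
Proof. by rewrite ler_norml ltW ?atan_gtNpi2// ltW ?atan_ltpi2. Qed.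

Lemma measurable_seg_kernel (e w : R) : 0 < e -> e <= w -> w <= 1 - e ->
  measurable_fun setT ((fun l => seg_kernel l w) : Rm -> Rm).
Proof.
move=> e0 ew we; apply: continuous_measurable_fun => l; apply: cvgM; first exact: cvg_id.
apply: cvgV; first by rewrite gt_eqF// (seg_den_gt0 l e0 ew we).
apply: cvgD; last exact: cvg_cst.
by apply: cvgM; [exact: cvg_cst|exact: exprn_continuous].
Qed.

Definition angle_integral (w : R) : R := \int[mu]_l seg_angle l w.

Lemma angle_integrable w : mu.-integrable setT (EFin \o ((fun l => seg_angle l w) : Rm -> R)).
Proof.
apply: (@fin_integrable _ (pi / 2)) => [|l]; last exact: atan_le.
exact: measurable_atan_scale.
Qed.

Lemma kernel_integrable (e w : R) : 0 < e -> e <= w -> w <= 1 - e ->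
  mu.-integrable setT (EFin \o ((fun l => seg_kernel l w) : Rm -> R)).
Proof.
move=> e0 ew we; apply: (@fin_integrable _ (e ^- 2)) => [|l].
  exact: measurable_seg_kernel e0 ew we.
exact: seg_kernel_le.
Qed.

Lemma angle_integral_expand (e u v : R) : 0 < e -> e <= u -> u <= v -> v <= 1 - e ->
  `|angle_integral v - angle_integral u - (v - u) * \int[mu]_l seg_kernel l u| <=
  e ^- 4 * (v - u) ^+ 2 * fine (mu setT).
Proof.
move=> e0 eu uv ve.
have iv := angle_integrable v; have iu := angle_integrable u.
have ik := kernel_integrable e0 eu (le_trans uv ve).
have ivu : mu.-integrable setT (EFin \o ((fun l => seg_angle l v - seg_angle l u) : Rm -> R)).
  exact: (@integrableB _ Rm _ _ _ measurableT (EFin \o _) (EFin \o _) iv iu).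
have ikv : mu.-integrable setT (EFin \o ((fun l => (v - u) * seg_kernel l u) : Rm -> R)).
  exact: (@integrableZl _ Rm _ _ _ measurableT _ (EFin \o _) ik).
rewrite /angle_integral -RintegralZl// -RintegralB// -RintegralB//.
have ia : mu.-integrable setT (EFin \o
    ((fun l => seg_angle l v - seg_angle l u - (v - u) * seg_kernel l u) : Rm -> R)).
  exact: (@integrableB _ Rm _ _ _ measurableT (EFin \o _) (EFin \o _) ivu ikv).
apply: (le_trans (le_normr_Rintegral _ ia)) => //.
rewrite -(Rintegral_cst mu measurableT).
apply: le_Rintegral => //; first exact: integrable_norm ia.
  by apply: (@fin_integrable _ `|e ^- 4 * (v - u) ^+ 2|).
by move=> l _; exact: seg_angle_expand.
Qed.

Lemma integral_atan_cvg (a : nat -> R) (f : R -> R) :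
  measurable_fun setT (f : Rm -> Rm) ->
  (forall l, atan (l * a n) @[n --> \oo] --> f l) ->
  \int[mu]_l atan (l * a n) @[n --> \oo] --> \int[mu]_l f l.
Proof.
move=> mf af.
have mfn n : measurable_fun setT (fun l : Rm => (atan (l * a n))%:E).
  by apply/measurable_EFinP; exact: measurable_atan_scale.
have mf' : measurable_fun setT (EFin \o (f : Rm -> R)) by exact/measurable_EFinP.
have ig : mu.-integrable setT (EFin \o ((fun=> pi / 2) : Rm -> R)).
  by apply: (@fin_integrable _ (`|pi / 2|)).
have [||intf _] := dominated_convergence measurableT mfn mf' _ ig.
- apply: aeW => l _; apply: cvg_EFin; first exact: nearW.
  exact: af.
- by apply: aeW => l n _; rewrite abse_EFin lee_fin atan_le.
rewrite -[X in _ --> X]fineK; last exact: integrable_fin_num.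
by move=> /fine_cvg.
Qed.

Lemma cvg_inv_succ2 : (n.+2%:R^-1 : R) @[n --> \oo] --> 0.
Proof.
have := @cvg_harmonic R; rewrite -cvg_shiftS; apply: cvg_trans.
by apply: near_eq_cvg; exact: nearW.
Qed.

Lemma atan_sg_cvg (l : R) : atan (l * n.+1%:R) @[n --> \oo] --> pi / 2 * Num.sg l.
Proof.
have pos (r : R) : 0 < r -> atan (r * n.+1%:R) @[n --> \oo] --> (pi / 2 : R).
  move=> r0; have h : (n.+1%:R : R) @[n --> \oo] --> +oo.
    by have := @cvgr_idn R; rewrite -(cvg_shiftS (fun n => n%:R : R)).
  have h2 : r * x @[x --> +oo] --> +oo by apply: gt0_cvgMry => //; exact: cvg_id.
  exact: (cvg_comp _ _ h (cvg_comp _ _ h2 (@cvgy_atan R))).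
have [l0|l0|->] := ltgtP l 0.
- rewrite ltr0_sg// mulrN1.
  rewrite (_ : (fun n => _) = (fun n => - atan (- l * n.+1%:R))); last first.
    by apply/funext => n; rewrite mulNr atanN opprK.
  by apply: cvgN; apply: pos; rewrite oppr_gt0.
- by rewrite gtr0_sg// mulr1; exact: pos.
- rewrite sgr0 mulr0.
  rewrite (_ : (fun n => _) = (fun n => 0)); first exact: cvg_cst.
  by apply/funext => n; rewrite mul0r atan0.
Qed.

Lemma measurable_sg : measurable_fun setT ((fun l => pi / 2 * Num.sg l) : Rm -> Rm).
Proof.
apply: (@measurable_fun_cvg _ Rm R setT (fun n l => atan (l * n.+1%:R))).
  by move=> n; exact: measurable_atan_scale.
by move=> l _; exact: atan_sg_cvg.
Qed.

Lemma Rintegral_sg (b := pi / 2 : R) : \int[mu]_l (b * Num.sg l) =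
  b * (fine (mu `]0, +oo[%classic) - fine (mu `]-oo, 0[%classic)).
Proof.
have msg : measurable_fun setT ((fun l => b * Num.sg l) : Rm -> Rm).
  exact: measurable_sg.
have ib : mu.-integrable setT (EFin \o ((fun l => b * Num.sg l) : Rm -> R)).
  apply: (@fin_integrable _ `|b|) => // l; rewrite normrM ler_piMr//.
  by rewrite normr_sg; case: (_ != 0).
pose P : set Rm := `]0, +oo[%classic; pose N : set Rm := `]-oo, 0[%classic.
have mP : measurable P by exact: measurable_itv.
have mN : measurable N by exact: measurable_itv.
have m0 : measurable ([set 0] : set Rm) by exact: measurable_set1.
have TE : setT = N `|` ([set 0] `|` P).
  apply/seteqP; split=> // l _; rewrite /N /P /= !in_itv/= andbT.
  by case: (ltgtP l 0) => l0; [left|right; right|right; left].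
have d1 : [disjoint N & [set 0] `|` P].
  rewrite disj_set2E; apply/eqP/seteqP; split=> // l [].
  rewrite /N /P /= !in_itv/= andbT => l0 [l1|l1]; move: l0; first by rewrite l1 ltxx.
  by move/(lt_trans l1); rewrite ltxx.
have d2 : [disjoint [set 0] & P].
  rewrite disj_set2E; apply/eqP/seteqP; split=> // l [].
  by rewrite /N /P /= !in_itv/= andbT => -> ; rewrite ltxx.
have mU := measurableU _ _ m0 mP.
rewrite TE Rintegral_setU//; last by rewrite -TE.
rewrite Rintegral_setU//; last first.
  by apply: (@integrableS _ Rm _ mu setT) ib.
have -> : \int[mu]_(l in N) (b * Num.sg l) = \int[mu]_(l in N) (- b).
  apply: eq_Rintegral => l; rewrite inE /N /= in_itv/= => l0.
  by rewrite ltr0_sg// mulrN1.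
have -> : \int[mu]_(l in P) (b * Num.sg l) = \int[mu]_(l in P) b.
  apply: eq_Rintegral => l; rewrite inE /P /= in_itv/= andbT => l0.
  by rewrite gtr0_sg// mulr1.
have -> : \int[mu]_(l in [set 0]) (b * Num.sg l) = \int[mu]_(l in [set 0]) 0.
  by apply: eq_Rintegral => l; rewrite inE /= => ->; rewrite sgr0 mulr0.
by rewrite !Rintegral_cst//; ring.
Qed.

Lemma angle_integral_cvg1 :
  angle_integral (1 - n.+2%:R^-1) @[n --> \oo] -->
  pi / 2 * (fine (mu `]0, +oo[%classic) - fine (mu `]-oo, 0[%classic)).
Proof.
rewrite -Rintegral_sg.
rewrite (_ : (fun n => _) = (fun n => \int[mu]_l atan (l * n.+1%:R))); last first.
  apply/funext => n; apply: eq_Rintegral => l _; rewrite /seg_angle; congr (atan (l * _)).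
  have N0 : n.+2%:R != 0 :> R by rewrite pnatr_eq0.
  by rewrite subKr invrK mulrBl mul1r mulVf// -natr1 addrK.
apply: integral_atan_cvg; last exact: atan_sg_cvg.
exact: measurable_sg.
Qed.

Lemma angle_integral_cvg0 :
  angle_integral (n.+2%:R^-1) @[n --> \oo] --> 0.
Proof.
have -> : 0 = \int[mu]_l 0 :> R.
  by rewrite Rintegral_cst// mul0r.
rewrite (_ : (fun n => _) = (fun n => \int[mu]_l atan (l * n.+1%:R^-1))); last first.
  apply/funext => n; apply: eq_Rintegral => l _; rewrite /seg_angle; congr (atan (l * _)).
  have N0 : n.+2%:R != 0 :> R by rewrite pnatr_eq0.
  have N1 : n.+1%:R != 0 :> R by rewrite pnatr_eq0.
  rewrite -[n.+2%:R]natr1 in N0 *; move: (n.+1%:R : R) N0 N1 => b N0 N1.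
  have -> : 1 - (b + 1)^-1 = b / (b + 1) by field.
  by field; rewrite N0 N1.
apply: (@integral_atan_cvg _ (fun=> 0)) => //.
move=> l.
rewrite (_ : 0 = @atan R (l * 0)); last by rewrite mulr0 atan0.
have h : (l / n.+1%:R : R) @[n --> \oo] --> l * 0.
  by apply: cvgM; [exact: cvg_cst|exact: cvg_harmonic].
exact: (cvg_comp _ _ h (@continuous_atan R (l * 0))).
Qed.

(** The function Phi plus the integrated angle has increments that are quadratic
on [e, 1 - e], so it takes the same value at both ends. As e tends to 0 the
angle of l tends to 0 at the left end and to pi / 2 times the sign of l at the
right end, with domination by pi / 2. *)
Lemma segment_integral (Phi phi : R -> R) (C M : R) :
  (forall u v : R, 0 <= u -> u <= v -> v <= 1 ->
     `|Phi v - Phi u - (v - u) * phi u| <= C * (v - u) ^+ 2) ->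
  (forall w, 0 <= w <= 1 -> `|phi w| <= M) ->
  (forall w, 0 < w -> w < 1 -> phi w = - \int[mu]_l seg_kernel l w) ->
  Phi 1 - Phi 0 =
  - (pi / 2 * (fine (mu `]0, +oo[%classic) - fine (mu `]-oo, 0[%classic))).
Proof.
move=> PhiP phiM phiE.
pose h w := Phi w + angle_integral w.
(* The derivatives of Phi and of the integrated angle are opposite. *)
have he (e : R) : 0 < e -> e <= 2^-1 -> h (1 - e) = h e.
  move=> e0 e1; apply/eqP; rewrite -subr_eq0 -normr_le0.
  rewrite -[leRHS](mul0r (1 - e - e)).
  pose D := C + e ^- 4 * fine (mu setT).
  apply: (@increment_bound R h (fun w => D * w)); first lra.
  move=> u v eu uv ve; rewrite add0r -mulrBr -mulrA -expr2.
  have u0 : 0 < u by lra.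
  have u1 : u < 1 by lra.
  have h1 : `|Phi v - Phi u - (v - u) * phi u| <= C * (v - u) ^+ 2 by apply: PhiP; lra.
  have h2 := angle_integral_expand e0 eu uv ve.
  have -> : h v - h u = (Phi v - Phi u - (v - u) * phi u) +
    (angle_integral v - angle_integral u - (v - u) * \int[mu]_l seg_kernel l u).
    by rewrite /h phiE//; ring.
  apply: (le_trans (ler_normD _ _)); rewrite /D [leRHS]mulrDl; apply: lerD => //.
  by apply: (le_trans h2); rewrite mulrAC.
have Phi_cont (u v : R) : 0 <= u -> u <= v -> v <= 1 ->
    `|Phi v - Phi u| <= (M + C) * (v - u).
  move=> u0 uv v1.
  have C0 : 0 <= C.
    by have := PhiP 0 1 (lexx _) ler01 (lexx _); rewrite subr0 expr1n mulr1; apply: le_trans.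
  have -> : Phi v - Phi u = (Phi v - Phi u - (v - u) * phi u) + (v - u) * phi u by ring.
  apply: (le_trans (ler_normD _ _)); rewrite [leLHS]addrC [leRHS]mulrDl; apply: lerD.
    rewrite normrM ger0_norm ?subr_ge0// mulrC ler_wpM2r ?subr_ge0//.
    by apply: phiM; rewrite u0 (le_trans uv).
  apply: (le_trans (PhiP _ _ u0 uv v1)); rewrite ler_wpM2l// expr2 ler_piMl ?subr_ge0//; lra.
have cv1 := angle_integral_cvg1; have cv0 := angle_integral_cvg0.
pose a n : R := n.+2%:R^-1.
have a0 n : 0 < a n by rewrite invr_gt0 ltr0n.
have a2 n : a n <= 2^-1 by rewrite lef_pV2 ?posrE ?ltr0n// ler_nat.
have cva : a n @[n --> \oo] --> 0 by exact: cvg_inv_succ2.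
have E n : `|Phi 1 - Phi 0 + (angle_integral (1 - a n) - angle_integral (a n))| <=
    2 * (M + C) * a n.
  have := he _ (a0 n) (a2 n); rewrite /h => Eh.
  have -> : Phi 1 - Phi 0 + (angle_integral (1 - a n) - angle_integral (a n)) =
    (Phi 1 - Phi (1 - a n)) + (Phi (a n) - Phi 0).
    lra.
  have p1 := Phi_cont (1 - a n) 1; have p2 := Phi_cont 0 (a n).
  have := a0 n; have := a2 n => h2 h1.
  apply: (le_trans (ler_normD _ _)).
  have -> : 2 * (M + C) * a n = (M + C) * (1 - (1 - a n)) + (M + C) * (a n - 0) by ring.
  by apply: lerD; [apply: p1; lra|apply: p2; lra].
set X := pi / 2 * _ in cv1 *.
have cvE : Phi 1 - Phi 0 + (angle_integral (1 - a n) - angle_integral (a n)) @[n --> \oo]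
   --> Phi 1 - Phi 0 + (X - 0).
  by apply: cvgD; [exact: cvg_cst|exact: cvgB].
have cvE0 : Phi 1 - Phi 0 + (angle_integral (1 - a n) - angle_integral (a n)) @[n --> \oo] --> 0.
  apply/norm_cvg0P.
  apply: (@squeeze_cvgr _ _ _ _ (fun=> 0) (fun n => 2 * (M + C) * a n)).
  - by apply: nearW => n; rewrite normr_ge0 E.
  - exact: cvg_cst.
  - by rewrite -[X in _ --> X](mulr0 (2 * (M + C))); apply: cvgM => //; exact: cvg_cst.
have e : Phi 1 - Phi 0 + (X - 0) = 0.
  by rewrite -(cvg_lim (@Rhausdorff R) cvE) (cvg_lim (@Rhausdorff R) cvE0).
by move: e; rewrite subr0 => e; lra.
Qed.

End AngleIntegral.

(** * The Xi-operator of an invertible dissipative operator *)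

Section XiOperator.
Variables (R : realType) (H : hilbertType R) (A : set (H -> H)).
Variables (A_vN : von_neumann_algebra A) (id_neq0 : (id : H -> H) != 0).
Local Notation V := (vnop A_vN id_neq0).
Local Notation J := (vn_i A_vN id_neq0).
Local Notation bnd := (@vnbnd _ _ _ A_vN id_neq0).
Local Notation bndP := (vnbndP A_vN id_neq0).
Variable M : V.
Hypotheses (M0 : im_ge 0 M) (uM : M \is a GRing.unit).
Variable D : minimal_dilation M.
Local Notation K := (dil_space D).
Local Notation emb := (@dil_emb _ _ _ D).
Local Notation proj := (@dil_proj _ _ _ D).
Local Notation L := (@dil_op _ _ _ D).
Local Notation E := (@dil_spectral _ _ _ D).
Local Notation Rm := (measurableTypeR R).
Implicit Types (x y h : H) (k : K).

Lemma vnorm_emb y : vnorm (emb y) = vnorm y.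
Proof.
apply/eqP; rewrite -(eqrXn2 (n := 2)) ?vnorm_ge0// -!hre_nn /hre dil_emb_isometry.
by [].
Qed.

Lemma hdot_proj k y : hdot (proj k) y = hdot k (emb y).
Proof. by rewrite hdotJ -(@dil_proj_adjoint _ _ _ D) -hdotJ. Qed.

Lemma hre_proj k y : hre (proj k) y = hre k (emb y).
Proof. by rewrite /hre hdot_proj. Qed.

Lemma proj0 : proj 0 = 0.
Proof. by apply: hre_eq => z; rewrite hre_proj !hre0l. Qed.

Lemma proj_le k : vnorm (proj k) <= vnorm k.
Proof.
have [E0|E0] := eqVneq (vnorm (proj k)) 0; first by rewrite E0 vnorm_ge0.
have X : 0 < vnorm (proj k) by rewrite lt_def E0 vnorm_ge0.
rewrite -(ler_pM2l X) -expr2 -hre_nn hre_proj mulrC -(vnorm_emb (proj k)).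
exact: hre_le.
Qed.

Lemma unit_segment : exists2 p, 0 <= p & invertible_segment bnd J p M.
Proof.
have [m m0 Mm] := unit_lower_bound uM.
exists (m / (m + 2))^-1; last exact: dissipative_segment.
by rewrite invr_ge0 divr_ge0 ?addr_ge0 // ltW.
Qed.

(** At w the segment is w (M + i s) with s = (1 - w) / w, so its inverse is a
multiple of a resolvent of M, which is compressed from that of L. The vector
emb h does lie in the range of L + i s: otherwise the resolvent takes its
default value 0 there, the inverse of the segment kills h, and h is 0. *)
Lemma segment_resolvent (w : R) h : 0 < w -> w < 1 ->
  exists x : K, [/\ udom L x, L x + ((1 - w) / w)%:C *: ('i *: x) = emb h &
    proj x = w%:C *: (segment J M w)^-1 h].
Proof.
move=> w0 w1; have [p p0 /(_ w)] := unit_segment.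
rewrite (ltW w0) (ltW w1) => /(_ isT)[uMw _].
set s := (1 - w) / w; have s0 : 0 < s by rewrite divr_gt0 ?subr_gt0.
pose z : R[i] := - (s%:C * 'i).
have zE (U : lmodType R[i]) (x : U) : - (z *: x) = s%:C *: ('i *: x).
  by rewrite /z scaleNr opprK scalerA.
have z0 : complex.Im z < 0 by rewrite /z /= mul0r addr0 mulr1 oppr_lt0.
have wC : (w%:C : R[i]) != 0 by rewrite eq_complex /= eqxx andbT gt_eqF.
have MwE x : segment J M w x = w%:C *: (M x - z *: x).
  rewrite vn_segmentE scalerDr zE (scalerA _ s%:C) -rmorphM.
  by congr (_ + _%:C *: _); rewrite /s mulrCA divff ?mulr1// gt_eqF.
have [bI MI IM] := vn_unit_inverse uMw.
have linI := bounded_op_linear bI.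
have inv : is_inverse ((M : H -> H) - z *: id) (w%:C *: (GRing.inv (segment J M w) : H -> H)).
  split.
  - rewrite -[_ *: _]addr0; apply: bounded_op_comb => //.
    by apply: (vN_bounded A_vN); exact: vN0.
  - apply/funext => x /=.
    rewrite -[LHS]/(M (w%:C *: (segment J M w)^-1 x) - z *: (w%:C *: (segment J M w)^-1 x)).
    rewrite (linZ _ _ (vn_linear M)) (scalerA z) (mulrC z) -scalerA -scalerBr -MwE.
    by rewrite -vn_mulE divrr.
  - apply/funext => x /=.
    rewrite -[LHS]/(w%:C *: (segment J M w)^-1 (M x - z *: x)).
    rewrite -(linZ _ _ (vn_linear (segment J M w)^-1)) -MwE.
    by rewrite -vn_mulE mulVr.
have := @dil_resolvent _ _ _ D z z0 h; rewrite (inv_opE inv).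
rewrite -[LHS]/(w%:C *: (segment J M w)^-1 h) => resE.
(* If no solution existed, the default value 0 of the resolvent would force h = 0. *)
have res_ex : exists x : K, udom L x /\ L x - z *: x = emb h.
  have [//|nex] := pselect (exists x : K, udom L x /\ L x - z *: x = emb h).
  have r0 : resolvent L z (emb h) = 0.
    by rewrite /resolvent; case: xgetP => // x _ Px; case: nex; exists x.
  rewrite r0 proj0 in resE; move: resE => /eqP; rewrite scaler_eq0 (negPf wC) /= => /eqP I0.
  have h0 : h = 0.
    have : h = segment J M w ((segment J M w)^-1 h) by rewrite -vn_mulE divrr.
    by rewrite I0 => ->; rewrite (lin0 (vn_linear _)).
  exists 0; split; first exact: udom0.
  rewrite uop0 scaler0 subr0 h0.
  have := @dil_emb_linear _ _ _ D (-1) 0 0; rewrite scaleN1r addNr => ->.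
  by rewrite scaleN1r addNr.
exists (resolvent L z (emb h)).
have [D1 D2] := xgetPex 0 res_ex.
by split=> //; rewrite -zE; exact: D2.
Qed.

Definition vec_form y (T : V) : R := him (T y) y.

Lemma vec_formP y : bounded_functional bnd (vnorm y ^+ 2) (vec_form y).
Proof.
split; first exact: sqr_ge0.
- by move=> a S T; rewrite /vec_form vn_addE vn_scaleE himDl himZl.
- move=> b T [b0 Tb]; rewrite /vec_form mulrC expr2 mulrA.
  apply: (le_trans (him_norm_le _ _)).
  by rewrite ler_wpM2r ?vnorm_ge0.
Qed.

(** Since (M - i) = (F_w - i) / w on the segment F_w, the form reduces to that
of the resolvent, which is given by resolvent_form. *)
Lemma segment_form (w : R) y : 0 < w -> w < 1 ->
  vec_form y ((segment J M w)^-1 * (M - J)) =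
  - \int[pvm_scalar E (emb y)]_l seg_kernel l w.
Proof.
move=> w0 w1; have [p p0 /(_ w)] := unit_segment.
rewrite (ltW w0) (ltW w1) => /(_ isT)[uMw _].
have wn0 : w != 0 by rewrite gt_eqF.
have -> : (segment J M w)^-1 * (M - J) = w^-1 *: (1 - J * (segment J M w)^-1).
  have -> : M - J = w^-1 *: (segment J M w - J).
    by rewrite /segment (addrC J) addrK scalerA mulVf// scale1r.
  rewrite -scalerAr mulrBr mulVr//; congr (_ *: (_ - _)).
  by apply/esym; apply: commrV; exact: vn_iC.
have [x [Dx xE px]] := segment_resolvent y w0 w1.
have s0 : 0 < (1 - w) / w by rewrite divr_gt0 ?subr_gt0.
have := resolvent_form (@dil_op_self_adjoint _ _ _ D) (@dil_op_spectral _ _ _ D) s0 Dx xE.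
rewrite -hre_proj px hreZl => rf.
rewrite /vec_form vn_scaleE vn_subE vn_1E vn_mulE vn_iE himZl himDl himNl him_il.
have -> : him y y = 0 by rewrite /him hdot_nn.
have -> : hre ((segment J M w)^-1 y) y =
    w^-1 * \int[pvm_scalar E (emb y)]_l res_kernel ((1 - w) / w) l.
  by rewrite -rf mulKf.
rewrite add0r mulrN; congr (- _); rewrite mulrA.
have fin : (pvm_scalar E (emb y) setT < +oo)%E by exact: pvm_scalar_fin.
rewrite -RintegralZl//; last first.
  apply: (@fin_integrable _ _ fin _ ((1 - w) / w)^-1); last exact: res_kernel_le.
  exact: measurable_res_kernel.
apply: eq_Rintegral => l _; rewrite /res_kernel /seg_kernel /seg_den.
have d0 : w ^+ 2 * l ^+ 2 + (1 - w) ^+ 2 != 0.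
  rewrite gt_eqF//; apply: ltr_wpDl; first by rewrite mulr_ge0 ?sqr_ge0.
  by rewrite exprn_gt0// subr_gt0.
have -> : l ^+ 2 + ((1 - w) / w) ^+ 2 = (w ^+ 2 * l ^+ 2 + (1 - w) ^+ 2) / w ^+ 2 by field.
move: (w ^+ 2 * l ^+ 2 + (1 - w) ^+ 2) d0 => d d0.
by field; rewrite wn0 d0.
Qed.

Lemma hdot_Xi y z : hdot (Xi D y) z =
  hdot (E `]-oo, 0[%classic (emb y)) (emb z) + 2^-1 * hdot (E [set 0] (emb y)) (emb z).
Proof.
by rewrite -[Xi D y]/(proj (E `]-oo, 0[%classic (emb y) + 2^-1 *: E [set 0] (emb y)))
  hdot_proj linearDl /= linearZl_LR.
Qed.

Lemma half_complex : 2^-1 = (2^-1 : R)%:C :> R[i].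
Proof. by rewrite rmorphV ?unitfE ?pnatr_eq0// rmorph_nat. Qed.

Lemma hre_Xi y z : hre (Xi D y) z =
  hre (E `]-oo, 0[%classic (emb y)) (emb z) + 2^-1 * hre (E [set 0] (emb y)) (emb z).
Proof. by rewrite {1}/hre hdot_Xi cReD half_complex cReM /= mul0r subr0. Qed.

Let mneg : measurable (`]-oo, 0[%classic : set Rm). Proof. exact: measurable_itv. Qed.
Let mpos : measurable (`]0, +oo[%classic : set Rm). Proof. exact: measurable_itv. Qed.
Let mzero : measurable ([set 0] : set Rm). Proof. exact: measurable_set1. Qed.

Lemma Xi_sym y z : hre (Xi D y) z = hre y (Xi D z).
Proof.
by rewrite (hreC y) !hre_Xi; congr (_ + _ * _); rewrite pvm_hre// hreC.
Qed.

Lemma him_Xi y : him (Xi D y) y = 0.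
Proof.
rewrite /him hdot_Xi cImD half_complex cImM /= mul0r addr0.
have im0 B : measurable B -> complex.Im (hdot (E B (emb y)) (emb y)) = 0.
  by move=> mB; rewrite -[E B (emb y)]pvmK// pvm_sym// hdot_nn.
by rewrite !im0// mulr0 addr0.
Qed.

Lemma Xi_linear : linear (Xi D).
Proof.
move=> a u v; apply: hdot_eq => z.
rewrite hdot_Xi linearDl /= linearZl_LR /= !hdot_Xi (@dil_emb_linear _ _ _ D).
rewrite !(pvm_linear E) // !linearDl /= !linearZl_LR /=.
by rewrite mulrDr !mulrA (mulrC 2^-1 a) mulrDr mulrA addrACA.
Qed.

Lemma Xi_le y : vnorm (Xi D y) <= 2 * vnorm y.
Proof.
rewrite -[Xi D y]/(proj (E `]-oo, 0[%classic (emb y) + 2^-1 *: E [set 0] (emb y))).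
apply: (le_trans (proj_le _)); apply: (le_trans (vnormD _ _)).
rewrite half_complex vnormZ ger0_norm ?invr_ge0//.
have h1 := pvm_le E (emb y) mneg; have h2 := pvm_le E (emb y) mzero.
rewrite vnorm_emb in h1 h2; have := vnorm_ge0 (E [set 0] (emb y)); lra.
Qed.

Lemma Xi_bounded : bounded_op (Xi D).
Proof.
by apply/bounded_opP; split; [exact: Xi_linear|exists 2; split=> // y; exact: Xi_le].
Qed.

(** On vectors, Xi (M) - 1/2 is the imaginary part of (log M - log i) / pi. *)
Lemma segment_log_vec y :
  segment_log J (vec_form y) M = pi * (hre (Xi D y) y - vnorm y ^+ 2 / 2).
Proof.
have [p p0 segM] := unit_segment; have [b Mb] := bnd_ex bndP (M - J).
have [Phi [<- PhiP]] := segment_log_primitive bndP (vec_formP y) segM Mb.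
have fin : (pvm_scalar E (emb y) setT < +oo)%E by exact: pvm_scalar_fin.
rewrite (segment_integral fin PhiP (M := vnorm y ^+ 2 * (p * b))); last 2 first.
- move=> w w01; apply: (functional_le (vec_formP y)); apply: (bndM bndP) => //.
  by have [] := segM w w01.
- by move=> w; exact: segment_form.
rewrite !pvm_scalar_sq//= hre_Xi !pvm_nn// -(vnorm_emb y).
have -> : vnorm (emb y) ^+ 2 = vnorm (E `]-oo, 0[%classic (emb y)) ^+ 2 +
    (vnorm (E [set 0] (emb y)) ^+ 2 + vnorm (E `]0, +oo[%classic (emb y)) ^+ 2).
  have d1 : `]-oo, 0[ `&` ([set 0] `|` `]0, +oo[) = set0 :> set R.
    apply/seteqP; split=> // l []; rewrite /= !in_itv/= andbT => l0 [l1|l1]; move: l0.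
      by rewrite l1 ltxx.
    by move/(lt_trans l1); rewrite ltxx.
  have d2 : [set 0] `&` `]0, +oo[ = set0 :> set R.
    by apply/seteqP; split=> // l []; rewrite /= !in_itv/= andbT => ->; rewrite ltxx.
  rewrite -pvm_sqU// -pvm_sqU//; last exact: measurableU.
  rewrite (_ : _ `|` _ = setT) ?pvm_setT//.
  apply/seteqP; split=> // l _; rewrite /= !in_itv/= andbT.
  by case: (ltgtP l 0) => l0; [left|right; right|right; left].
by field.
Qed.

(** The bound is uniform in y, so that it is an estimate in norm. *)
Lemma Xi_segment_sum : exists c : R, forall n y,
  `|pi * (hre (Xi D y) y - vnorm y ^+ 2 / 2) - him (segment_sum J M n y) y| <=
  c / n.+1%:R * vnorm y ^+ 2.
Proof.
have [p p0 segM] := unit_segment; have [b Mb] := bnd_ex bndP (M - J).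
exists ((p * b) ^+ 2) => n y; rewrite -segment_log_vec.
have := segment_sum_approx bndP (vec_formP y) segM Mb n.
move/le_trans; apply; rewrite le_eqVlt; apply/orP; left; apply/eqP.
by rewrite -mulrA mulrC.
Qed.

(** By Xi_segment_sum, Xi (M) is a limit in norm of elements of A, made from the
imaginary parts of the Riemann sums. *)
Lemma vN_Xi : A (Xi D).
Proof.
have [c cP] := Xi_segment_sum.
apply: (vN_limit A_vN); first exact: Xi_bounded.
move=> e e0.
have pi0 : 0 < (pi : R) by exact: pi_gt0.
have [n cn] : exists n : nat, c / n.+1%:R <= pi * e.
  exists (Num.Def.archi_bound (`|c| / (pi * e))).
  have pe : 0 < pi * e by rewrite mulr_gt0.
  rewrite ler_pdivrMr ?ltr0n// -ler_pdivrMl// mulrC.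
  have := archi_boundP (divr_ge0 (normr_ge0 c) (ltW pe)).
  set N := Num.Def.archi_bound _ => /ltW h.
  apply: (@le_trans _ _ (`|c| / (pi * e))).
    by rewrite ler_wpM2r ?invr_ge0 ?ler_norm// ltW.
  by apply: (le_trans h); rewrite ler_nat.
pose Z : V := segment_sum J M n.
have AZ : A Z by exact: vnP.
have [Y [AY Ysym Yform]] : exists Y : H -> H, [/\ A Y,
    forall u v, hre (Y u) v = hre u (Y v) & forall u, hre (Y u) u = him (Z u) u].
  exists (im_part Z); split; first exact: vN_im_part.
  - by move=> u v; exact: im_part_sym A_vN _ _ _ AZ.
  - by move=> u; exact: im_part_form A_vN _ _ AZ.
pose S : H -> H := (pi^-1)%:C *: Y + (2^-1)%:C *: id.
have SE x : S x = (pi^-1)%:C *: Y x + (2^-1)%:C *: x by [].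
have AS : A S.
  apply: (vN_comb A_vN) => //.
  by apply: (vN_scale A_vN); exact: vN_id.
exists S => //; split; first exact: ltW.
have linS := vN_linear A_vN AS.
have SBE x : (Xi D - S) x = Xi D x - S x by [].
move=> x; apply: (@symmetric_form_bound R H setT (Xi D - S) e) => //.
- move=> r u v _ _; rewrite !SBE Xi_linear linS.
  by rewrite scalerBr opprD addrACA.
- move=> u v _ _; rewrite !SBE hreBl hreBr Xi_sym; congr (_ - _).
  by rewrite !SE hreDl hreDr !hreZl !hreZr Ysym.
- move=> u _; rewrite SBE hreBl SE hreDl !hreZl hre_nn Yform.
  have := cP n u; rewrite -/Z => h.
  have -> : hre (Xi D u) u - (pi^-1 * him (Z u) u + 2^-1 * vnorm u ^+ 2) =
    pi^-1 * (pi * (hre (Xi D u) u - vnorm u ^+ 2 / 2) - him (Z u) u).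
    by rewrite mulrBr mulKf ?gt_eqF//; set q := pi^-1 * _; lra.
  rewrite normrM ger0_norm ?invr_ge0 ?(ltW pi0)// ler_pdivrMl//.
  by apply: (le_trans h); rewrite [leRHS]mulrA ler_wpM2r ?sqr_ge0.
Qed.

Section XiTrace.
Variable tau : (H -> H) -> R[i].
Hypothesis tauP : state_on A tau.

Definition tau_form (T : V) : R := complex.Im (tau T).

Lemma tau_formP : bounded_functional bnd 1 tau_form.
Proof.
split=> //.
- move=> a S T; rewrite /tau_form.
  rewrite -[vnval (a *: S + T)]/(a%:C *: (S : H -> H) + (T : H -> H)).
  rewrite (tau_comb tauP); [|exact: vnP..].
  by rewrite cImD cImM /= mul0r addr0.
- move=> b T [b0 Tb]; rewrite mul1r; apply: (Im_tau_le A_vN tauP (vnP T)) => x.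
  by apply: (le_trans (him_norm_le _ _)); rewrite expr2 mulrA ler_wpM2r ?vnorm_ge0.
Qed.

(** The same Riemann sums approximate both Xi (M) in norm and the logarithm under
the state. *)
Lemma tau_Xi : tau (Xi D) = (2^-1 + segment_log J tau_form M / pi)%:C.
Proof.
have pi0 : 0 < (pi : R) by exact: pi_gt0.
have [X0 _] : complex.Im (tau (Xi D)) = 0 /\ `|complex.Re (tau (Xi D))| <= 2.
  apply: (tau_real_form A_vN tauP vN_Xi) => x; first exact: him_Xi.
  apply: (le_trans (hre_norm_le _ _)); rewrite expr2 mulrA ler_wpM2r ?vnorm_ge0//.
  exact: Xi_le.
apply: complex_eq => //=.
set l := segment_log _ _ _; set r := complex.Re _.
suff E0 : l = pi * (r - 2^-1) by rewrite E0 mulrC mulKf ?gt_eqF//; lra.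
have [c cP] := Xi_segment_sum.
have [p p0 segM] := unit_segment; have [b Mb] := bnd_ex bndP (M - J).
apply/eqP; rewrite -subr_eq0 -normr_le0.
apply: (@ler_add_invnat R _ _ ((p * b) ^+ 2 + c)) => n; rewrite add0r.
pose Z : V := segment_sum J M n.
have h1 := segment_sum_approx bndP tau_formP segM Mb n.
rewrite -/Z -/l mul1r in h1.
have h2 : `|complex.Im (tau Z) - pi * (r - 2^-1)| <= c / n.+1%:R.
  have tau1 : tau id = 1 by case: tauP.
  (* T is Z - i pi (Xi (M) - 1/2), whose form has a small imaginary part. *)
  pose T : H -> H := (- (pi%:C * 'i)) *: (Xi D + (- (2^-1)%:C) *: id) + (Z : H -> H).
  have AX : A (Xi D + (- (2^-1)%:C) *: id).
    by apply: (vN_add A_vN); [exact: vN_Xi|apply: (vN_scale A_vN); exact: vN_id].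
  have AT : A T by apply: (vN_comb A_vN) => //; exact: vnP.
  have TE : complex.Im (tau T) = complex.Im (tau Z) - pi * (r - 2^-1).
    rewrite /T (tau_comb tauP) //; last exact: vnP.
    rewrite (tauD tauP)//; [|exact: vN_Xi|by apply: (vN_scale A_vN); exact: vN_id].
    rewrite (tauZ A_vN tauP); last exact: vN_id.
    rewrite tau1 cImD cImM !cReD !cImD !cReN !cImN /= X0 -/r.
    ring.
  rewrite -TE; apply: (Im_tau_le A_vN tauP AT) => x.
  have -> : T x = (- (pi%:C * 'i)) *: (Xi D x - (2^-1)%:C *: x) + Z x.
    by rewrite -[LHS]/((- (pi%:C * 'i)) *: (Xi D x + (- (2^-1)%:C) *: x) + Z x) (scaleNr _ x).
  rewrite himDl scaleNr himNl -scalerA himZl him_il hreBl hreZl hre_nn.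
  rewrite -normrN opprD opprK.
  have -> : pi * (hre (Xi D x) x - 2^-1 * vnorm x ^+ 2) - him (Z x) x =
     pi * (hre (Xi D x) x - vnorm x ^+ 2 / 2) - him (Z x) x by ring.
  exact: cP.
have -> : l - pi * (r - 2^-1) = (l - tau_form Z) + (complex.Im (tau Z) - pi * (r - 2^-1)).
  by rewrite /tau_form; ring.
by apply: (le_trans (ler_normD _ _)); rewrite [leRHS]mulrDl; apply: lerD.
Qed.

End XiTrace.
End XiOperator.

(** * The index of a Schur complement *)

(** The operators are given up to equality of functions because the dilations
are those of the functions themselves, not of elements of the algebra. *)
Lemma xi_index_segment_log (R : realType) (H : hilbertType R) (A : set (H -> H))
    (A_vN : von_neumann_algebra A) (id_neq0 : (id : H -> H) != 0)
    (tau : (H -> H) -> R[i]) (tauP : state_on A tau)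
    (M N : vnop A_vN id_neq0) (M' N' : H -> H)
    (DM : minimal_dilation M') (DN : minimal_dilation N') :
  im_ge 0 M -> M \is a GRing.unit -> im_ge 0 N -> N \is a GRing.unit ->
  M = M' :> (H -> H) -> N = N' :> (H -> H) ->
  xi_index tau DM DN =
  ((segment_log (vn_i A_vN id_neq0) (@tau_form _ _ _ A_vN id_neq0 tau) N -
    segment_log (vn_i A_vN id_neq0) (@tau_form _ _ _ A_vN id_neq0 tau) M) / pi)%:C.
Proof.
move=> M0 uM N0 uN ME NE; case: _ / ME in DM *; case: _ / NE in DN *.
rewrite /xi_index (tau_Xi M0 uM DM tauP) (tau_Xi N0 uN DN tauP) -rmorphB.
by rewrite addrAC opprD addrA subrr add0r addrC -mulrBl.
Qed.

Theorem theorem3p3 (R : realType) (H : hilbertType R) (A : set (H -> H))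
    (tau : (H -> H) -> R[i]) (K M N : H -> H)
    (A_vN : von_neumann_algebra A) (A_finite : finite_type A)
    (tau_state : normal_tracial_state A tau)
    (AK : A K) (DM : invertible_dissipative A M)
    (DN : invertible_dissipative A N)
    (invM' : boundedly_invertible (M - (adj K \o inv_op N \o K)))
    (invN' : boundedly_invertible (N - (K \o inv_op M \o adj K)))
    (LM : minimal_dilation M)
    (LM' : minimal_dilation (M - (adj K \o inv_op N \o K)))
    (LN : minimal_dilation N)
    (LN' : minimal_dilation (N - (K \o inv_op M \o adj K))) :
  xi_index tau LM LM' = xi_index tau LN LN'.
Proof.
have [tauP tauC _] := tau_state.
have id_neq0 : (id : H -> H) != 0.
  apply/eqP => id0; have tau1 : tau id = 1 by case: tauP.
  by move: tau1; rewrite id0 (tau0 A_vN tauP) => /eqP; rewrite eq_sym oner_eq0.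
have [AM dM [M1 MM1]] := DM; have [AN dN [N1 NN1]] := DN.
have [AK' KK'] := vN_adj A_vN AK.
pose vM := VNOp A_vN id_neq0 AM; pose vN := VNOp A_vN id_neq0 AN.
pose vK := VNOp A_vN id_neq0 AK; pose vK' := VNOp A_vN id_neq0 AK'.
have [uM ME] := vn_inverse_unit (T := vM) MM1.
have [uN NE] := vn_inverse_unit (T := vN) NN1.
have M0 : im_ge 0 vM by exact: dissipative_im_ge.
have N0 : im_ge 0 vN by exact: dissipative_im_ge.
have SM : schur vK' vN vK vM = M - (adj K \o inv_op N \o K) :> (H -> H).
  by rewrite (inv_opE NN1) -NE.
have SN : schur vK vM vK' vN = N - (K \o inv_op M \o adj K) :> (H -> H).
  by rewrite (inv_opE MM1) -ME.
have [uSM _] : schur vK' vN vK vM \is a GRing.unit /\ True.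
  by case: invM' => S; rewrite -SM => /vn_inverse_unit[].
have [uSN _] : schur vK vM vK' vN \is a GRing.unit /\ True.
  by case: invN' => S; rewrite -SN => /vn_inverse_unit[].
have S0 : im_ge 0 (schur vK' vN vK vM).
  by apply: im_ge_schur => //; exact: is_adjoint_sym.
have T0 : im_ge 0 (schur vK vM vK' vN) by exact: im_ge_schur.
rewrite (xi_index_segment_log tauP LM LM' M0 uM S0 uSM)//.
rewrite (xi_index_segment_log tauP LN LN' N0 uN T0 uSN)//.
congr ((_ / pi)%:C).
apply: (dissipative_log_schur (tau_formP A_vN id_neq0 tauP)) => //.
by move=> S T; rewrite /tau_form; congr (complex.Im _); apply: tauC; exact: vnP.
Qed.
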